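(* Given $\rho\in(1/2,\infty)\setminus\{1\}$, there exists a $\rho$-regular set $\Lambda$ with $\sigma_U(\Lambda)<\sigma_Z(\Lambda)$.
   Context: For $\sigma\ge 0$, $\mathcal E_{\rho,\sigma}$ is the class of entire functions of order $\rho$ and of type not exceeding $\sigma$, meaning: for each $\varepsilon>0$ there is $C_\varepsilon$ with $|f(z)|\le C_\varepsilon e^{(\sigma+\varepsilon)|z|^\rho}$ for all $z\in\mathbb C$. $\Lambda\subset\mathbb C$ is a discrete set (no finite accumulation points), whose points may carry multiplicities; all counts and sums take multiplicities into account. $f|_\Lambda=0$ means that $f$ vanishes at each point of $\Lambda$ with at least its multiplicity; $f^{-1}\{0\}=\Lambda$ means that the zeros of $f$, with multiplicities, are exactly the points of $\Lambda$. $\Lambda$ is a uniqueness set for a class $\mathcal A$ of entire functions if $f\in\mathcal A$, $f|_\Lambda=0$ imply $f\equiv0$. Put $$\sigma_U(\Lambda)=\sup\{\sigma:\Lambda\text{ is a uniqueness set for }\mathcal E_{\rho,\sigma}\}=\inf\{\sigma:\exists f\in\mathcal E_{\rho,\sigma}\setminus\{0\}:\ f|_\Lambda=0\},$$ $$\sigma_Z(\Lambda)=\inf\{\sigma:\ \exists f\in\mathcal E_{\rho,\sigma}:\ f^{-1}\{0\}=\Lambda\}$$ ($\sigma$ ranging over $[0,\infty)$, and the supremum of the empty set being $0$). $\Lambda$ has an angular density (with respect to the order $\rho$) if for all $\alpha<\beta$ (angles mod $2\pi$), except maybe countably many values of the angles, the limit $\Delta_\Lambda(\alpha,\beta)=\lim_{R\to\infty}n_\Lambda(R;\alpha,\beta)/R^\rho$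 exists, where $n_\Lambda(R;\alpha,\beta)=\#\{\lambda\in\Lambda:|\lambda|<R,\ \arg\lambda\in(\alpha,\beta)\}$. $\Lambda$ is $\rho$-regular if it has an angular density with respect to the order $\rho$ and, when $\rho$ is an integer, in addition the Lindelöf condition holds: $\lim_{R\to\infty}\sum_{0<|\lambda|\le R}\lambda^{-\rho}$ (sum over $\lambda\in\Lambda$) exists and is finite. *)

(* Defs.v *)
From Stdlib Require Export Reals List Lra ClassicalEpsilon Classical.
From Coquelicot Require Export Coquelicot.
Import ListNotations.
Open Scope R_scope.

(** * Entire functions *)

Definition entire (f : C -> C) : Prop :=
  forall z : C, ex_derive (K := C_AbsRing) (V := C_NormedModule) f z.

(* [x ^ rho] for [0 <= x] and [0 < rho]; the junk value [Rpower 0 rho = 1] is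
   replaced by 0. *)
Definition rpow (x rho : R) : R := if Rlt_dec 0 x then Rpower x rho else 0.

Definition class_E (rho sigma : R) (f : C -> C) : Prop :=
  entire f /\
  forall eps : R, 0 < eps ->
    exists K : R, forall z : C,
      Cmod (f z) <= K * exp ((sigma + eps) * rpow (Cmod z) rho).

Definition zero_order_ge (f : C -> C) (a : C) (m : nat) : Prop :=
  exists g : C -> C, entire g /\ forall z : C, f z = ((z - a) ^ m * g z)%C.

Definition zero_order_eq (f : C -> C) (a : C) (m : nat) : Prop :=
  exists g : C -> C,
    entire g /\ g a <> RtoC 0 /\ forall z : C, f z = ((z - a) ^ m * g z)%C.

(** * Discrete sets with multiplicities

   A multiset of points is its multiplicity function [L : C -> nat]; its points
   are the [z] with [L z <> 0]. *)

Definition discrete_mset (L : C -> nat) : Prop :=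
  forall r : R, exists l : list C,
    forall z : C, Cmod z <= r -> L z <> 0%nat -> In z l.

(* A duplicate-free list of the points of [L] satisfying [P]; meaningful when
   there are finitely many of them (see [enum_spec]). *)
Definition enum (L : C -> nat) (P : C -> Prop) : list C :=
  epsilon (inhabits [])
    (fun l : list C => NoDup l /\ forall z : C, In z l <-> L z <> 0%nat /\ P z).

Definition mcount (L : C -> nat) (P : C -> Prop) : nat :=
  list_sum (map L (enum L P)).

Definition msum (L : C -> nat) (P : C -> Prop) (F : C -> C) : C :=
  fold_right Cplus (RtoC 0)
    (map (fun z => (RtoC (INR (L z)) * F z)%C) (enum L P)).

Lemma enum_spec (L : C -> nat) (P : C -> Prop) (r : R) :
  discrete_mset L -> (forall z, P z -> Cmod z <= r) ->
  NoDup (enum L P) /\ forall z, In z (enum L P) <-> L z <> 0%nat /\ P z.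
Proof.
intros HL HP; unfold enum; apply epsilon_spec.
destruct (HL r) as [l Hl].
set (b z := if excluded_middle_informative (L z <> 0%nat /\ P z)
            then true else false).
exists (nodup Ceq_dec (filter b l)); split.
  apply NoDup_nodup.
intros z; rewrite nodup_In, filter_In; unfold b.
destruct (excluded_middle_informative _) as [H|H]; intuition.
discriminate.
Qed.

(** * Uniqueness sets and zero sets *)

Definition vanishes_on (f : C -> C) (L : C -> nat) : Prop :=
  forall z : C, zero_order_ge f z (L z).

Definition zeros_are (f : C -> C) (L : C -> nat) : Prop :=
  forall z : C, zero_order_eq f z (L z).

Definition uniqueness_set (A : (C -> C) -> Prop) (L : C -> nat) : Prop :=
  forall f : C -> C, A f -> vanishes_on f L -> forall z : C, f z = RtoC 0.

(* The disjunct [s = 0] implements the convention that the supremum of the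
   empty set is 0. *)
Definition sigma_U (rho : R) (L : C -> nat) : Rbar :=
  Lub_Rbar (fun s : R =>
    s = 0 \/ (0 <= s /\ uniqueness_set (class_E rho s) L)).

(* [Glb_Rbar] of the empty set is [p_infty]. *)
Definition sigma_Z (rho : R) (L : C -> nat) : Rbar :=
  Glb_Rbar (fun s : R =>
    0 <= s /\ exists f : C -> C, class_E rho s f /\ zeros_are f L).

Lemma class_E_mono (rho s t : R) (f : C -> C) :
  s <= t -> class_E rho s f -> class_E rho t f.
Proof.
intros Hst [Hf Hg]; split; [exact Hf|].
intros eps He; destruct (Hg eps He) as [K HK]; exists (Rabs K); intros z.
apply Rle_trans with (1 := HK z).
apply Rle_trans with (Rabs K * exp ((s + eps) * rpow (Cmod z) rho)).
  apply Rmult_le_compat_r; [left; apply exp_pos | apply Rle_abs].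
apply Rmult_le_compat_l; [apply Rabs_pos|].
assert (0 <= rpow (Cmod z) rho).
  unfold rpow; destruct (Rlt_dec _ _); [left; apply exp_pos | lra].
assert (H1 : (s + eps) * rpow (Cmod z) rho <= (t + eps) * rpow (Cmod z) rho)
  by (apply Rmult_le_compat_r; lra).
destruct H1 as [H1|H1]; [left; apply exp_increasing, H1 | rewrite H1; lra].
Qed.

Lemma sigma_U_inf (rho : R) (L : C -> nat) :
  sigma_U rho L =
  Glb_Rbar (fun s : R => 0 <= s /\
    exists f : C -> C,
      class_E rho s f /\ (exists z : C, f z <> RtoC 0) /\ vanishes_on f L).
Proof.
set (B := fun s : R => 0 <= s /\ _).
assert (HB : forall s, 0 <= s -> ~ uniqueness_set (class_E rho s) L -> B s).
  intros s Hs H; split; [exact Hs|].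
  apply NNPP; intros H1; apply H; intros f Hf Hv z.
  apply NNPP; intros H2; apply H1; exists f; eauto.
apply Rbar_le_antisym.
- apply (proj2 (Lub_Rbar_correct _)); intros s Hs.
  apply (proj2 (Glb_Rbar_correct B)); intros t [Ht [f [Hf [[z Hz] Hv]]]].
  destruct Hs as [->|[Hs Hu]]; [exact Ht|].
  apply Rnot_lt_le; intros Hts; apply Hz.
  apply (Hu f); [|exact Hv].
  apply class_E_mono with (2 := Hf); lra.
- unfold sigma_U.
  match goal with |- Rbar_le _ (Lub_Rbar ?A') => set (A := A') end.
  destruct (Lub_Rbar_correct A) as [HA _].
  destruct (Glb_Rbar_correct B) as [HG _].
  assert (H0 : Rbar_le 0 (Lub_Rbar A)) by (apply HA; left; reflexivity).
  destruct (Lub_Rbar A) as [u| |] eqn:E; simpl in H0;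
    [| destruct (Glb_Rbar B); exact I | contradiction].
  destruct (Glb_Rbar B) as [g| |] eqn:E'; simpl; [| |exact I].
  + apply Rnot_lt_le; intros Hug.
    set (t := (u + g) / 2); assert (u < t < g) by (unfold t; lra).
    assert (Ht : ~ A t) by (intros HAt; specialize (HA t HAt); simpl in HA; lra).
    assert (HBt : B t).
      apply HB; [lra|]; intros Hu; apply Ht; right; split; [lra|exact Hu].
    specialize (HG t HBt); simpl in HG; lra.
  + assert (Ht : ~ A (u + 1)).
      intros HAt; specialize (HA (u + 1) HAt); simpl in HA; lra.
    assert (HBt : B (u + 1)).
      apply HB; [lra|]; intros Hu; apply Ht; right; split; [lra|exact Hu].
    exact (HG (u + 1) HBt).
Qed.

(** * Regularity *)

(* Some determination of [arg z] lies in [(alpha, beta)]; [arg 0] is undefined,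
   so the origin belongs to no sector. *)
Definition in_sector (alpha beta : R) (z : C) : Prop :=
  z <> RtoC 0 /\
  exists theta : R, alpha < theta < beta /\
    z = (Cmod z * cos theta, Cmod z * sin theta).

Definition n_sector (L : C -> nat) (r alpha beta : R) : nat :=
  mcount L (fun z => Cmod z < r /\ in_sector alpha beta z).

(* The range of [u] contains the exceptional angles. *)
Definition has_angular_density (rho : R) (L : C -> nat) : Prop :=
  exists u : nat -> R, forall alpha beta : R,
    alpha < beta ->
    (forall k, u k <> alpha) -> (forall k, u k <> beta) ->
    ex_finite_lim (fun r => INR (n_sector L r alpha beta) / Rpower r rho) p_infty.

Definition lindelof (n : nat) (L : C -> nat) : Prop :=
  exists l : C,
    filterlim
      (fun r : R => msum L (fun z => 0 < Cmod z <= r) (fun z => (/ z ^ n)%C))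
      (Rbar_locally p_infty) (locally (T := C_UniformSpace) l).

Definition rho_regular (rho : R) (L : C -> nat) : Prop :=
  has_angular_density rho L /\ forall n : nat, rho = INR n -> lindelof n L.

(* Main.v *)
Require Import Defs.
From Stdlib Require Import Reals Lia ZArith Permutation.
From Coquelicot Require Import Coquelicot.
Open Scope R_scope.

(* Let rho < m < 2 rho, so that tau = rho / m lies in (1/2, 1), and let [L] be
   the set of all z with z^m = k^(1/tau) for some k >= 1: m equally spaced rays,
   each with counting function ~ r^rho.  Since m does not divide rho when rho is
   an integer, the sums in the Lindelof condition vanish by symmetry.

   Let A = int_R e^(tau s) / (1 + e^s) ds.  The product G(w) of the
   1 - w / k^(1/tau) has indicator A cos(tau (pi - theta)), 0 <= theta <= 2 pi.
   A function f with zero set exactly [L] is, after averaging log |f| over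
   rotations by 2 pi / m, no better than G(z^m): the order rho is less than m, so
   a zero-free function contributes nothing to the average.  On the rays
   z^m < 0 this forces type at least A.

   Allowing additional zeros, take f(z) = G(z^m) G(- c' z^m) with
   c'^tau = c = - cos(pi tau) > 0.  Its indicator in terms of u = |arg(- z^m)| is
   A (cos(tau u) + c cos(tau (pi - u))) = A sin(pi tau) sin(tau (pi - u)),
   so its type is at most A sin(pi tau) < A.

   Everything complex-analytic is derived from Goursat's theorem for rectangles,
   pulled back by the exponential to circles. *)

(** * Complex differentiability *)

(** No factorization theorem for entire functions is used. For the lower bound, finitely many zeros
    of [f] are divided out by a polynomial; the quotient has a logarithm on a disc of radius [r],
    with [r ^ m] of order [n ^ (1 / tau)], whose real part is only known to be at most of order
    [n ln n]. The usual Harnack inequality would transport this to a fixed point with an error of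
    size [n ln n / r], useless for [rho >= 1]. Invariance under rotation by [2 pi / m] improves
    [1 / r] to [1 / r ^ m], and as [1 / tau > 1] the error tends to 0. This is what [rho < m] is
    for, besides the convergence of [A]. The other inequality, [m < 2 rho], makes [cos (pi tau)]
    negative, so that [c] is positive and the additional zeros exist. Only one-sided estimates of
    growth occur: upper bounds in all directions, and a lower bound in the single direction
    [z ^ m < 0]. The behaviour of [ln |G|] close to its zeros, where it is unbounded below,
    therefore never has to be analysed. *)

Definition ccont (f : C -> C) (z : C) : Prop :=
  forall eps : R, 0 < eps -> exists del : R, 0 < del /\
    forall w : C, Cmod (w - z) < del -> Cmod (f w - f z) < eps.

Definition cderiv (f : C -> C) (z d : C) : Prop :=
  forall eps : R, 0 < eps -> exists del : R, 0 < del /\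
    forall w : C, Cmod (w - z) < del ->
      Cmod (f w - f z - d * (w - z)) <= eps * Cmod (w - z).

Definition cdiff (f : C -> C) (z : C) : Prop := exists d, cderiv f z d.

Lemma is_derive_cderiv (f : C -> C) (z d : C) :
  is_derive (K := C_AbsRing) (V := C_NormedModule) f z d <-> cderiv f z d.
Proof.
split.
- intros [_ H] eps He.
  specialize (H z (fun P HP => HP) (mkposreal eps He)).
  destruct H as [del H]; exists del; split; [apply cond_pos|].
  intros w Hw; specialize (H w Hw).
  change (Cmod (f w - f z - (w - z) * d) <= eps * Cmod (w - z)) in H.
  now rewrite (Cmult_comm d).
- intros H; split.
  + apply is_linear_scal_l.
  + intros x Hx eps.
    assert (x = z) as ->.
    { symmetry. apply (is_filter_lim_locally_unique (V := AbsRing_NormedModule C_AbsRing)), Hx. }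
    destruct (H eps (cond_pos eps)) as [del [Hd H1]].
    exists (mkposreal del Hd); intros w Hw.
    change (Cmod (f w - f z - (w - z) * d) <= eps * Cmod (w - z)).
    rewrite (Cmult_comm _ d). apply H1, Hw.
Qed.

Lemma entire_cdiff (f : C -> C) : entire f <-> forall z, cdiff f z.
Proof.
split; intros H z.
- destruct (H z) as [d Hd]; exists d; now apply is_derive_cderiv.
- destruct (H z) as [d Hd]; exists d; now apply is_derive_cderiv.
Qed.

Lemma Cmod_sub_sym (a b : C) : Cmod (a - b) = Cmod (b - a).
Proof. rewrite <- Cmod_opp. f_equal. ring. Qed.

Lemma Cmod_sub_triangle (a b c : C) : Cmod (a - c) <= Cmod (a - b) + Cmod (b - c).
Proof.
replace (a - c)%C with ((a - b) + (b - c))%C by ring. apply Cmod_triangle.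
Qed.

Lemma Cmod_sub_ge (a b : C) : Cmod a - Cmod b <= Cmod (a - b).
Proof.
pose proof (Cmod_triangle (a - b) b) as H.
replace (a - b + b)%C with a in H by ring. lra.
Qed.

Lemma ccont_const (c z : C) : ccont (fun _ => c) z.
Proof.
intros eps He; exists 1; split; [lra|]; intros w _.
replace (c - c)%C with (RtoC 0) by ring. now rewrite Cmod_0.
Qed.

Lemma ccont_id (z : C) : ccont (fun w => w) z.
Proof. intros eps He; exists eps; split; auto. Qed.

Lemma ccont_ext_loc (f g : C -> C) (z : C) (r : R) :
  0 < r -> (forall w, Cmod (w - z) < r -> f w = g w) -> ccont g z -> ccont f z.
Proof.
intros Hr E H eps He; destruct (H eps He) as [del [Hd H1]].
exists (Rmin r del); split; [now apply Rmin_pos|]; intros w Hw.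
rewrite !E; [apply H1|..].
- apply Rlt_le_trans with (1 := Hw), Rmin_r.
- replace (z - z)%C with (RtoC 0) by ring. now rewrite Cmod_0.
- apply Rlt_le_trans with (1 := Hw), Rmin_l.
Qed.

Lemma ccont_plus (f g : C -> C) (z : C) :
  ccont f z -> ccont g z -> ccont (fun w => f w + g w)%C z.
Proof.
intros Hf Hg eps He.
destruct (Hf (eps / 2)) as [d1 [H1 Hf1]]; [lra|].
destruct (Hg (eps / 2)) as [d2 [H2 Hg1]]; [lra|].
exists (Rmin d1 d2); split; [now apply Rmin_pos|]; intros w Hw.
specialize (Hf1 w (Rlt_le_trans _ _ _ Hw (Rmin_l _ _))).
specialize (Hg1 w (Rlt_le_trans _ _ _ Hw (Rmin_r _ _))).
replace (f w + g w - (f z + g z))%C with ((f w - f z) + (g w - g z))%C by ring.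
pose proof (Cmod_triangle (f w - f z) (g w - g z)). lra.
Qed.

Lemma ccont_mult (f g : C -> C) (z : C) :
  ccont f z -> ccont g z -> ccont (fun w => f w * g w)%C z.
Proof.
intros Hf Hg eps He.
set (a := Cmod (f z)); set (b := Cmod (g z)).
assert (Ha : 0 <= a) by apply Cmod_ge_0. assert (Hb : 0 <= b) by apply Cmod_ge_0.
set (e := Rmin 1 (eps / (a + b + 2))).
assert (Hq : 0 < eps / (a + b + 2)) by (apply Rdiv_lt_0_compat; lra).
assert (He0 : 0 < e) by (apply Rmin_pos; lra).
assert (He1 : e <= 1) by apply Rmin_l.
assert (He2 : e * (a + b + 2) <= eps).
{ apply Rle_trans with (eps / (a + b + 2) * (a + b + 2)).
  - apply Rmult_le_compat_r; [lra|apply Rmin_r].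
  - right; field; lra. }
destruct (Hf e He0) as [d1 [H1 Hf1]]. destruct (Hg e He0) as [d2 [H2 Hg1]].
exists (Rmin d1 d2); split; [now apply Rmin_pos|]; intros w Hw.
specialize (Hf1 w (Rlt_le_trans _ _ _ Hw (Rmin_l _ _))).
specialize (Hg1 w (Rlt_le_trans _ _ _ Hw (Rmin_r _ _))).
replace (f w * g w - f z * g z)%C
  with ((f w - f z) * (g w - g z) + ((f w - f z) * g z + f z * (g w - g z)))%C by ring.
eapply Rle_lt_trans; [apply Cmod_triangle|].
eapply Rle_lt_trans; [apply Rplus_le_compat_l, Cmod_triangle|].
rewrite !Cmod_mult. fold a b.
pose proof (Cmod_ge_0 (f w - f z)). pose proof (Cmod_ge_0 (g w - g z)). nra.
Qed.

Lemma ccont_inv (f : C -> C) (z : C) :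
  f z <> RtoC 0 -> ccont f z -> ccont (fun w => / f w)%C z.
Proof.
intros Hz Hf eps He.
set (a := Cmod (f z)). assert (Ha : 0 < a) by now apply Cmod_gt_0.
set (e := Rmin (a / 2) (eps * (a * a / 4))).
assert (He0 : 0 < e) by (apply Rmin_pos; [lra|apply Rmult_lt_0_compat; nra]).
destruct (Hf e He0) as [d [Hd H]]; exists d; split; [exact Hd|]; intros w Hw.
specialize (H w Hw).
assert (H1 : Cmod (f w - f z) < a / 2) by (eapply Rlt_le_trans; [exact H|apply Rmin_l]).
assert (H2 : Cmod (f w - f z) < eps * (a * a / 4))
  by (eapply Rlt_le_trans; [exact H|apply Rmin_r]).
pose proof (Cmod_sub_ge (f z) (f w)) as H3. rewrite Cmod_sub_sym in H3. fold a in H3.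
assert (Hw0 : f w <> RtoC 0) by (apply Cmod_gt_0; lra).
replace (/ f w - / f z)%C with (- (f w - f z) * / (f w * f z))%C by (field; auto).
rewrite Cmod_mult, Cmod_opp, Cmod_inv, Cmod_mult by (now apply Cmult_neq_0). fold a.
set (b := Cmod (f w)) in *. set (c := Cmod (f w - f z)) in *.
apply Rmult_lt_reg_r with (b * a); [nra|].
rewrite Rmult_assoc, Rinv_l by nra. 
assert (a * a / 4 < b * a) by nra. nra.
Qed.

Lemma ccont_comp (f g : C -> C) (z : C) :
  ccont f (g z) -> ccont g z -> ccont (fun w => f (g w)) z.
Proof.
intros Hf Hg eps He. destruct (Hf eps He) as [d [Hd H]].
destruct (Hg d Hd) as [d' [Hd' H']]. exists d'; split; auto.
Qed.

(** Carathéodory's form of differentiability: the difference quotient, completed by [d] at [z], is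
    continuous at [z]. The rules of calculus then reduce to algebra and to continuity of slopes,
    without a separate case [w = z]. *)
Lemma cderiv_carath (f : C -> C) (z d : C) :
  cderiv f z d <->
  exists phi : C -> C, ccont phi z /\ phi z = d /\
    forall w, f w = (f z + phi w * (w - z))%C.
Proof.
split.
- intros H.
  exists (fun w => if Ceq_dec w z then d else (f w - f z) / (w - z))%C.
  assert (Hz : (if Ceq_dec z z then d else (f z - f z) / (z - z))%C = d).
  { destruct (Ceq_dec z z); congruence. }
  repeat split; [|exact Hz|].
  + intros eps He. destruct (H (eps / 2)) as [del [Hd H1]]; [lra|].
    exists del; split; [exact Hd|]; intros w Hw. rewrite Hz.
    destruct (Ceq_dec w z) as [->|Hwz].
    * replace (d - d)%C with (RtoC 0) by ring. now rewrite Cmod_0.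
    * assert (Hn : (w - z)%C <> RtoC 0).
      { intros E. apply Hwz. replace w with (w - z + z)%C by ring. rewrite E. ring. }
      replace ((f w - f z) / (w - z) - d)%C
        with ((f w - f z - d * (w - z)) / (w - z))%C by (field; exact Hn).
      rewrite Cmod_div by exact Hn.
      specialize (H1 w Hw). apply Cmod_gt_0 in Hn.
      apply Rle_lt_trans with (eps / 2); [|lra].
      apply Rmult_le_reg_r with (Cmod (w - z)); [exact Hn|].
      unfold Rdiv at 1. rewrite Rmult_assoc, Rinv_l; lra.
  + intros w. destruct (Ceq_dec w z) as [->|Hwz]; [ring|].
    field. intros E. apply Hwz. replace w with (w - z + z)%C by ring. rewrite E. ring.
- intros [phi [Hc [<- E]]] eps He.
  destruct (Hc eps He) as [del [Hd H]]; exists del; split; [exact Hd|]; intros w Hw.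
  rewrite (E w).
  replace (f z + phi w * (w - z) - f z - phi z * (w - z))%C
    with ((phi w - phi z) * (w - z))%C by ring.
  rewrite Cmod_mult. apply Rmult_le_compat_r; [apply Cmod_ge_0|].
  left. now apply H.
Qed.

Lemma cderiv_ccont (f : C -> C) (z d : C) : cderiv f z d -> ccont f z.
Proof.
intros H. apply cderiv_carath in H. destruct H as [phi [Hc [_ E]]].
apply ccont_ext_loc with (g := fun w => (f z + phi w * (w + - z))%C) (r := 1);
  [lra|intros w _; apply E|].
repeat first [apply ccont_plus | apply ccont_mult | apply ccont_const | apply ccont_id | exact Hc].
Qed.

Lemma cdiff_ccont (f : C -> C) (z : C) : cdiff f z -> ccont f z.
Proof. intros [d H]. now apply cderiv_ccont with d. Qed.

Lemma cderiv_ext_loc (f g : C -> C) (z d : C) (r : R) :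
  0 < r -> (forall w, Cmod (w - z) < r -> f w = g w) -> cderiv g z d -> cderiv f z d.
Proof.
intros Hr E H eps He; destruct (H eps He) as [del [Hd H1]].
exists (Rmin r del); split; [now apply Rmin_pos|]; intros w Hw.
rewrite !E; [apply H1|..].
- apply Rlt_le_trans with (1 := Hw), Rmin_r.
- replace (z - z)%C with (RtoC 0) by ring. now rewrite Cmod_0.
- apply Rlt_le_trans with (1 := Hw), Rmin_l.
Qed.

Lemma cdiff_ext_loc (f g : C -> C) (z : C) (r : R) :
  0 < r -> (forall w, Cmod (w - z) < r -> f w = g w) -> cdiff g z -> cdiff f z.
Proof. intros Hr E [d H]; exists d; now apply cderiv_ext_loc with g r. Qed.

Lemma cdiff_ext (f g : C -> C) (z : C) :
  (forall w, f w = g w) -> cdiff g z -> cdiff f z.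
Proof. intros E. apply cdiff_ext_loc with 1; [lra|auto]. Qed.

Lemma cderiv_const (c z : C) : cderiv (fun _ => c) z 0.
Proof.
apply cderiv_carath. exists (fun _ => RtoC 0). split; [apply ccont_const|].
split; [reflexivity|]. intros; ring.
Qed.

Lemma cderiv_id (z : C) : cderiv (fun w => w) z 1.
Proof.
apply cderiv_carath. exists (fun _ => RtoC 1). split; [apply ccont_const|].
split; [reflexivity|]. intros; ring.
Qed.

Lemma cderiv_plus (f g : C -> C) (z a b : C) :
  cderiv f z a -> cderiv g z b -> cderiv (fun w => f w + g w)%C z (a + b).
Proof.
rewrite !cderiv_carath.
intros [p [Hp [Ep Fp]]] [q [Hq [Eq Fq]]]. exists (fun w => p w + q w)%C.
split; [now apply ccont_plus|]. split; [congruence|].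
intros w. rewrite (Fp w), (Fq w). ring.
Qed.

Lemma cderiv_mult (f g : C -> C) (z a b : C) :
  cderiv f z a -> cderiv g z b ->
  cderiv (fun w => f w * g w)%C z (a * g z + f z * b).
Proof.
intros Hf Hg. assert (Cg := cderiv_ccont _ _ _ Hg). revert Hf Hg.
rewrite !cderiv_carath.
intros [p [Hp [Ep Fp]]] [q [Hq [Eq Fq]]]. exists (fun w => p w * g w + f z * q w)%C.
split; [repeat first [apply ccont_plus | apply ccont_mult | apply ccont_const]; auto|].
split; [congruence|].
intros w. rewrite (Fp w), (Fq w). ring.
Qed.

Lemma cderiv_inv (f : C -> C) (z a : C) :
  f z <> RtoC 0 -> cderiv f z a ->
  cderiv (fun w => / f w)%C z (- a / (f z * f z)).
Proof.
intros Hz Hf. assert (Cf := cderiv_ccont _ _ _ Hf).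
destruct (Cf (Cmod (f z))) as [r [Hr Hn]]; [now apply Cmod_gt_0|].
apply cderiv_carath in Hf. destruct Hf as [p [Hp [Ep Fp]]].
(* The slope identity must hold for all [w], whereas [/ f w] is meaningful only where [f w] is
   nonzero. The replacement agrees with it near [z] and has the required form everywhere. *)
apply cderiv_ext_loc with (g := fun w => (/ f z + (- p w * / (f w * f z)) * (w - z))%C) (r := r).
- exact Hr.
- intros w Hw. specialize (Hn w Hw).
  assert (f w <> RtoC 0).
  { intros E. rewrite E in Hn. replace (0 - f z)%C with (- f z)%C in Hn by ring.
    rewrite Cmod_opp in Hn. lra. }
  assert (E : (f w - f z)%C = (p w * (w - z))%C) by (rewrite (Fp w); ring).
  replace (/ f z + - p w * / (f w * f z) * (w - z))%C
    with (/ f z - (p w * (w - z)) / (f w * f z))%C by (field; auto).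
  rewrite <- E. field; auto.
- apply cderiv_carath. exists (fun w => (- (1)) * p w * / (f w * f z))%C.
  split; [|split].
  + repeat first [apply ccont_mult | apply ccont_const | exact Hp].
    apply ccont_inv; [now apply Cmult_neq_0|].
    apply ccont_mult; [exact Cf|apply ccont_const].
  + rewrite Ep. field; auto.
  + intros w. ring.
Qed.

Lemma cderiv_comp (f g : C -> C) (z a b : C) :
  cderiv f (g z) a -> cderiv g z b -> cderiv (fun w => f (g w)) z (a * b).
Proof.
intros Hf Hg. assert (Cg := cderiv_ccont _ _ _ Hg). revert Hf Hg.
rewrite !cderiv_carath.
intros [p [Hp [Ep Fp]]] [q [Hq [Eq Fq]]]. exists (fun w => p (g w) * q w)%C.
split; [apply ccont_mult; [now apply ccont_comp|exact Hq]|]. split; [congruence|].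
intros w. rewrite (Fp (g w)), (Fq w). ring.
Qed.

Lemma cdiff_const (c z : C) : cdiff (fun _ => c) z.
Proof. eexists; apply cderiv_const. Qed.
Lemma cdiff_id (z : C) : cdiff (fun w => w) z.
Proof. eexists; apply cderiv_id. Qed.
Lemma cdiff_plus (f g : C -> C) (z : C) :
  cdiff f z -> cdiff g z -> cdiff (fun w => f w + g w)%C z.
Proof. intros [a H] [b H']; eexists; apply cderiv_plus; eauto. Qed.
Lemma cdiff_mult (f g : C -> C) (z : C) :
  cdiff f z -> cdiff g z -> cdiff (fun w => f w * g w)%C z.
Proof. intros [a H] [b H']; eexists; apply cderiv_mult; eauto. Qed.
Lemma cdiff_inv (f : C -> C) (z : C) :
  f z <> RtoC 0 -> cdiff f z -> cdiff (fun w => / f w)%C z.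
Proof. intros Hz [a H]; eexists; apply cderiv_inv; eauto. Qed.
Lemma cdiff_comp (f g : C -> C) (z : C) :
  cdiff f (g z) -> cdiff g z -> cdiff (fun w => f (g w)) z.
Proof. intros [a H] [b H']; eexists; apply cderiv_comp; eauto. Qed.
Lemma cdiff_opp (f : C -> C) (z : C) : cdiff f z -> cdiff (fun w => - f w)%C z.
Proof.
intros H. apply cdiff_ext with (g := fun w => (-(1) * f w)%C); [intros; ring|].
apply cdiff_mult; [apply cdiff_const|exact H].
Qed.
Lemma cdiff_minus (f g : C -> C) (z : C) :
  cdiff f z -> cdiff g z -> cdiff (fun w => f w - g w)%C z.
Proof. intros Hf Hg. apply cdiff_plus; [exact Hf|now apply cdiff_opp]. Qed.
Lemma cdiff_div (f g : C -> C) (z : C) :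
  g z <> RtoC 0 -> cdiff f z -> cdiff g z -> cdiff (fun w => f w / g w)%C z.
Proof. intros. apply cdiff_mult; [|apply cdiff_inv]; auto. Qed.
Lemma cdiff_pow (n : nat) (f : C -> C) (z : C) :
  cdiff f z -> cdiff (fun w => f w ^ n)%C z.
Proof.
intros H. induction n as [|n IH]; simpl; [apply cdiff_const|now apply cdiff_mult].
Qed.

(** * Exponential and logarithm *)

Lemma Cmod_le_abs (z : C) : Cmod z <= Rabs (Re z) + Rabs (Im z).
Proof.
pose proof (Rabs_pos (Re z)). pose proof (Rabs_pos (Im z)).
unfold Cmod. rewrite <- (sqrt_Rsqr (Rabs (Re z) + Rabs (Im z))) by lra.
apply sqrt_le_1_alt. unfold Rsqr.
pose proof (pow2_abs (Re z)) as E1. pose proof (pow2_abs (Im z)) as E2.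
change (fst z) with (Re z). change (snd z) with (Im z). nra.
Qed.

Lemma im_le_Cmod (z : C) : Rabs (Im z) <= Cmod z.
Proof. eapply Rle_trans; [apply Rmax_r|apply Rmax_Cmod]. Qed.

(** The balls of the uniform structure on [C] are squares, those of [Cmod] are discs; [sqrt 2 < 2]
    converts between the two. Theorems on real integrals and on uniform continuity become applicable
    through this bridge. *)
Lemma ccont_continuous (f : C -> C) (z : C) :
  ccont f z <-> continuous (T := C_UniformSpace) (U := C_UniformSpace) f z.
Proof.
split.
- intros H. apply filterlim_locally. intros eps.
  destruct (H eps (cond_pos eps)) as [d [Hd H1]].
  assert (Hd2 : 0 < d / 2) by lra.
  exists (mkposreal _ Hd2). intros y Hy.
  apply C_NormedModule_mixin_compat1. apply H1.
  apply C_NormedModule_mixin_compat2 in Hy. simpl in Hy.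
  eapply Rlt_trans; [exact Hy|].
  assert (sqrt 2 < 2) by (rewrite <- (sqrt_Rsqr 2) at 2 by lra; apply sqrt_lt_1; unfold Rsqr; lra).
  nra.
- intros H eps He.
  assert (He2 : 0 < eps / 2) by lra.
  destruct (proj1 (filterlim_locally _ _) H (mkposreal _ He2)) as [d H1].
  exists d; split; [apply cond_pos|]. intros w Hw.
  specialize (H1 w (C_NormedModule_mixin_compat1 _ _ _ Hw)).
  apply C_NormedModule_mixin_compat2 in H1. simpl in H1.
  eapply Rlt_trans; [exact H1|].
  assert (sqrt 2 < 2) by (rewrite <- (sqrt_Rsqr 2) at 2 by lra; apply sqrt_lt_1; unfold Rsqr; lra).
  nra.
Qed.

Lemma continuous_Re (z : C) : continuous (T := C_UniformSpace) (U := R_UniformSpace) Re z.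
Proof. apply (continuous_fst (U := R_UniformSpace) (V := R_UniformSpace)). Qed.

Lemma continuous_Im (z : C) : continuous (T := C_UniformSpace) (U := R_UniformSpace) Im z.
Proof. apply (continuous_snd (U := R_UniformSpace) (V := R_UniformSpace)). Qed.

Lemma continuous_Cmod (z : C) : continuous (T := C_UniformSpace) (U := R_UniformSpace) Cmod z.
Proof.
set (V := prod_NormedModule R_AbsRing R_NormedModule R_NormedModule).
apply (continuous_ext (T := C_UniformSpace) (U := R_UniformSpace) (@norm R_AbsRing V)).
- intros x; symmetry; apply Cmod_norm.
- apply (filterlim_norm (K := R_AbsRing) (V := V)).
Qed.

Lemma continuous_pair {U : UniformSpace} (a b : U -> R) (u : U) :
  continuous a u -> continuous b u ->
  continuous (T := U) (U := C_UniformSpace) (fun t => (a t, b t) : C) u.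
Proof.
intros Ha Hb. apply filterlim_locally. intros eps.
assert (H1 := proj1 (filterlim_locally _ _) Ha eps).
assert (H2 := proj1 (filterlim_locally _ _) Hb eps).
generalize (filter_and _ _ H1 H2). apply filter_imp. intros t [A B]. now split.
Qed.

Lemma continuous_Re_comp {U : UniformSpace} (F : C -> C) (g : U -> C) (t : U) :
  continuous (U := C_UniformSpace) g t -> ccont F (g t) -> continuous (fun s => Re (F (g s))) t.
Proof.
intros Hg HF. apply (continuous_comp (V := C_UniformSpace) (fun s => F (g s)) Re); [|apply continuous_Re].
apply (continuous_comp (V := C_UniformSpace) (W := C_UniformSpace) g F); [exact Hg|]. now apply ccont_continuous.
Qed.

Lemma continuous_Im_comp {U : UniformSpace} (F : C -> C) (g : U -> C) (t : U) :
  continuous (U := C_UniformSpace) g t -> ccont F (g t) -> continuous (fun s => Im (F (g s))) t.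
Proof.
intros Hg HF. apply (continuous_comp (V := C_UniformSpace) (fun s => F (g s)) Im); [|apply continuous_Im].
apply (continuous_comp (V := C_UniformSpace) (W := C_UniformSpace) g F); [exact Hg|]. now apply ccont_continuous.
Qed.

Definition cexp (z : C) : C := (exp (Re z) * cos (Im z), exp (Re z) * sin (Im z)).

Lemma cexp_plus (a b : C) : cexp (a + b) = (cexp a * cexp b)%C.
Proof.
unfold cexp, Cmult, Cplus, Re, Im; simpl. rewrite exp_plus, cos_plus, sin_plus.
f_equal; ring.
Qed.

Lemma cexp_0 : cexp 0 = 1.
Proof. unfold cexp, Re, Im; simpl. rewrite exp_0, cos_0, sin_0. unfold RtoC. f_equal; ring. Qed.

Lemma Cmod_pair_polar (r t : R) : 0 <= r -> Cmod (r * cos t, r * sin t) = r.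
Proof.
intros Hr. unfold Cmod; simpl.
replace (r * cos t * (r * cos t * 1) + r * sin t * (r * sin t * 1)) with (Rsqr r).
- now apply sqrt_Rsqr.
- generalize (sin2_cos2 t). unfold Rsqr. intros H.
  replace (r * cos t * (r * cos t * 1) + r * sin t * (r * sin t * 1))
    with (r * r * (sin t * sin t + cos t * cos t)) by ring. rewrite H. ring.
Qed.

Lemma Cmod_cexp (z : C) : Cmod (cexp z) = exp (Re z).
Proof. apply Cmod_pair_polar. left. apply exp_pos. Qed.

Lemma cexp_neq_0 (z : C) : cexp z <> RtoC 0.
Proof. apply Cmod_gt_0. rewrite Cmod_cexp. apply exp_pos. Qed.

Lemma deriv_lim_bound (f : R -> R) (l eps : R) :
  derivable_pt_lim f 0 l -> 0 < eps ->
  exists d, 0 < d /\ forall x, Rabs x < d -> Rabs (f x - f 0 - l * x) <= eps * Rabs x.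
Proof.
intros H He. destruct (H eps He) as [d Hd]. exists d; split; [apply cond_pos|].
intros x Hx. destruct (Req_dec x 0) as [->|Hx0].
- rewrite Rmult_0_r, Rminus_0_r, Rminus_diag, Rabs_R0. lra.
- specialize (Hd x Hx0 Hx). rewrite Rplus_0_l in Hd.
  replace (f x - f 0 - l * x) with (((f x - f 0) / x - l) * x) by (field; exact Hx0).
  rewrite Rabs_mult. apply Rmult_le_compat_r; [apply Rabs_pos|lra].
Qed.

Lemma cderiv_cexp_0 : cderiv cexp 0 1.
Proof.
intros eps He.
(* With [M = Cmod w], the real and imaginary parts of the error turn out to be at most [4 * e * M]
   and [5 * e * M]; hence the 10. *)
set (e := Rmin 1 (eps / 10)).
assert (He0 : 0 < e) by (apply Rmin_pos; lra).
assert (He1 : e <= 1) by apply Rmin_l. assert (He2 : 10 * e <= eps).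
{ assert (e <= eps / 10) by apply Rmin_r. lra. }
destruct (deriv_lim_bound exp 1 e) as [d1 [Hd1 H1]]; [rewrite <- exp_0; apply derivable_pt_lim_exp|exact He0|].
destruct (deriv_lim_bound cos 0 e) as [d2 [Hd2 H2]]; [|exact He0|].
{ replace 0 with (- sin 0) at 2 by (rewrite sin_0; ring). apply derivable_pt_lim_cos. }
destruct (deriv_lim_bound sin 1 e) as [d3 [Hd3 H3]]; [|exact He0|].
{ rewrite <- cos_0. apply derivable_pt_lim_sin. }
exists (Rmin (Rmin d1 d2) (Rmin d3 e)). split; [apply Rmin_pos; apply Rmin_pos; assumption|].
intros w Hw. replace (w - 0)%C with w in * by ring.
assert (G1 : Cmod w < d1) by (eapply Rlt_le_trans; [exact Hw|eapply Rle_trans; apply Rmin_l]).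
assert (G2 : Cmod w < d2) by (eapply Rlt_le_trans; [exact Hw|eapply Rle_trans; [apply Rmin_l|apply Rmin_r]]).
assert (G3 : Cmod w < d3) by (eapply Rlt_le_trans; [exact Hw|eapply Rle_trans; [apply Rmin_r|apply Rmin_l]]).
assert (G4 : Cmod w < e) by (eapply Rlt_le_trans; [exact Hw|eapply Rle_trans; apply Rmin_r]).
pose proof (re_le_Cmod w) as Hx. pose proof (im_le_Cmod w) as Hy.
set (M := Cmod w) in *.
destruct w as [x y]. unfold Re, Im in Hx, Hy; simpl in Hx, Hy.
specialize (H1 x ltac:(lra)). specialize (H2 y ltac:(lra)). specialize (H3 y ltac:(lra)).
rewrite exp_0 in H1. rewrite cos_0 in H2. rewrite sin_0 in H3.
rewrite cexp_0.
eapply Rle_trans; [apply Cmod_le_abs|].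
unfold cexp, Re, Im, Cminus, Cplus, Copp, Cmult, RtoC; simpl.
pose proof (Rabs_pos x). pose proof (Rabs_pos y).
set (E := exp x - 1 - 1 * x) in *. set (A := cos y - 1 - 0 * y) in *. set (B := sin y - 0 - 1 * y) in *.
assert (Ex : exp x = 1 + x + E) by (unfold E; ring).
assert (HEx : Rabs (exp x) <= 3).
{ rewrite Ex. eapply Rle_trans; [apply Rabs_triang|].
  assert (Rabs (1 + x) <= 2) by (eapply Rle_trans; [apply Rabs_triang|]; rewrite Rabs_R1; lra). nra. }
assert (HE1 : Rabs (x + E) <= 2 * Rabs x).
{ eapply Rle_trans; [apply Rabs_triang|]. nra. }
replace (exp x * cos y + - (1) + - (1 * x - 0 * y)) with (E + exp x * A)
  by (unfold E, A; ring).
replace (exp x * sin y + - 0 + - (1 * y + 0 * x)) with (exp x * B + (x + E) * y)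
  by (unfold B; rewrite Ex; ring).
assert (T1 : Rabs (E + exp x * A) <= e * M + 3 * (e * M)).
{ eapply Rle_trans; [apply Rabs_triang|]. rewrite Rabs_mult. pose proof (Rabs_pos A).
  assert (Rabs (exp x) * Rabs A <= 3 * (e * M)) by (apply Rmult_le_compat; nra||apply Rabs_pos). nra. }
assert (T2 : Rabs (exp x * B + (x + E) * y) <= 3 * (e * M) + 2 * M * e).
{ eapply Rle_trans; [apply Rabs_triang|]. rewrite !Rabs_mult. pose proof (Rabs_pos B).
  assert (Rabs (exp x) * Rabs B <= 3 * (e * M)) by (apply Rmult_le_compat; nra||apply Rabs_pos).
  assert (Rabs (x + E) * Rabs y <= (2 * M) * e) by (apply Rmult_le_compat; nra||apply Rabs_pos). nra. }
assert (0 <= M) by lra. nra.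
Qed.

Lemma cderiv_cexp (z : C) : cderiv cexp z (cexp z).
Proof.
apply cderiv_ext_loc with (g := fun w => (cexp z * cexp (w + - z))%C) (r := 1); [lra| |].
- intros w _. rewrite <- cexp_plus. f_equal. ring.
- assert (H : cderiv (fun w => (cexp z * cexp (w + - z))%C) z
    (0 * cexp (z + - z) + cexp z * (1 * (1 + 0)))%C).
  { apply (cderiv_mult (fun _ => cexp z) (fun w => cexp (w + - z))); [apply cderiv_const|].
    apply (cderiv_comp cexp (fun w => (w + - z)%C)).
    - replace (z + - z)%C with (RtoC 0) by ring. apply cderiv_cexp_0.
    - apply cderiv_plus; [apply cderiv_id|apply cderiv_const]. }
  replace (0 * cexp (z + - z) + cexp z * (1 * (1 + 0)))%C with (cexp z) in H by ring.
  exact H.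
Qed.

Lemma cdiff_cexp (f : C -> C) (z : C) : cdiff f z -> cdiff (fun w => cexp (f w)) z.
Proof. intros H. apply (cdiff_comp cexp f); [eexists; apply cderiv_cexp|exact H]. Qed.

(* Meaningful on the right half-plane only. *)
Definition clog (w : C) : C := (ln (Cmod w), atan (Im w / Re w)).

Lemma cexp_clog (w : C) : 0 < Re w -> cexp (clog w) = w.
Proof.
intros H. assert (Hw : 0 < Cmod w).
{ apply Rlt_le_trans with (Re w); [exact H|]. eapply Rle_trans; [apply Rle_abs|apply re_le_Cmod]. }
change (cexp (clog w)) with
  (exp (ln (Cmod w)) * cos (atan (Im w / Re w)), exp (ln (Cmod w)) * sin (atan (Im w / Re w))).
rewrite exp_ln by exact Hw.
assert (Hs : sqrt (1 + (Im w / Re w)²) = Cmod w / Re w).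
{ apply sqrt_lem_1; [generalize (Rle_0_sqr (Im w / Re w)); lra|apply Rlt_le, Rdiv_lt_0_compat; lra|].
  replace (Cmod w / Re w * (Cmod w / Re w)) with (Cmod w ^ 2 / (Re w)^2) by (field; lra).
  rewrite Cmod2_alt. unfold Rsqr. field; lra. }
rewrite cos_atan, sin_atan, Hs.
clear Hs. set (c := Cmod w) in *. clearbody c.
destruct w as [x y]. unfold Re, Im in *; cbv [fst snd] in *. f_equal. field; lra. field; lra.
Qed.

Lemma ccont_clog (w : C) : 0 < Re w -> ccont clog w.
Proof.
intros H. apply ccont_continuous. apply continuous_pair.
- apply (continuous_comp (U := C_UniformSpace) (V := R_UniformSpace) Cmod ln).
  + apply continuous_Cmod.
  + apply continuity_pt_filterlim. apply derivable_continuous_pt.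
    exists (/ Cmod w). apply derivable_pt_lim_ln.
    apply Rlt_le_trans with (Re w); [exact H|]. eapply Rle_trans; [apply Rle_abs|apply re_le_Cmod].
- apply (continuous_comp (U := C_UniformSpace) (V := R_UniformSpace) (fun w => Im w / Re w) atan).
  + apply (continuous_mult (K := R_AbsRing) (U := C_UniformSpace) Im (fun w => / Re w)); [apply continuous_Im|].
    apply (continuous_comp (U := C_UniformSpace) (V := R_UniformSpace) Re Rinv); [apply continuous_Re|].
    apply continuity_pt_filterlim. apply (continuity_pt_inv (fun x => x)); [|lra].
    apply continuity_pt_id.
  + apply continuity_pt_filterlim. apply derivable_continuous_pt. apply derivable_pt_atan.
Qed.

(** With [p] the slope of [E] at [L w], the identity [E (L v) = v] reads
    [v - w = p (L v) * (L v - L w)]. Thus [/ p (L v)] is a slope for [L], and it is continuous at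
    [w] because [L] is and [p (L w) = a] is nonzero. *)
Lemma cdiff_right_inverse (E L : C -> C) (w a : C) (r : R) :
  0 < r -> (forall v, Cmod (v - w) < r -> E (L v) = v) ->
  ccont L w -> cderiv E (L w) a -> a <> RtoC 0 -> cdiff L w.
Proof.
intros Hr HE HL HD Ha. apply cderiv_carath in HD. destruct HD as [p [Hp [Ep Fp]]].
assert (Hc : ccont (fun v => p (L v)) w) by now apply ccont_comp.
destruct (Hc (Cmod a)) as [d [Hd Hn]]; [now apply Cmod_gt_0|].
apply cdiff_ext_loc with (g := fun v => (L w + / p (L v) * (v - w))%C) (r := Rmin r d).
- now apply Rmin_pos.
- intros v Hv.
  assert (p (L v) <> RtoC 0).
  { intros E0. specialize (Hn v (Rlt_le_trans _ _ _ Hv (Rmin_r _ _))).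
    rewrite E0, Ep in Hn. replace (0 - a)%C with (- a)%C in Hn by ring. rewrite Cmod_opp in Hn. lra. }
  assert (E1 : (v - w)%C = (p (L v) * (L v - L w))%C).
  { rewrite <- (HE v) at 1 by (eapply Rlt_le_trans; [exact Hv|apply Rmin_l]).
    rewrite <- (HE w) at 1. 2:{ replace (w - w)%C with (RtoC 0) by ring. now rewrite Cmod_0. }
    rewrite (Fp (L v)). ring. }
  rewrite E1. field. assumption.
- exists (/ p (L w))%C. apply cderiv_carath. exists (fun v => / p (L v))%C.
  split; [|split].
  + apply ccont_inv; [congruence|exact Hc].
  + reflexivity.
  + intros v. ring.
Qed.

Lemma cdiff_clog (w : C) : 0 < Re w -> cdiff clog w.
Proof.
intros H. apply (cdiff_right_inverse cexp clog w (cexp (clog w)) (Re w)).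
- exact H.
- intros v Hv. apply cexp_clog.
  pose proof (re_le_Cmod (v - w)) as H1.
  replace (Re (v - w)) with (Re v - Re w) in H1 by (unfold Re, Cminus, Cplus, Copp; simpl; ring).
  destruct (Rabs_def2 (Re v - Re w) (Re w)); lra.
- now apply ccont_clog.
- apply cderiv_cexp.
- apply cexp_neq_0.
Qed.

Lemma polar (z : C) : exists t : R, - PI <= t <= PI /\ z = (Cmod z * cos t, Cmod z * sin t).
Proof.
destruct (Ceq_dec z 0) as [->|Hz].
{ exists 0. pose proof PI_RGT_0. split; [lra|]. rewrite Cmod_0, !Rmult_0_l. reflexivity. }
apply Cmod_gt_0 in Hz. set (r := Cmod z) in *.
assert (Hx : -1 <= Re z / r <= 1).
{ pose proof (re_le_Cmod z) as H. fold r in H. apply Rabs_le_between in H.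
  split; apply Rmult_le_reg_r with r; try lra; unfold Rdiv; rewrite Rmult_assoc, Rinv_l; lra. }
assert (Hs : r * sqrt (1 - (Re z / r)²) = Rabs (Im z)).
{ rewrite <- (sqrt_Rsqr_abs (Im z)). rewrite <- (sqrt_Rsqr r) at 1 by lra.
  rewrite <- sqrt_mult_alt by apply Rle_0_sqr. f_equal.
  unfold Rsqr. replace (r * r * (1 - Re z / r * (Re z / r))) with (r ^ 2 - Re z ^ 2) by (field; lra).
  unfold r. rewrite Cmod2_alt. ring. }
pose proof (acos_bound (Re z / r)).
destruct (Rle_dec 0 (Im z)) as [H0|H0].
- exists (acos (Re z / r)). split; [lra|].
  rewrite cos_acos, sin_acos, Hs, Rabs_pos_eq by assumption.
  destruct z as [x y]; unfold Re, Im; simpl. f_equal. field. lra.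
- exists (- acos (Re z / r)). split; [lra|].
  rewrite cos_neg, sin_neg, cos_acos, sin_acos by assumption.
  rewrite <- Ropp_mult_distr_r, Hs, Rabs_left by lra.
  destruct z as [x y]; unfold Re, Im; simpl. f_equal; [field; lra|ring].
Qed.

(** * Goursat's theorem *)

Definition pcont (f : R -> C) (a b : R) : Prop :=
  forall t, a <= t <= b -> continuous (T := R_UniformSpace) (U := C_UniformSpace) f t.

Definition CInt (f : R -> C) (a b : R) : C :=
  (RInt (fun t => Re (f t)) a b, RInt (fun t => Im (f t)) a b).

Lemma pcont_ex_Re (f : R -> C) (a b : R) : a <= b -> pcont f a b -> ex_RInt (fun t => Re (f t)) a b.
Proof.
intros Hab H. apply (ex_RInt_continuous (V := R_CompleteNormedModule)).
rewrite Rmin_left, Rmax_right by exact Hab. intros t Ht.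
apply (continuous_Re_comp (fun w => w) f); [now apply H|apply ccont_id].
Qed.

Lemma pcont_ex_Im (f : R -> C) (a b : R) : a <= b -> pcont f a b -> ex_RInt (fun t => Im (f t)) a b.
Proof.
intros Hab H. apply (ex_RInt_continuous (V := R_CompleteNormedModule)).
rewrite Rmin_left, Rmax_right by exact Hab. intros t Ht.
apply (continuous_Im_comp (fun w => w) f); [now apply H|apply ccont_id].
Qed.

Lemma pcont_sub (f : R -> C) (a b c d : R) : a <= c -> d <= b -> pcont f a b -> pcont f c d.
Proof. intros H1 H2 H t Ht; apply H; lra. Qed.

Lemma CInt_ext (f g : R -> C) (a b : R) :
  a <= b -> (forall t, a <= t <= b -> f t = g t) -> CInt f a b = CInt g a b.
Proof.
intros Hab H. unfold CInt. f_equal; apply RInt_ext; rewrite Rmin_left, Rmax_right by exact Hab;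
intros t Ht; rewrite H; trivial; lra.
Qed.

Lemma CInt_Chasles (f : R -> C) (a b c : R) :
  a <= b <= c -> pcont f a c -> (CInt f a b + CInt f b c)%C = CInt f a c.
Proof.
intros Hab H. unfold CInt, Cplus; simpl.
rewrite <- (RInt_Chasles (V := R_CompleteNormedModule) (fun t => Re (f t)) a b c).
- rewrite <- (RInt_Chasles (V := R_CompleteNormedModule) (fun t => Im (f t)) a b c).
  + reflexivity.
  + apply pcont_ex_Im; [lra|]. apply pcont_sub with a c; trivial; lra.
  + apply pcont_ex_Im; [lra|]. apply pcont_sub with a c; trivial; lra.
- apply pcont_ex_Re; [lra|]. apply pcont_sub with a c; trivial; lra.
- apply pcont_ex_Re; [lra|]. apply pcont_sub with a c; trivial; lra.
Qed.

Lemma RInt_abs_le_const (f : R -> R) (a b M : R) :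
  a <= b -> ex_RInt f a b -> (forall t, a <= t <= b -> Rabs (f t) <= M) ->
  Rabs (RInt f a b) <= M * (b - a).
Proof.
intros Hab Hf H. rewrite Rmult_comm. apply (abs_RInt_le_const f a b M); assumption.
Qed.

(** The factor 2 comes from bounding the real and imaginary parts separately. *)
Lemma CInt_bound (f : R -> C) (a b M : R) :
  a <= b -> pcont f a b -> (forall t, a <= t <= b -> Cmod (f t) <= M) ->
  Cmod (CInt f a b) <= 2 * M * (b - a).
Proof.
intros Hab Hf H. eapply Rle_trans; [apply Cmod_le_abs|].
assert (H1 : Rabs (Re (CInt f a b)) <= M * (b - a)).
{ apply RInt_abs_le_const; [exact Hab|now apply pcont_ex_Re|].
  intros t Ht. eapply Rle_trans; [apply re_le_Cmod|now apply H]. }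
assert (H2 : Rabs (Im (CInt f a b)) <= M * (b - a)).
{ apply RInt_abs_le_const; [exact Hab|now apply pcont_ex_Im|].
  intros t Ht. eapply Rle_trans; [apply im_le_Cmod|now apply H]. }
lra.
Qed.

Lemma CInt_plus (f g : R -> C) (a b : R) :
  a <= b -> pcont f a b -> pcont g a b ->
  CInt (fun t => f t + g t)%C a b = (CInt f a b + CInt g a b)%C.
Proof.
intros Hab Hf Hg. unfold CInt, Cplus; simpl. f_equal.
- apply (RInt_plus (V := R_CompleteNormedModule) (fun t => Re (f t)) (fun t => Re (g t)));
  now apply pcont_ex_Re.
- apply (RInt_plus (V := R_CompleteNormedModule) (fun t => Im (f t)) (fun t => Im (g t)));
  now apply pcont_ex_Im.
Qed.

Lemma CInt_scal (c : C) (f : R -> C) (a b : R) :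
  a <= b -> pcont f a b -> CInt (fun t => c * f t)%C a b = (c * CInt f a b)%C.
Proof.
intros Hab Hf. 
assert (H1 := pcont_ex_Re f a b Hab Hf). assert (H2 := pcont_ex_Im f a b Hab Hf).
assert (S1 : forall k, RInt (fun t => k * Re (f t)) a b = k * RInt (fun t => Re (f t)) a b).
{ intros k. exact (RInt_scal (V := R_CompleteNormedModule) (fun t => Re (f t)) a b k H1). }
assert (S2 : forall k, RInt (fun t => k * Im (f t)) a b = k * RInt (fun t => Im (f t)) a b).
{ intros k. exact (RInt_scal (V := R_CompleteNormedModule) (fun t => Im (f t)) a b k H2). }
assert (X1 : forall k, ex_RInt (fun t => k * Re (f t)) a b).
{ intros k. exact (ex_RInt_scal (V := R_NormedModule) (fun t => Re (f t)) a b k H1). }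
assert (X2 : forall k, ex_RInt (fun t => k * Im (f t)) a b).
{ intros k. exact (ex_RInt_scal (V := R_NormedModule) (fun t => Im (f t)) a b k H2). }
unfold CInt, Cmult; simpl. rewrite <- !S1, <- !S2. f_equal.
- apply (RInt_minus (V := R_CompleteNormedModule)
    (fun t => fst c * Re (f t)) (fun t => snd c * Im (f t))); auto.
- apply (RInt_plus (V := R_CompleteNormedModule)
    (fun t => fst c * Im (f t)) (fun t => snd c * Re (f t))); auto.
Qed.

Lemma CInt_const (c : C) (a b : R) : CInt (fun _ => c) a b = (c * RtoC (b - a))%C.
Proof.
unfold CInt. rewrite !(RInt_const (V := R_CompleteNormedModule)).
unfold scal, Cmult, RtoC; simpl. unfold mult; simpl. unfold Re, Im. f_equal; ring.
Qed.

Lemma CInt_opp (f : R -> C) (a b : R) :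
  a <= b -> pcont f a b -> CInt (fun t => - f t)%C a b = (- CInt f a b)%C.
Proof.
intros Hab Hf. rewrite <- (CInt_ext (fun t => (-(1)) * f t)%C); [|exact Hab|intros; ring].
rewrite CInt_scal by assumption. ring.
Qed.

Lemma RInt_id (a b : R) : RInt (fun t => t) a b = (b * b - a * a) / 2.
Proof.
apply is_RInt_unique.
replace ((b * b - a * a) / 2) with (minus (b * b / 2) (a * a / 2))
  by (unfold minus, plus, opp; simpl; field).
apply (is_RInt_derive (V := R_CompleteNormedModule) (fun t => t * t / 2)).
- intros x _. auto_derive; [trivial|field].
- intros x _. apply continuous_id.
Qed.

(* Boundary integral over the rectangle with lower left corner [(x, y)], width
   [w] and height [h]. *)
Definition rect_int (F : C -> C) (x y w h : R) : C :=
  (CInt (fun t => F (t, y)) x (x + w) + Ci * CInt (fun t => F ((x + w)%R, t)) y (y + h)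
   - CInt (fun t => F (t, (y + h)%R)) x (x + w) - Ci * CInt (fun t => F (x, t)) y (y + h))%C.

Definition on_rect (P : C -> Prop) (x y w h : R) : Prop :=
  forall s t, x <= s <= x + w -> y <= t <= y + h -> P (s, t).

Lemma pcont_hor (F : C -> C) (y a b : R) :
  (forall t, a <= t <= b -> ccont F (t, y)) -> pcont (fun t => F (t, y)) a b.
Proof.
intros H t Ht.
apply (continuous_comp (V := C_UniformSpace) (W := C_UniformSpace) (fun t : R => (t, y) : C) F).
- apply continuous_pair; [apply continuous_id|apply continuous_const].
- now apply ccont_continuous, H.
Qed.

Lemma pcont_ver (F : C -> C) (x a b : R) :
  (forall t, a <= t <= b -> ccont F (x, t)) -> pcont (fun t => F (x, t)) a b.
Proof.
intros H t Ht.
apply (continuous_comp (V := C_UniformSpace) (W := C_UniformSpace) (fun t : R => (x, t) : C) F).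
- apply continuous_pair; [apply continuous_const|apply continuous_id].
- now apply ccont_continuous, H.
Qed.

Lemma rect_int_ext (F G : C -> C) (x y w h : R) :
  0 <= w -> 0 <= h -> on_rect (fun z => F z = G z) x y w h ->
  rect_int F x y w h = rect_int G x y w h.
Proof.
intros Hw Hh E. unfold rect_int.
rewrite (CInt_ext (fun t => F (t, y)) (fun t => G (t, y))),
  (CInt_ext (fun t => F (t, (y + h)%R)) (fun t => G (t, (y + h)%R))),
  (CInt_ext (fun t => F (x, t)) (fun t => G (x, t))),
  (CInt_ext (fun t => F ((x + w)%R, t)) (fun t => G ((x + w)%R, t)));
  [reflexivity|lra|intros; apply E; lra|lra|intros; apply E; lra
  |lra|intros; apply E; lra|lra|intros; apply E; lra].
Qed.

Lemma rect_int_plus (F G : C -> C) (x y w h : R) :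
  0 <= w -> 0 <= h -> on_rect (ccont F) x y w h -> on_rect (ccont G) x y w h ->
  rect_int (fun z => F z + G z)%C x y w h = (rect_int F x y w h + rect_int G x y w h)%C.
Proof.
intros Hw Hh HF HG. unfold rect_int.
rewrite (CInt_plus (fun t => F (t, y)) (fun t => G (t, y))),
  (CInt_plus (fun t => F (t, (y + h)%R)) (fun t => G (t, (y + h)%R))),
  (CInt_plus (fun t => F (x, t)) (fun t => G (x, t))),
  (CInt_plus (fun t => F ((x + w)%R, t)) (fun t => G ((x + w)%R, t))); try lra;
  try (apply pcont_hor; intros; first [apply HF|apply HG]; lra);
  try (apply pcont_ver; intros; first [apply HF|apply HG]; lra).
ring.
Qed.

Lemma rect_int_affine (a b : C) (x y w h : R) :
  0 <= w -> 0 <= h -> rect_int (fun z => a + b * z)%C x y w h = RtoC 0.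
Proof.
intros Hw Hh.
rewrite (rect_int_plus (fun _ => a) (fun z => b * z)%C);
  [|exact Hw|exact Hh|intros s t _ _; apply ccont_const
  |intros s t _ _; apply ccont_mult; [apply ccont_const|apply ccont_id]].
assert (E1 : rect_int (fun _ => a) x y w h = RtoC 0).
{ unfold rect_int. rewrite !CInt_const. replace (x + w - x) with w by ring.
  replace (y + h - y) with h by ring. ring. }
assert (E2 : rect_int (fun z => b * z)%C x y w h = RtoC 0).
{ unfold rect_int.
  rewrite (CInt_scal b (fun t => (t, y))), (CInt_scal b (fun t => (t, (y + h)%R))),
    (CInt_scal b (fun t => (x, t))), (CInt_scal b (fun t => ((x + w)%R, t))); try lra;
  try (apply (pcont_hor (fun z => z)); intros; apply ccont_id);
  try (apply (pcont_ver (fun z => z)); intros; apply ccont_id).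
  unfold CInt, Re, Im; simpl.
  rewrite !RInt_id, !(RInt_const (V := R_CompleteNormedModule)).
  unfold scal; simpl; unfold mult; simpl.
  unfold Ci, Cminus, Cmult, Cplus, Copp, RtoC; simpl. f_equal. field. field. }
rewrite E1, E2. ring.
Qed.

Lemma rect_int_bound (F : C -> C) (x y w h M : R) :
  0 <= w -> 0 <= h -> on_rect (ccont F) x y w h ->
  on_rect (fun z => Cmod (F z) <= M) x y w h ->
  Cmod (rect_int F x y w h) <= 4 * M * (w + h).
Proof.
intros Hw Hh Hc HM. unfold rect_int.
assert (B1 : Cmod (CInt (fun t => F (t, y)) x (x + w)) <= 2 * M * (x + w - x)).
{ apply CInt_bound; [lra|apply pcont_hor; intros; apply Hc; lra|intros; apply HM; lra]. }
assert (B2 : Cmod (CInt (fun t => F (t, (y + h)%R)) x (x + w)) <= 2 * M * (x + w - x)).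
{ apply CInt_bound; [lra|apply pcont_hor; intros; apply Hc; lra|intros; apply HM; lra]. }
assert (B3 : Cmod (CInt (fun t => F (x, t)) y (y + h)) <= 2 * M * (y + h - y)).
{ apply CInt_bound; [lra|apply pcont_ver; intros; apply Hc; lra|intros; apply HM; lra]. }
assert (B4 : Cmod (CInt (fun t => F ((x + w)%R, t)) y (y + h)) <= 2 * M * (y + h - y)).
{ apply CInt_bound; [lra|apply pcont_ver; intros; apply Hc; lra|intros; apply HM; lra]. }
unfold Cminus.
eapply Rle_trans; [apply Cmod_triangle|].
eapply Rle_trans; [apply Rplus_le_compat_r, Cmod_triangle|].
eapply Rle_trans; [apply Rplus_le_compat_r, Rplus_le_compat_r, Cmod_triangle|].
rewrite !Cmod_opp, !Cmod_mult, Cmod_Ci. lra.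
Qed.

Lemma rect_int_split (F : C -> C) (x y w h : R) :
  0 <= w -> 0 <= h -> on_rect (ccont F) x y w h ->
  rect_int F x y w h =
  (rect_int F x y (w / 2) (h / 2) + rect_int F (x + w / 2) y (w / 2) (h / 2)
   + rect_int F x (y + h / 2) (w / 2) (h / 2)
   + rect_int F (x + w / 2) (y + h / 2) (w / 2) (h / 2))%C.
Proof.
intros Hw Hh Hc. unfold rect_int.
replace (x + w / 2 + w / 2) with (x + w) by field.
replace (y + h / 2 + h / 2) with (y + h) by field.
rewrite <- (CInt_Chasles (fun t => F (t, y)) x (x + w / 2) (x + w)),
  <- (CInt_Chasles (fun t => F (t, (y + h)%R)) x (x + w / 2) (x + w)),
  <- (CInt_Chasles (fun t => F (x, t)) y (y + h / 2) (y + h)),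
  <- (CInt_Chasles (fun t => F ((x + w)%R, t)) y (y + h / 2) (y + h)); try lra;
  try (apply pcont_hor; intros; apply Hc; lra);
  try (apply pcont_ver; intros; apply Hc; lra).
ring.
Qed.

Lemma rect_int_quarter (F : C -> C) (x y w h : R) :
  0 <= w -> 0 <= h -> on_rect (ccont F) x y w h ->
  exists x' y', x <= x' <= x + w / 2 /\ y <= y' <= y + h / 2 /\
    Cmod (rect_int F x y w h) <= 4 * Cmod (rect_int F x' y' (w / 2) (h / 2)).
Proof.
intros Hw Hh Hc. rewrite rect_int_split by assumption.
set (A := rect_int F x y _ _). set (B := rect_int F (x + w / 2) y _ _).
set (D := rect_int F x (y + h / 2) _ _). set (E := rect_int F (x + w / 2) (y + h / 2) _ _).
assert (T : Cmod (A + B + D + E) <= Cmod A + Cmod B + Cmod D + Cmod E).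
{ eapply Rle_trans; [apply Cmod_triangle|]. apply Rplus_le_compat_r.
  eapply Rle_trans; [apply Cmod_triangle|]. apply Rplus_le_compat_r. apply Cmod_triangle. }
set (S := Cmod (A + B + D + E)) in *.
destruct (Rle_dec S (4 * Cmod A)) as [H1|H1]; [exists x, y; fold A; repeat split; lra|].
destruct (Rle_dec S (4 * Cmod B)) as [H2|H2]; [exists (x + w / 2), y; fold B; repeat split; lra|].
destruct (Rle_dec S (4 * Cmod D)) as [H3|H3]; [exists x, (y + h / 2); fold D; repeat split; lra|].
exists (x + w / 2), (y + h / 2); fold E; repeat split; lra.
Qed.

Lemma nested_intervals (a : nat -> R) (w : R) :
  0 <= w -> (forall n, a n <= a (S n) <= a n + w / 2 ^ S n) ->
  exists l, forall n, a n <= l <= a n + w / 2 ^ n.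
Proof.
intros Hw H.
assert (Hp : forall n, 0 < 2 ^ n) by (intros n; apply pow_lt; lra).
assert (Hm : forall n k, a n <= a (n + k)%nat <= a n + w / 2 ^ n - w / 2 ^ (n + k)).
{ intros n k; induction k as [|k IH].
  - rewrite Nat.add_0_r. lra.
  - rewrite Nat.add_succ_r. specialize (H (n + k)%nat). simpl in H |- *.
    assert (E : w / 2 ^ (n + k) = 2 * (w / (2 * 2 ^ (n + k))))
      by (field; generalize (Hp (n + k)%nat); lra). lra. }
assert (Hwp : forall n, 0 <= w / 2 ^ n) by (intros n; apply Rdiv_le_0_compat; auto).
assert (Hm' : forall n k, a k <= a n + w / 2 ^ n).
{ intros n k. destruct (Nat.le_ge_cases n k) as [Hnk|Hnk].
  - destruct (Hm n (k - n)%nat) as [_ H2]. replace (n + (k - n))%nat with k in H2 by lia.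
    specialize (Hwp k). lra.
  - destruct (Hm k (n - k)%nat) as [H2 _]. replace (k + (n - k))%nat with n in H2 by lia.
    specialize (Hwp n). lra. }
destruct (completeness (fun x => exists n, x = a n)) as [l [Hl1 Hl2]].
- exists (a 0%nat + w / 2 ^ 0). intros x [n ->]. apply Hm'.
- exists (a 0%nat), 0%nat. reflexivity.
- exists l. intros n; split.
  + apply Hl1. now exists n.
  + apply Hl2. intros x [k ->]. apply Hm'.
Qed.

Lemma goursat (F : C -> C) (x y w h : R) :
  0 <= w -> 0 <= h -> on_rect (cdiff F) x y w h -> rect_int F x y w h = RtoC 0.
Proof.
intros Hw Hh HF.
set (inR n (p : R * R) := x <= fst p /\ fst p + w / 2 ^ n <= x + w /\
                          y <= snd p /\ snd p + h / 2 ^ n <= y + h).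
assert (Hp : forall n, 0 < 2 ^ n) by (intros n; apply pow_lt; lra).
assert (Hwp : forall n, 0 <= w / 2 ^ n) by (intros n; apply Rdiv_le_0_compat; auto).
assert (Hhp : forall n, 0 <= h / 2 ^ n) by (intros n; apply Rdiv_le_0_compat; auto).
assert (Hsub : forall n p, inR n p -> on_rect (cdiff F) (fst p) (snd p) (w / 2 ^ n) (h / 2 ^ n)).
{ intros n p [H1 [H2 [H3 H4]]] s t Hs Ht. apply HF; lra. }
(* The condition [inR n p] stands inside the existential so that the choice function [next] is
   defined for all [n] and [p]; that the sequence [q] satisfies the condition is proved
   afterwards. *)
assert (Hstep : forall n (p : R * R), exists p' : R * R, inR n p ->
  fst p <= fst p' <= fst p + w / 2 ^ S n /\ snd p <= snd p' <= snd p + h / 2 ^ S n /\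
  Cmod (rect_int F (fst p) (snd p) (w / 2 ^ n) (h / 2 ^ n)) <=
  4 * Cmod (rect_int F (fst p') (snd p') (w / 2 ^ S n) (h / 2 ^ S n))).
{ intros n p. destruct (classic (inR n p)) as [Hin|Hin]; [|exists p; tauto].
  destruct (rect_int_quarter F (fst p) (snd p) (w / 2 ^ n) (h / 2 ^ n)) as [x' [y' H]]; auto.
  { intros s t Hs Ht. apply cdiff_ccont. now apply (Hsub n p Hin). }
  exists (x', y'). intros _. simpl fst; simpl snd.
  replace (w / 2 ^ S n) with (w / 2 ^ n / 2) by (simpl; field; generalize (Hp n); lra).
  replace (h / 2 ^ S n) with (h / 2 ^ n / 2) by (simpl; field; generalize (Hp n); lra).
  exact H. }
set (next n p := proj1_sig (constructive_indefinite_description _ (Hstep n p))).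
set (q := fix q n := match n with O => (x, y) | S n => next n (q n) end).
assert (Hq : forall n, inR n (q n) ->
  fst (q n) <= fst (q (S n)) <= fst (q n) + w / 2 ^ S n /\
  snd (q n) <= snd (q (S n)) <= snd (q n) + h / 2 ^ S n /\
  Cmod (rect_int F (fst (q n)) (snd (q n)) (w / 2 ^ n) (h / 2 ^ n)) <=
  4 * Cmod (rect_int F (fst (q (S n))) (snd (q (S n))) (w / 2 ^ S n) (h / 2 ^ S n))).
{ intros n Hin. change (q (S n)) with (next n (q n)). unfold next.
  destruct (constructive_indefinite_description _ _) as [p' Hp']. apply (Hp' Hin). }
assert (Hhalf : forall c n, c / 2 ^ n = 2 * (c / 2 ^ S n)).
{ intros c n. simpl. field. generalize (Hp n). lra. }
assert (Hin : forall n, inR n (q n)).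
{ induction n as [|n IH].
  - unfold inR; simpl. lra.
  - destruct (Hq n IH) as [H1 [H2 _]]. unfold inR in *.
    rewrite (Hhalf w n), (Hhalf h n) in IH. specialize (Hwp (S n)). lra. }
assert (HJ : forall n, Cmod (rect_int F x y w h) <=
  4 ^ n * Cmod (rect_int F (fst (q n)) (snd (q n)) (w / 2 ^ n) (h / 2 ^ n))).
{ induction n as [|n IH].
  - simpl. rewrite !Rdiv_1_r. lra.
  - eapply Rle_trans; [exact IH|]. destruct (Hq n (Hin n)) as [_ [_ H]].
    simpl (4 ^ S n). rewrite (Rmult_comm 4), Rmult_assoc. apply Rmult_le_compat_l; [|exact H].
    apply pow_le; lra. }
destruct (nested_intervals (fun n => fst (q n)) w Hw) as [lx Hlx]; [intros n; apply (Hq n (Hin n))|].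
destruct (nested_intervals (fun n => snd (q n)) h Hh) as [ly Hly]; [intros n; apply (Hq n (Hin n))|].
destruct (HF lx ly) as [d Hd].
{ specialize (Hlx 0%nat). simpl in Hlx. lra. }
{ specialize (Hly 0%nat). simpl in Hly. lra. }
apply Cmod_eq_0. apply Rle_antisym; [|apply Cmod_ge_0].
apply Rnot_lt_le. intros Hpos. set (J := Cmod (rect_int F x y w h)) in *.
set (D := w + h).
assert (HD : 0 <= D) by (unfold D; lra).
(* Chosen against the final estimate [J <= 4 * eps * (D * D)], whose right-hand side becomes less
   than [J / 2]; the [+ 1] covers a degenerate rectangle. *)
set (eps := J / (8 * (D * D + 1))).
assert (He : 0 < eps) by (apply Rdiv_lt_0_compat; nra).
assert (HeJ : eps * (8 * (D * D + 1)) = J) by (unfold eps; field; nra).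
destruct (Hd eps He) as [del [Hdel H]].
assert (Hn : exists n, D / 2 ^ n < del).
{ destruct (pow_lt_1_zero (/ 2) ltac:(rewrite Rabs_pos_eq; lra) (del / (D + 1))) as [n Hn].
  - apply Rdiv_lt_0_compat; lra.
  - exists n. specialize (Hn n (Nat.le_refl n)).
    rewrite Rabs_pos_eq in Hn by (apply pow_le; lra). rewrite pow_inv in Hn.
    apply Rle_lt_trans with ((D + 1) * / 2 ^ n).
    + apply Rmult_le_compat_r; [left; apply Rinv_0_lt_compat, Hp|lra].
    + apply Rlt_le_trans with ((D + 1) * (del / (D + 1))); [|right; field; lra].
      apply Rmult_lt_compat_l; lra. }
destruct Hn as [n Hn].
specialize (HJ n). specialize (Hlx n). specialize (Hly n). specialize (Hin n).
set (a := fst (q n)) in *. set (b := snd (q n)) in *.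
set (z0 := (lx, ly) : C) in *.
assert (HDn : D / 2 ^ n = w / 2 ^ n + h / 2 ^ n) by (unfold D; field; generalize (Hp n); lra).
assert (Hdist : on_rect (fun z => Cmod (z - z0) <= D / 2 ^ n) a b (w / 2 ^ n) (h / 2 ^ n)).
{ intros s t Hs Ht. eapply Rle_trans; [apply Cmod_le_abs|].
  unfold z0, Re, Im, Cminus, Cplus, Copp; simpl. rewrite HDn.
  apply Rplus_le_compat; apply Rabs_le; lra. }
assert (Hcont : on_rect (ccont F) a b (w / 2 ^ n) (h / 2 ^ n)).
{ intros s t Hs Ht. apply cdiff_ccont. now apply (Hsub n (q n) Hin). }
set (E := fun z => (F z - F z0 - d * (z - z0))%C).
assert (HE : on_rect (ccont E) a b (w / 2 ^ n) (h / 2 ^ n)).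
{ intros s t Hs Ht. unfold E. 
  apply (ccont_plus (fun z => (F z - F z0)%C) (fun z => (- (d * (z - z0)))%C)).
  - apply ccont_plus; [now apply Hcont|apply ccont_const].
  - apply ccont_ext_loc with (g := fun z => (- d * (z + - z0))%C) (r := 1); [lra|intros; ring|].
    apply ccont_mult; [apply ccont_const|]. apply ccont_plus; [apply ccont_id|apply ccont_const]. }
assert (HB : Cmod (rect_int F a b (w / 2 ^ n) (h / 2 ^ n)) <= 4 * (eps * (D / 2 ^ n)) * (D / 2 ^ n)).
(* The affine part of [F] at [z0] integrates to 0, so only the remainder [E] contributes, and it is
   at most [eps] times the distance to [z0]. *)
{ assert (EF : forall z, F z = ((F z0 - d * z0) + d * z + E z)%C) by (intros z; unfold E; ring).
  replace (rect_int F a b (w / 2 ^ n) (h / 2 ^ n))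
    with (rect_int (fun z => ((F z0 - d * z0) + d * z + E z)%C) a b (w / 2 ^ n) (h / 2 ^ n)).
  2:{ apply rect_int_ext; auto. intros s t _ _. symmetry. apply EF. }
  rewrite (rect_int_plus (fun z => (F z0 - d * z0) + d * z)%C E); auto.
  2:{ intros s t _ _. repeat first [apply ccont_plus|apply ccont_mult|apply ccont_const|apply ccont_id]. }
  rewrite rect_int_affine by auto. rewrite Cplus_0_l. rewrite HDn at 2.
  apply rect_int_bound; auto. intros s t Hs Ht. unfold E.
  specialize (Hdist s t Hs Ht).
  eapply Rle_trans; [apply H|]; [lra|]. apply Rmult_le_compat_l; lra. }
assert (H4 : 4 ^ n = 2 ^ n * 2 ^ n) by (rewrite <- Rpow_mult_distr; f_equal; ring).
assert (J <= 4 * eps * (D * D)).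
{ eapply Rle_trans; [exact HJ|].
  eapply Rle_trans; [apply Rmult_le_compat_l; [apply pow_le; lra|exact HB]|].
  right. rewrite H4. field. generalize (Hp n); lra. }
nra.
Qed.

(** * Circle means and logarithms on discs *)

Lemma exp_le (x y : R) : x <= y -> exp x <= exp y.
Proof. intros [H| ->]; [left; now apply exp_increasing|lra]. Qed.

Definition circ (r t : R) : C := (r * cos t, r * sin t).

Definition cmean (F : C -> C) (r : R) : C := CInt (fun t => F (circ r t)) 0 (2 * PI).

Lemma Cmod_circ (r t : R) : 0 <= r -> Cmod (circ r t) = r.
Proof. apply Cmod_pair_polar. Qed.

Lemma circ_0 (t : R) : circ 0 t = RtoC 0.
Proof. unfold circ, RtoC. f_equal; ring. Qed.

Lemma two_PI_pos : 0 < 2 * PI.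
Proof. generalize PI_RGT_0; lra. Qed.

Lemma continuous_circ (r t : R) :
  continuous (T := R_UniformSpace) (U := C_UniformSpace) (circ r) t.
Proof.
apply continuous_pair.
- apply (continuous_mult (K := R_AbsRing) (fun _ => r) cos); [apply continuous_const|apply continuous_cos].
- apply (continuous_mult (K := R_AbsRing) (fun _ => r) sin); [apply continuous_const|apply continuous_sin].
Qed.

Lemma pcont_circ (F : C -> C) (r a b : R) :
  0 <= r -> (forall z, Cmod z = r -> ccont F z) -> pcont (fun t => F (circ r t)) a b.
Proof.
intros Hr H t _.
apply (continuous_comp (V := C_UniformSpace) (W := C_UniformSpace) (circ r) F).
- apply continuous_circ.
- apply ccont_continuous, H. now apply Cmod_circ.
Qed.

(* The two horizontal sides of the rectangle in the logarithmic plane cancel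
   by periodicity. *)
Lemma cmean_annulus (F : C -> C) (r1 r2 : R) :
  0 < r1 <= r2 -> (forall z, r1 <= Cmod z <= r2 -> cdiff F z) ->
  cmean F r1 = cmean F r2.
Proof.
intros [H1 H12] HF.
assert (Hln : ln r1 <= ln r2).
{ destruct H12 as [H12| ->]; [left; now apply ln_increasing|lra]. }
pose proof two_PI_pos as Hpi.
assert (G := goursat (fun z => F (cexp z)) (ln r1) 0 (ln r2 - ln r1) (2 * PI)).
assert (E : forall r t, 0 < r -> F (cexp (ln r, t)) = F (circ r t)).
{ intros r t Hr. unfold cexp, circ, Re, Im; simpl. now rewrite exp_ln. }
unfold rect_int in G.
replace (ln r1 + (ln r2 - ln r1)) with (ln r2) in G by ring. rewrite Rplus_0_l in G.
rewrite (CInt_ext (fun t => F (cexp (t, 2 * PI))) (fun t => F (cexp (t, 0)))) in G.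
2: exact Hln.
2:{ intros t _. f_equal. unfold cexp, Re, Im; simpl. rewrite cos_2PI, sin_2PI, cos_0, sin_0. reflexivity. }
rewrite (CInt_ext (fun t => F (cexp (ln r1, t))) (fun t => F (circ r1 t))) in G;
  [|lra|intros; apply E; lra].
rewrite (CInt_ext (fun t => F (cexp (ln r2, t))) (fun t => F (circ r2 t))) in G;
  [|lra|intros; apply E; lra].
fold (cmean F r1) in G. fold (cmean F r2) in G.
assert (G' : (Ci * (cmean F r2 - cmean F r1))%C = RtoC 0).
{ rewrite <- G; [ring|lra|lra|]. intros s t Hs Ht.
  apply (cdiff_comp F cexp); [|eexists; apply cderiv_cexp].
  apply HF. rewrite Cmod_cexp. unfold Re; simpl.
  replace (ln r1 + (ln r2 - ln r1)) with (ln r2) in Hs by ring.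
  rewrite <- (exp_ln r1) by lra. rewrite <- (exp_ln r2) by lra.
  split; apply exp_le; lra. }
replace (cmean F r1) with (cmean F r2 + Ci * (Ci * (cmean F r2 - cmean F r1)))%C.
- rewrite G'. ring.
- assert (Ei : (Ci * Ci)%C = (-(1))%C) by (unfold Ci, Cmult, Copp, RtoC; simpl; f_equal; ring).
  rewrite Cmult_assoc, Ei. ring.
Qed.

Lemma cmean_continuity (F : C -> C) (R0 R1 r0 : R) :
  0 <= r0 <= R0 -> R0 < R1 -> (forall z, Cmod z < R1 -> ccont F z) ->
  forall eps, 0 < eps -> exists del, 0 < del /\
    forall r, 0 <= r <= R0 -> Rabs (r - r0) < del -> Cmod (cmean F r - cmean F r0) <= eps.
Proof.
intros Hr0 HR HF eps He.
pose proof two_PI_pos as Hpi.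
(* The integrand is at most [2 * e], [CInt_bound] doubles this, and the interval has length
   [2 * PI]: in total [8 * PI * e]. *)
set (e := eps / (8 * PI)). pose proof PI_RGT_0.
assert (He0 : 0 < e) by (apply Rdiv_lt_0_compat; lra).
assert (Hc : forall r t, 0 <= r <= R0 ->
  continuous (T := prod_UniformSpace R_UniformSpace R_UniformSpace) (U := C_UniformSpace)
    (fun p : R * R => circ (fst p) (snd p)) (r, t)).
{ intros r t Hr. apply continuous_pair.
  - apply (continuous_mult (K := R_AbsRing) (U := prod_UniformSpace R_UniformSpace R_UniformSpace)
      (fun p : R * R => fst p) (fun p : R * R => cos (snd p))); [apply continuous_fst|].
    apply (continuous_comp (U := prod_UniformSpace R_UniformSpace R_UniformSpace) (V := R_UniformSpace) (fun p : R * R => snd p) cos); [apply continuous_snd|apply continuous_cos].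
  - apply (continuous_mult (K := R_AbsRing) (U := prod_UniformSpace R_UniformSpace R_UniformSpace)
      (fun p : R * R => fst p) (fun p : R * R => sin (snd p))); [apply continuous_fst|].
    apply (continuous_comp (U := prod_UniformSpace R_UniformSpace R_UniformSpace) (V := R_UniformSpace) (fun p : R * R => snd p) sin); [apply continuous_snd|apply continuous_sin]. }
assert (HFc : forall r t, 0 <= r <= R0 -> ccont F (circ r t)).
{ intros r t Hr. apply HF. rewrite Cmod_circ; lra. }
destruct (uniform_continuity_2d (fun r t => Re (F (circ r t))) 0 R0 0 (2 * PI)) with (eps := mkposreal e He0)
  as [d1 H1].
{ intros r t Hr Ht. apply continuity_2d_pt_filterlim.
  apply (continuous_Re_comp F (fun p : R * R => circ (fst p) (snd p)) (r, t) (Hc r t Hr)).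
  now apply HFc. }
destruct (uniform_continuity_2d (fun r t => Im (F (circ r t))) 0 R0 0 (2 * PI)) with (eps := mkposreal e He0)
  as [d2 H2].
{ intros r t Hr Ht. apply continuity_2d_pt_filterlim.
  apply (continuous_Im_comp F (fun p : R * R => circ (fst p) (snd p)) (r, t) (Hc r t Hr)).
  now apply HFc. }
exists (Rmin d1 d2). split; [apply Rmin_pos; apply cond_pos|].
intros r Hr Hd.
assert (Pc : forall r, 0 <= r <= R0 -> pcont (fun t => F (circ r t)) 0 (2 * PI)).
{ intros r' Hr'. apply pcont_circ; [lra|]. intros z Hz. apply HF. lra. }
unfold cmean, Cminus. rewrite <- CInt_opp by (auto; lra).
assert (Po : pcont (fun t => - F (circ r0 t))%C 0 (2 * PI)).
{ apply (pcont_circ (fun z => - F z)%C); [lra|]. intros z Hz.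
  apply ccont_ext_loc with (g := fun z => (-(1) * F z)%C) (r := 1); [lra|intros; ring|].
  apply ccont_mult; [apply ccont_const|apply HF; lra]. }
rewrite <- CInt_plus; [|lra|auto|exact Po].
eapply Rle_trans; [apply (CInt_bound _ _ _ (2 * e)); [lra| |]|].
- intros t Ht.
  apply (continuous_plus (K := C_AbsRing) (V := C_NormedModule) (fun t => F (circ r t)) (fun t => (- F (circ r0 t))%C)).
  + now apply Pc.
  + now apply Po.
- intros t Ht. eapply Rle_trans; [apply Cmod_le_abs|].
  assert (A1 := H1 r0 t r t ltac:(lra) Ht ltac:(lra) Ht).
  assert (A2 := H2 r0 t r t ltac:(lra) Ht ltac:(lra) Ht).
  simpl in A1, A2. rewrite Rminus_diag, Rabs_R0 in A1, A2.
  specialize (A1 (Rlt_le_trans _ _ _ Hd (Rmin_l _ _)) (cond_pos d1)).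
  specialize (A2 (Rlt_le_trans _ _ _ Hd (Rmin_r _ _)) (cond_pos d2)).
  unfold Re, Im, Cplus, Copp in *; simpl in *. unfold Rminus in *. lra.
- unfold e. right. field. lra.
Qed.

Lemma le_all_eps (x : R) : (forall eps, 0 < eps -> x <= eps) -> x <= 0.
Proof. intros H. apply Rnot_lt_le. intros Hx. specialize (H (x / 2)). lra. Qed.

(* Continuity of circle means bridges the exceptional circle [Cmod z = r0]. *)
Lemma cmean_center (F : C -> C) (r0 r R1 : R) :
  0 < r0 < r -> r < R1 -> (forall z, Cmod z < R1 -> ccont F z) ->
  (forall z, 0 < Cmod z < R1 -> Cmod z <> r0 -> cdiff F z) ->
  cmean F r = (RtoC (2 * PI) * F (RtoC 0))%C.
Proof.
intros Hr0 Hr Hc Hd.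
assert (E1 : cmean F r = cmean F r0).
{ assert (H : Cmod (cmean F r - cmean F r0) <= 0).
  { apply le_all_eps. intros eps He.
    destruct (cmean_continuity F r R1 r0 ltac:(lra) Hr Hc eps He) as [del [Hdel H]].
    set (s := Rmin r (r0 + del / 2)).
    assert (s <= r) by apply Rmin_l. assert (s <= r0 + del / 2) by apply Rmin_r.
    assert (r0 < s) by (apply Rmin_glb_lt; lra).
    rewrite <- (cmean_annulus F s r); [|lra|intros z Hz; apply Hd; lra].
    apply H; [lra|]. apply Rabs_lt_between. lra. }
  assert (H0 := Cmod_ge_0 (cmean F r - cmean F r0)).
  assert (H1 := Cmod_eq_0 _ (Rle_antisym _ _ H H0)).
  replace (cmean F r) with (cmean F r - cmean F r0 + cmean F r0)%C by ring. rewrite H1. ring. }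
assert (E2 : cmean F r0 = cmean F 0).
{ assert (H : Cmod (cmean F r0 - cmean F 0) <= 0).
  { apply le_all_eps. intros eps He.
    destruct (cmean_continuity F r R1 r0 ltac:(lra) Hr Hc (eps / 2) ltac:(lra)) as [d1 [Hd1 H1]].
    destruct (cmean_continuity F r R1 0 ltac:(lra) Hr Hc (eps / 2) ltac:(lra)) as [d2 [Hd2 H2]].
    set (s := Rmax (r0 / 2) (r0 - d1 / 2)).
    assert (Hs1 : r0 / 2 <= s) by apply Rmax_l. assert (r0 - d1 / 2 <= s) by apply Rmax_r.
    assert (s < r0) by (apply Rmax_lub_lt; lra).
    set (u := Rmin s (d2 / 2)).
    assert (u <= s) by apply Rmin_l. assert (u <= d2 / 2) by apply Rmin_r.
    assert (0 < u) by (apply Rmin_glb_lt; lra).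
    specialize (H1 s ltac:(lra)). specialize (H2 u ltac:(lra)).
    rewrite <- (cmean_annulus F u s) in H1; [|lra|intros z Hz; apply Hd; lra].
    rewrite Cmod_sub_sym in H1.
    specialize (H1 ltac:(apply Rabs_lt_between; lra)). specialize (H2 ltac:(apply Rabs_lt_between; lra)).
    eapply Rle_trans; [apply (Cmod_sub_triangle _ (cmean F u))|]. lra. }
  assert (H0 := Cmod_ge_0 (cmean F r0 - cmean F 0)).
  assert (H1 := Cmod_eq_0 _ (Rle_antisym _ _ H H0)).
  replace (cmean F r0) with (cmean F r0 - cmean F 0 + cmean F 0)%C by ring. rewrite H1. ring. }
rewrite E1, E2. unfold cmean.
rewrite (CInt_ext _ (fun _ => F (RtoC 0))); [|generalize two_PI_pos; lra|intros; now rewrite circ_0].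
rewrite CInt_const, Rminus_0_r. ring.
Qed.

Lemma cmean_holo (F : C -> C) (r R1 : R) :
  0 < r < R1 -> (forall z, Cmod z < R1 -> cdiff F z) ->
  cmean F r = (RtoC (2 * PI) * F (RtoC 0))%C.
Proof.
intros Hr Hd. apply cmean_center with (r0 := r / 2) (R1 := R1); try lra.
- intros z Hz. now apply cdiff_ccont, Hd.
- intros z Hz _. apply Hd. lra.
Qed.

Lemma Re_div_pos (a b : C) : Cmod (a - b) < Cmod b -> 0 < Re (a / b)%C.
Proof.
intros H. assert (Hb : 0 < Cmod b) by (generalize (Cmod_ge_0 (a - b)); lra).
assert (Hb0 : b <> RtoC 0) by now apply Cmod_gt_0.
assert (H1 : Cmod (a / b - 1) < 1).
{ replace (a / b - 1)%C with ((a - b) / b)%C by (field; exact Hb0).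
  rewrite Cmod_div by exact Hb0. apply Rmult_lt_reg_r with (Cmod b); [exact Hb|].
  unfold Rdiv. rewrite Rmult_assoc, Rinv_l; lra. }
pose proof (re_le_Cmod (a / b - 1)) as H2.
replace (Re (a / b - 1)%C) with (Re (a / b)%C - 1) in H2
  by (unfold Re, Cminus, Cplus, Copp, RtoC; simpl; ring).
destruct (Rabs_def2 (Re (a / b)%C - 1) 1); lra.
Qed.

(** A Lebesgue number for the covering of the closed disc by neighbourhoods on which [h] varies by
    less than a quarter of its modulus at the centre. The conclusion places [h z / h z'] within
    distance 1 of 1, hence in the domain of [clog]. *)
Lemma uniform_ratio (h : C -> C) (r : R) :
  (forall z, Cmod z <= r -> ccont h z /\ h z <> RtoC 0) ->
  exists d, 0 < d /\ forall z z', Cmod z <= r -> Cmod z' <= r -> Cmod (z - z') < d ->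
    Cmod (h z - h z') < Cmod (h z').
Proof.
intros H.
(* Compactness is applied to a square around the disc. A point outside the disc receives a gauge so
   small that it cannot be the centre responsible for a point of the disc. *)
assert (Hdel : forall p : C, exists d : posreal,
  (r < Cmod p -> d <= (Cmod p - r) / 4) /\
  (Cmod p <= r -> forall w, Cmod (w - p) < 4 * d -> Cmod (h w - h p) < Cmod (h p) / 4)).
{ intros p. destruct (Rle_dec (Cmod p) r) as [Hp|Hp].
  - destruct (H p Hp) as [Hc Hn]. apply Cmod_gt_0 in Hn.
    destruct (Hc (Cmod (h p) / 4)) as [d [Hd H1]]; [lra|].
    assert (Hd4 : 0 < d / 4) by lra. exists (mkposreal _ Hd4). split; [lra|].
    intros _ w Hw. apply H1. simpl in Hw. lra.
  - assert (Hd4 : 0 < (Cmod p - r) / 4) by lra. exists (mkposreal _ Hd4). split; simpl; lra. }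
set (delta u v := proj1_sig (constructive_indefinite_description _ (Hdel (u, v)))).
destruct (compactness_value_2d (- r) r (- r) r delta) as [d Hd].
exists d. split; [apply cond_pos|]. intros z z' Hz Hz' Hzz.
assert (Hx := re_le_Cmod z). assert (Hy := im_le_Cmod z).
apply Rabs_le_between in Hx. apply Rabs_le_between in Hy.
specialize (Hd (Re z) (Im z) ltac:(lra) ltac:(lra)). apply NNPP in Hd.
destruct Hd as [u [v [_ [_ [Hu [Hv Hduv]]]]]].
unfold delta in Hu, Hv, Hduv. destruct (constructive_indefinite_description _ _) as [e [He1 He2]].
simpl in Hu, Hv, Hduv.
assert (D1 : Cmod (z - (u, v)) < 2 * e).
{ eapply Rle_lt_trans; [apply Cmod_le_abs|].
  unfold Re, Im, Cminus, Cplus, Copp in *; simpl in *. unfold Rminus in *. lra. }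
assert (D2 : Cmod (z' - (u, v)) < 3 * e).
{ eapply Rle_lt_trans; [apply (Cmod_sub_triangle _ z)|]. rewrite Cmod_sub_sym. lra. }
destruct (Rle_dec (Cmod (u, v)) r) as [Hp|Hp].
- assert (Hn := H _ Hp). destruct Hn as [_ Hn]. apply Cmod_gt_0 in Hn.
  pose proof (cond_pos e).
  assert (A1 := He2 Hp z ltac:(lra)). assert (A2 := He2 Hp z' ltac:(lra)).
  assert (A3 := Cmod_sub_triangle (h z) (h (u, v)) (h z')).
  rewrite (Cmod_sub_sym (h (u, v))) in A3.
  assert (A4 := Cmod_sub_ge (h (u, v)) (h z')). rewrite (Cmod_sub_sym (h (u, v))) in A4. lra.
- specialize (He1 ltac:(lra)).
  assert (A := Cmod_sub_ge (u, v) z). rewrite Cmod_sub_sym in A. lra.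
Qed.

Fixpoint csum (f : nat -> C) (n : nat) : C :=
  match n with O => RtoC 0 | S n => (csum f n + f n)%C end.

Lemma cdiff_csum (f : nat -> C -> C) (z : C) (n : nat) :
  (forall k, (k < n)%nat -> cdiff (f k) z) -> cdiff (fun w => csum (fun k => f k w) n) z.
Proof.
induction n as [|n IH]; intros H; simpl; [apply cdiff_const|].
apply cdiff_plus; [apply IH; intros; apply H; lia|apply H; lia].
Qed.

Lemma csum_0 (f : nat -> C) (n : nat) : (forall k, (k < n)%nat -> f k = RtoC 0) -> csum f n = RtoC 0.
Proof.
induction n as [|n IH]; intros H; simpl; [reflexivity|].
rewrite IH by (intros; apply H; lia). rewrite H by lia. ring.
Qed.

(** Along the radius to [z], divided into [M] steps, consecutive values of [h] have a ratio in the
    right half-plane, where [clog] is holomorphic. The logarithms of these ratios add up to a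
    logarithm of [h z / h 0]. *)
Lemma log_on_disc (h : C -> C) (R1 r : R) :
  0 < r < R1 -> (forall z, Cmod z < R1 -> cdiff h z /\ h z <> RtoC 0) ->
  exists L : C -> C, (forall z, Cmod z < r -> cdiff L z) /\ L (RtoC 0) = RtoC 0 /\
    forall z, Cmod z < r -> Re (L z) = ln (Cmod (h z)) - ln (Cmod (h (RtoC 0))).
Proof.
intros Hr H.
destruct (uniform_ratio h r) as [d [Hd Hu]].
{ intros z Hz. destruct (H z ltac:(lra)) as [H1 H2]. split; [now apply cdiff_ccont|exact H2]. }
destruct (nfloor_ex (r / d)) as [N HN]; [apply Rdiv_le_0_compat; lra|].
set (M := S N). assert (HM : 0 < INR M) by (apply lt_0_INR; unfold M; lia).
assert (HMd : r / INR M < d).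
{ unfold M at 1. rewrite S_INR. apply Rmult_lt_reg_r with (INR N + 1); [rewrite <- S_INR; exact HM|].
  unfold Rdiv. rewrite Rmult_assoc, Rinv_l by (rewrite <- S_INR; apply Rgt_not_eq, HM).
  rewrite Rmult_1_r. apply Rmult_lt_reg_r with (/ d); [now apply Rinv_0_lt_compat|].
  replace (d * (INR N + 1) * / d) with (INR N + 1) by (field; lra). unfold Rdiv in HN. lra. }
set (t k := RtoC (INR k / INR M)).
assert (Ht : forall k z, (k <= M)%nat -> Cmod z < r -> Cmod (t k * z) < r).
{ intros k z Hk Hz. rewrite Cmod_mult. unfold t. rewrite Cmod_R, Rabs_pos_eq.
  - assert (INR k / INR M <= 1).
    { apply Rmult_le_reg_r with (INR M); [exact HM|]. unfold Rdiv. rewrite Rmult_assoc, Rinv_l by lra.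
      apply le_INR in Hk. lra. }
    pose proof (Cmod_ge_0 z). nra.
  - apply Rdiv_le_0_compat; [apply pos_INR|exact HM]. }
assert (Hpos : forall k z, (k < M)%nat -> Cmod z < r -> 0 < Re (h (t (S k) * z) / h (t k * z))%C).
{ intros k z Hk Hz. apply Re_div_pos. apply Hu.
  - left; apply Ht; [lia|exact Hz].
  - left; apply Ht; [lia|exact Hz].
  - replace (t (S k) * z - t k * z)%C with (RtoC (/ INR M) * z)%C.
    + rewrite Cmod_mult, Cmod_R, Rabs_pos_eq by (left; now apply Rinv_0_lt_compat).
      apply Rle_lt_trans with (2 := HMd). unfold Rdiv. rewrite Rmult_comm.
      apply Rmult_le_compat_r; [left; now apply Rinv_0_lt_compat|lra].
    + unfold t. rewrite S_INR. unfold Rdiv. rewrite !RtoC_mult, RtoC_plus. ring. }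
assert (Hnz : forall k z, (k <= M)%nat -> Cmod z < r -> h (t k * z)%C <> RtoC 0).
{ intros k z Hk Hz. apply H. assert (A := Ht k z Hk Hz). lra. }
exists (fun z => csum (fun k => clog (h (t (S k) * z) / h (t k * z))%C) M). split; [|split].
- intros z Hz. apply (cdiff_csum (fun k z => clog (h (t (S k) * z) / h (t k * z))%C)). intros k Hk.
  assert (Hd1 : forall k, (k <= M)%nat -> cdiff (fun z => h (t k * z)%C) z).
  { intros j Hj. apply (cdiff_comp h (fun z => (t j * z)%C)).
    - apply H. assert (A := Ht j z Hj Hz). lra.
    - apply cdiff_mult; [apply cdiff_const|apply cdiff_id]. }
  apply (cdiff_comp clog (fun z => (h (t (S k) * z) / h (t k * z))%C)).
  + apply cdiff_clog. now apply Hpos.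
  + apply (cdiff_div (fun z => h (t (S k) * z)%C) (fun z => h (t k * z)%C)).
    * apply Hnz; [lia|exact Hz].
    * apply Hd1; lia.
    * apply Hd1; lia.
- apply csum_0. intros k Hk. rewrite !Cmult_0_r.
  assert (Hn0 : h (RtoC 0) <> RtoC 0) by (apply H; rewrite Cmod_0; lra).
  replace (h 0 / h 0)%C with (RtoC 1) by (field; exact Hn0).
  unfold clog. rewrite Cmod_1, ln_1. unfold Re, Im, RtoC; simpl.
  unfold Rdiv. rewrite Rmult_0_l, atan_0. reflexivity.
- intros z Hz.
  assert (A : forall n, (n <= M)%nat ->
    Re (csum (fun k => clog (h (t (S k) * z) / h (t k * z))%C) n) =
    ln (Cmod (h (t n * z)%C)) - ln (Cmod (h (RtoC 0)))).
  { induction n as [|n IH]; intros Hn.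
    - simpl. unfold t at 1. simpl. unfold Rdiv. rewrite Rmult_0_l, Cmult_0_l.
      unfold Re, RtoC; simpl. ring.
    - simpl csum. transitivity (Re (csum (fun k => clog (h (t (S k) * z) / h (t k * z))%C) n)
        + ln (Cmod (h (t (S n) * z) / h (t n * z))%C)); [reflexivity|].
      rewrite IH by lia. rewrite Cmod_div by (apply Hnz; [lia|exact Hz]).
      rewrite ln_div; [ring| |]; apply Cmod_gt_0; apply Hnz; trivial; lia. }
  rewrite A by lia. unfold t, Rdiv. rewrite Rinv_r by lra. now rewrite Cmult_1_l.
Qed.

(** * A symmetric Harnack inequality *)

Lemma cderiv_eq (f : C -> C) (z a b : C) : a = b -> cderiv f z a -> cderiv f z b.
Proof. now intros ->. Qed.

Lemma cderiv_pow (n : nat) (z : C) : cderiv (fun w => w ^ S n)%C z (RtoC (INR (S n)) * z ^ n).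
Proof.
induction n as [|n IH].
- apply cderiv_eq with (RtoC 1); [simpl; ring|].
  apply cderiv_ext_loc with (g := fun w => w) (r := 1); [lra|intros; simpl; ring|apply cderiv_id].
- apply cderiv_eq with (1 * z ^ S n + z * (RtoC (INR (S n)) * z ^ n))%C.
  + rewrite (S_INR (S n)), RtoC_plus. simpl (z ^ S n)%C. ring.
  + apply (cderiv_mult (fun w => w) (fun w => w ^ S n)%C); [apply cderiv_id|exact IH].
Qed.

Lemma neq_0_loc (f : C -> C) (z : C) :
  ccont f z -> f z <> RtoC 0 -> exists r, 0 < r /\ forall w, Cmod (w - z) < r -> f w <> RtoC 0.
Proof.
intros Hc Hz. destruct (Hc (Cmod (f z))) as [r [Hr H]]; [now apply Cmod_gt_0|].
exists r; split; [exact Hr|]. intros w Hw E. specialize (H w Hw). rewrite E in H.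
replace (0 - f z)%C with (- f z)%C in H by ring. rewrite Cmod_opp in H. lra.
Qed.

Lemma Cminus_eq_0 (a b : C) : (a - b)%C = RtoC 0 -> a = b.
Proof. intros E. replace a with (a - b + b)%C by ring. rewrite E. ring. Qed.

(** L'Hôpital's rule at a simple zero of [D]: cancelling [w - a] leaves the quotient of the two
    slopes, and that of [D] does not vanish near [a]. *)
Lemma quotient_limit (N D : C -> C) (a d : C) :
  cdiff N a -> cderiv D a d -> N a = RtoC 0 -> D a = RtoC 0 -> d <> RtoC 0 ->
  exists v, forall eps, 0 < eps -> exists del, 0 < del /\
    forall w, w <> a -> Cmod (w - a) < del -> D w <> RtoC 0 /\ Cmod (N w / D w - v) < eps.
Proof.
intros [n HN] HD EN ED Hd. apply cderiv_carath in HN, HD.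
destruct HN as [p [Hp [Ep Fp]]]. destruct HD as [q [Hq [Eq Fq]]].
exists (p a / q a)%C. intros eps He.
assert (Hqa : q a <> RtoC 0) by congruence.
destruct (ccont_mult p (fun w => / q w)%C a Hp (ccont_inv q a Hqa Hq) eps He) as [d1 [Hd1 H1]].
destruct (neq_0_loc q a Hq Hqa) as [d2 [Hd2 H2]].
exists (Rmin d1 d2); split; [now apply Rmin_pos|]. intros w Hwa Hw.
assert (Hw1 : (w - a)%C <> RtoC 0) by (intros E; now apply Hwa, Cminus_eq_0).
specialize (H1 w (Rlt_le_trans _ _ _ Hw (Rmin_l _ _))).
specialize (H2 w (Rlt_le_trans _ _ _ Hw (Rmin_r _ _))).
rewrite (Fp w), (Fq w), EN, ED, !Cplus_0_l. split; [now apply Cmult_neq_0|].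
replace (p w * (w - a) / (q w * (w - a)))%C with (p w * / q w)%C by (field; auto).
exact H1.
Qed.

(** Only continuity is asserted at the zeros of [D]. In the application these zeros all lie on one
    circle about 0, and [cmean_center] tolerates such a circle. *)
Lemma quotient_extension (N D : C -> C) (R1 : R) :
  (forall z, Cmod z < R1 -> cdiff N z /\ cdiff D z) ->
  (forall z, Cmod z < R1 -> D z = RtoC 0 -> N z = RtoC 0 /\ exists d, d <> RtoC 0 /\ cderiv D z d) ->
  exists K : C -> C, (forall z, Cmod z < R1 -> ccont K z) /\
    forall z, D z <> RtoC 0 -> K z = (N z / D z)%C.
Proof.
intros Hd H0.
set (P a v := forall eps, 0 < eps -> exists del, 0 < del /\
    forall w, w <> a -> Cmod (w - a) < del -> D w <> RtoC 0 /\ Cmod (N w / D w - v) < eps).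
exists (fun z => if Ceq_dec (D z) 0 then epsilon (inhabits (RtoC 0)) (P z) else N z / D z)%C.
assert (HK : forall z, D z <> RtoC 0 ->
  (if Ceq_dec (D z) 0 then epsilon (inhabits (RtoC 0)) (P z) else N z / D z)%C = (N z / D z)%C).
{ intros z Hz. destruct (Ceq_dec (D z) 0); [contradiction|reflexivity]. }
split; [|exact HK].
intros z Hz. destruct (Hd z Hz) as [HN HD].
destruct (Ceq_dec (D z) 0) as [E|E].
- destruct (H0 z Hz E) as [EN [d [Hd0 Hdd]]].
  assert (Hv : exists v, P z v) by now apply (quotient_limit N D z d).
  apply (epsilon_spec (inhabits (RtoC 0)) (P z)) in Hv.
  intros eps He. destruct (Hv eps He) as [del [Hdel H]].
  exists del; split; [exact Hdel|]. intros w Hw.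
  destruct (Ceq_dec w z) as [->|Hwz].
  { replace (_ - _)%C with (RtoC 0) by ring. now rewrite Cmod_0. }
  destruct (H w Hwz Hw) as [H1 H2]. rewrite HK by exact H1.
  destruct (Ceq_dec (D z) 0); [exact H2|contradiction].
- destruct (neq_0_loc D z (cdiff_ccont _ _ HD) E) as [r [Hr Hn]].
  apply ccont_ext_loc with (g := fun z => (N z / D z)%C) (r := r); [exact Hr| |].
  + intros w Hw. apply HK. now apply Hn.
  + apply cdiff_ccont. now apply cdiff_div.
Qed.

Lemma Cmod_pow_lt (z : C) (r : R) (m : nat) : (0 < m)%nat -> Cmod z < r -> Cmod (z ^ m) < r ^ m.
Proof.
intros Hm Hz. rewrite Cmod_pow. pose proof (Cmod_ge_0 z).
destruct m as [|m]; [lia|]. clear Hm.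
induction m as [|m IH]; [simpl; lra|].
simpl in *. assert (0 <= Cmod z * Cmod z ^ m) by (apply Rmult_le_pos; [lra|apply pow_le; lra]). nra.
Qed.

Lemma pow_root_inj (x y : R) (m : nat) : (0 < m)%nat -> 0 <= x -> 0 <= y -> x ^ m = y ^ m -> x = y.
Proof.
intros Hm Hx Hy E. destruct (Rtotal_order x y) as [H|[H|H]]; [|exact H|].
- exfalso. assert (A := Cmod_pow_lt (RtoC x) y m Hm). rewrite Cmod_R, Rabs_pos_eq in A by exact Hx.
  rewrite Cmod_pow, Cmod_R, Rabs_pos_eq in A by exact Hx. specialize (A H). lra.
- exfalso. assert (A := Cmod_pow_lt (RtoC y) x m Hm). rewrite Cmod_R, Rabs_pos_eq in A by exact Hy.
  rewrite Cmod_pow, Cmod_R, Rabs_pos_eq in A by exact Hy. specialize (A H). lra.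
Qed.

Lemma cmean_plus (F G : C -> C) (r : R) :
  0 <= r -> (forall z, Cmod z = r -> ccont F z) -> (forall z, Cmod z = r -> ccont G z) ->
  cmean (fun z => F z + G z)%C r = (cmean F r + cmean G r)%C.
Proof.
intros Hr HF HG. unfold cmean.
apply (CInt_plus (fun t => F (circ r t)) (fun t => G (circ r t))).
- generalize two_PI_pos; lra.
- now apply pcont_circ.
- now apply pcont_circ.
Qed.

Lemma cmean_scal (c : C) (F : C -> C) (r : R) :
  0 <= r -> (forall z, Cmod z = r -> ccont F z) ->
  cmean (fun z => c * F z)%C r = (c * cmean F r)%C.
Proof.
intros Hr HF. unfold cmean. apply (CInt_scal c (fun t => F (circ r t))).
- generalize two_PI_pos; lra.
- now apply pcont_circ.
Qed.

Lemma cmean_const (c : C) (r : R) : cmean (fun _ => c) r = (c * RtoC (2 * PI))%C.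
Proof. unfold cmean. rewrite CInt_const, Rminus_0_r. reflexivity. Qed.

Lemma cmean_ext (F G : C -> C) (r : R) :
  0 <= r -> (forall z, Cmod z = r -> F z = G z) -> cmean F r = cmean G r.
Proof.
intros Hr E. apply CInt_ext; [generalize two_PI_pos; lra|].
intros t _. apply E. now apply Cmod_circ.
Qed.

Lemma cmean_Re_ge_0 (F : C -> C) (r : R) :
  0 <= r -> (forall z, Cmod z = r -> ccont F z) -> (forall z, Cmod z = r -> 0 <= Re (F z)) ->
  0 <= Re (cmean F r).
Proof.
intros Hr Hc H. unfold cmean, CInt. unfold Re at 1; simpl.
apply RInt_ge_0; [generalize two_PI_pos; lra| |].
- apply pcont_ex_Re; [generalize two_PI_pos; lra|]. now apply pcont_circ.
- intros t _. apply H. now apply Cmod_circ.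
Qed.

Lemma cmean_conj (F : C -> C) (r : R) :
  0 <= r -> (forall z, Cmod z = r -> ccont F z) ->
  cmean (fun z => Cconj (F z)) r = Cconj (cmean F r).
Proof.
intros Hr Hc. unfold cmean, CInt, Cconj; simpl. f_equal.
apply (RInt_opp (V := R_CompleteNormedModule) (fun t => Im (F (circ r t)))).
apply pcont_ex_Im; [generalize two_PI_pos; lra|]. now apply pcont_circ.
Qed.

(* A Harnack inequality gaining the factor [(|z0| / r) ^ m] from the symmetry of
   [F]: on the circle, the kernel [z ^ m / (z ^ m - z0 ^ m)] is the conjugate of
   a function holomorphic in the disc. *)
Lemma symmetric_harnack (F : C -> C) (m : nat) (z0 : C) (r R1 B : R) :
  (0 < m)%nat -> 0 < Cmod z0 < r -> r < R1 -> 0 <= B ->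
  (forall z, Cmod z < R1 -> cdiff F z) ->
  (forall z w, (z ^ m)%C = (w ^ m)%C -> F z = F w) ->
  F (RtoC 0) = RtoC 0 ->
  (forall z, Cmod z = r -> Re (F z) <= B) ->
  - (2 * B * (Cmod z0 ^ m / (r ^ m - Cmod z0 ^ m))) <= Re (F z0).
Proof.
intros Hm Hz0 Hr HB HF Hsym F0 HFB.
assert (Hr0 : 0 < r) by lra.
set (a := (z0 ^ m)%C). set (x := Cmod z0 ^ m). set (y := r ^ m).
assert (Ha : Cmod a = x) by apply Cmod_pow.
assert (Hxy : 0 < x < y).
{ split; [apply pow_lt; lra|]. unfold x, y. rewrite <- Cmod_pow. apply Cmod_pow_lt; [exact Hm|lra]. }
assert (Hzm : forall z, Cmod z = r -> Cmod (z ^ m) = y) by (intros z Hz; rewrite Cmod_pow, Hz; reflexivity).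
assert (HD : forall z, Cmod z = r -> (z ^ m - a)%C <> RtoC 0).
{ intros z Hz E. apply Cminus_eq_0 in E. apply (f_equal Cmod) in E. rewrite Hzm, Ha in E; [lra|exact Hz]. }
set (kap := x / (y - x)). assert (Hkap : 0 < kap) by (apply Rdiv_lt_0_compat; lra).
set (k z := (z ^ m / (z ^ m - a))%C).
set (b z := (RtoC (y * y) / (RtoC (y * y) - Cconj a * z ^ m))%C).
assert (Hkb : forall z, Cmod z = r -> k z = Cconj (b z)).
{ intros z Hz. unfold k, b.
  assert (Hzz : (z ^ m * Cconj (z ^ m))%C = RtoC (y * y)).
  { rewrite <- Cmod2_conj, Hzm by exact Hz. f_equal. ring. }
  assert (Hn : Cconj (z ^ m) <> RtoC 0).
  { apply Cmod_gt_0. rewrite Cmod_conj, Hzm by exact Hz. lra. }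
  assert (Hn2 : (RtoC (y * y) - Cconj a * z ^ m)%C <> RtoC 0).
  { intros E. apply Cminus_eq_0 in E. apply (f_equal Cmod) in E.
    rewrite Cmod_mult, Cmod_conj, Cmod_R, Hzm, Ha, Rabs_pos_eq in E by (exact Hz || nra). nra. }
  rewrite Cdiv_conj by exact Hn2. rewrite Cminus_conj, Cmult_conj, Cconj_conj.
  assert (ER : Cconj (RtoC (y * y)) = RtoC (y * y)) by (unfold Cconj, RtoC; simpl; f_equal; ring).
  rewrite ER, <- Hzz. field. split; [|now apply HD].
  replace (z ^ m * Cconj (z ^ m) - a * Cconj (z ^ m))%C with ((z ^ m - a) * Cconj (z ^ m))%C by ring.
  apply Cmult_neq_0; [now apply HD|exact Hn]. }
assert (Hk : forall z, Cmod z = r -> ccont k z).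
{ intros z Hz. apply cdiff_ccont. apply (cdiff_div (fun z => z ^ m)%C (fun z => z ^ m - a)%C).
  - now apply HD.
  - apply cdiff_pow, cdiff_id.
  - apply cdiff_minus; [apply cdiff_pow, cdiff_id|apply cdiff_const]. }
(* The poles of [b] are the reflections in the circle of the solutions of [z ^ m = a], and so have
   modulus [r * r / Cmod z0]. *)
set (R2 := Rmin R1 (r * r / Cmod z0)).
assert (HR2 : r < R2).
{ apply Rmin_glb_lt; [lra|]. apply Rmult_lt_reg_r with (Cmod z0); [lra|].
  replace (r * r / Cmod z0 * Cmod z0) with (r * r) by (field; lra). nra. }
assert (Hb : forall z, Cmod z < R2 -> cdiff b z).
{ intros z Hz. apply (cdiff_div (fun _ => RtoC (y * y)) (fun z => RtoC (y * y) - Cconj a * z ^ m)%C).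
  - intros E. apply Cminus_eq_0 in E. apply (f_equal Cmod) in E.
    rewrite Cmod_mult, Cmod_conj, Cmod_R, Ha, Rabs_pos_eq in E by nra.
    unfold x in E. rewrite <- (Rabs_pos_eq (Cmod z0)) in E by lra.
    rewrite <- Cmod_R, <- Cmod_pow, <- Cmod_mult, <- Cpow_mult_l in E.
    assert (E1 : Cmod (RtoC (Cmod z0) * z) < r * r).
    { rewrite Cmod_mult, Cmod_R, Rabs_pos_eq by lra.
      apply Rlt_le_trans with (Cmod z0 * (r * r / Cmod z0)); [|right; field; lra].
      apply Rmult_lt_compat_l; [lra|]. eapply Rlt_le_trans; [exact Hz|apply Rmin_r]. }
    apply (Cmod_pow_lt _ _ m Hm) in E1. rewrite Rpow_mult_distr in E1. fold y in E1. lra.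
  - apply cdiff_const.
  - apply cdiff_minus; [apply cdiff_const|].
    apply cdiff_mult; [apply cdiff_const|apply cdiff_pow, cdiff_id]. }
assert (Zm : (0 ^ m)%C = RtoC 0).
{ destruct m as [|m']; [lia|]. simpl. ring. }
assert (b0 : b (RtoC 0) = RtoC 1).
{ unfold b. rewrite Zm. field. intros E. apply (f_equal Re) in E.
  unfold Re, Cminus, Cmult, Cplus, Copp, RtoC in E; simpl in E. nra. }
assert (HF2 : forall z, Cmod z < R2 -> cdiff F z).
{ intros z Hz. apply HF. eapply Rlt_le_trans; [exact Hz|apply Rmin_l]. }
assert (Mb : cmean b r = RtoC (2 * PI)).
{ rewrite (cmean_holo b r R2) by (lra || exact Hb). rewrite b0. ring. }
assert (MF : cmean F r = RtoC 0).
{ rewrite (cmean_holo F r R2) by (lra || exact HF2). rewrite F0. ring. }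
assert (MFb : cmean (fun z => F z * b z)%C r = RtoC 0).
{ rewrite (cmean_holo _ r R2); [rewrite F0; ring|lra|].
  intros z Hz. apply cdiff_mult; auto. }
assert (Cb : forall z, Cmod z = r -> ccont b z) by (intros z Hz; apply cdiff_ccont, Hb; lra).
assert (CF : forall z, Cmod z = r -> ccont F z) by (intros z Hz; apply cdiff_ccont, HF; lra).
assert (Mk : cmean k r = RtoC (2 * PI)).
{ rewrite (cmean_ext k (fun z => Cconj (b z))) by (lra || exact Hkb).
  rewrite cmean_conj by (lra || exact Cb). rewrite Mb. unfold Cconj, RtoC; simpl. f_equal. ring. }
(* By symmetry [F - F z0] vanishes at every zero of [z ^ m - a], so [(F - F z0) * k] extends
   continuously across them. The factor [z ^ m] makes it 0 at the centre, hence its circle mean is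
   0. *)
destruct (quotient_extension (fun z => z ^ m * (F z - F z0))%C (fun z => z ^ m - a)%C R1) as [K [CK EK]].
{ intros z Hz. split.
  - apply cdiff_mult; [apply cdiff_pow, cdiff_id|]. apply cdiff_minus; [now apply HF|apply cdiff_const].
  - apply cdiff_minus; [apply cdiff_pow, cdiff_id|apply cdiff_const]. }
{ intros z Hz E. apply Cminus_eq_0 in E. split.
  - rewrite (Hsym z z0 E). ring.
  - destruct m as [|m']; [lia|]. exists (RtoC (INR (S m')) * z ^ m' + 0)%C. split.
    + rewrite Cplus_0_r. apply Cmult_neq_0.
      * intros E1. apply RtoC_inj in E1. generalize (lt_0_INR (S m') Hm). lra.
      * apply Cpow_nz. intros ->. apply (f_equal Cmod) in E. rewrite Zm, Cmod_0, Ha in E. lra.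
    + apply (cderiv_plus (fun z => z ^ S m')%C (fun _ => (- a)%C)); [apply cderiv_pow|apply cderiv_const]. }
assert (HDne : forall z, Cmod z <> Cmod z0 -> (z ^ m - a)%C <> RtoC 0).
{ intros z Hz E. apply Hz. apply Cminus_eq_0 in E. apply (f_equal Cmod) in E.
  unfold a in E. rewrite !Cmod_pow in E. apply pow_root_inj in E; trivial; apply Cmod_ge_0. }
assert (MK : cmean K r = RtoC 0).
{ rewrite (cmean_center K (Cmod z0) r R1); [|lra|lra|exact CK|].
  - rewrite EK; [|apply HDne; rewrite Cmod_0; lra]. rewrite Zm. unfold Cdiv. ring.
  - intros z Hz Hne. 
    assert (CD : cdiff (fun z => z ^ m - a)%C z).
    { apply cdiff_minus; [apply cdiff_pow, cdiff_id|apply cdiff_const]. }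
    destruct (neq_0_loc (fun z => z ^ m - a)%C z (cdiff_ccont _ _ CD) (HDne z Hne)) as [e [He Hn]].
    apply cdiff_ext_loc with (g := fun z => (z ^ m * (F z - F z0) / (z ^ m - a))%C) (r := e); [exact He| |].
    + intros w Hw. apply EK. now apply Hn.
    + apply (cdiff_div (fun z => z ^ m * (F z - F z0))%C (fun z => z ^ m - a)%C).
      * now apply HDne.
      * apply cdiff_mult; [apply cdiff_pow, cdiff_id|].
        apply cdiff_minus; [apply HF; lra|apply cdiff_const].
      * exact CD. }
assert (CK' : forall z, Cmod z = r -> ccont K z) by (intros z Hz; apply CK; lra).
(* On the circle [K = (F - F z0) * k] and [b] is the conjugate of [k], so the real part of [H] is
   [2 * (B - Re F) * (kap + 1 - Re k)], which is nonnegative since [Cmod k <= kap + 1]. The mean of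
   [H], computed term by term from values at 0, is [2 * PI] times [2 * kap * B + F z0]. *)
set (c := 2 * kap + 2).
set (H z := (((RtoC (c * B) + (- RtoC c) * F z) + (RtoC (- (2 * B)) * k z + K z)) + (F z0 * k z + F z * b z))%C).
assert (C1 : forall (e : C) G, (forall z, Cmod z = r -> ccont G z) -> forall z, Cmod z = r -> ccont (fun z => e * G z)%C z).
{ intros e G HG z Hz. apply ccont_mult; [apply ccont_const|now apply HG]. }
assert (C2 : forall G G' : C -> C, (forall z, Cmod z = r -> ccont G z) -> (forall z, Cmod z = r -> ccont G' z) ->
  forall z, Cmod z = r -> ccont (fun z => G z + G' z)%C z).
{ intros G G' HG HG' z Hz. apply ccont_plus; auto. }
assert (C3 : forall z, Cmod z = r -> ccont (fun z => F z * b z)%C z).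
{ intros z Hz. apply ccont_mult; auto. }
assert (C4 : forall e : C, forall z, Cmod z = r -> ccont (fun _ => e) z).
{ intros e z _. apply ccont_const. }
assert (MH : cmean H r = (RtoC (2 * PI) * (RtoC (2 * kap * B) + F z0))%C).
{ unfold H.
  rewrite (cmean_plus (fun z => ((RtoC (c * B) + (- RtoC c) * F z) + (RtoC (- (2 * B)) * k z + K z))%C)
    (fun z => (F z0 * k z + F z * b z)%C)); [|lra|auto 10|auto 10].
  rewrite (cmean_plus (fun z => (RtoC (c * B) + (- RtoC c) * F z)%C)
    (fun z => (RtoC (- (2 * B)) * k z + K z)%C)); [|lra|auto 10|auto 10].
  rewrite (cmean_plus (fun z => RtoC (c * B)) (fun z => (- RtoC c) * F z)%C); [|lra|auto|auto].
  rewrite (cmean_plus (fun z => (RtoC (- (2 * B)) * k z)%C) K); [|lra|auto|auto].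
  rewrite (cmean_plus (fun z => (F z0 * k z)%C) (fun z => F z * b z)%C); [|lra|auto|auto].
  rewrite !cmean_scal, cmean_const by (lra || auto).
  rewrite MF, Mk, MK, MFb. unfold c.
  rewrite !RtoC_mult, !RtoC_plus, RtoC_opp, !RtoC_mult. ring. }
assert (HR : 0 <= Re (cmean H r)).
{ apply cmean_Re_ge_0; [lra|unfold H; auto 10|].
  intros z Hz. unfold H. rewrite (EK z) by now apply HD.
  replace (z ^ m * (F z - F z0) / (z ^ m - a))%C with ((F z - F z0) * k z)%C
    by (unfold k; field; now apply HD).
  assert (Eb : b z = Cconj (k z)) by (rewrite Hkb, Cconj_conj; trivial).
  rewrite Eb.
  assert (Bk : Re (k z) <= kap + 1).
  { eapply Rle_trans; [apply Rle_abs|]. eapply Rle_trans; [apply re_le_Cmod|].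
    unfold k. rewrite Cmod_div by now apply HD. rewrite Hzm by exact Hz.
    assert (y - x <= Cmod (z ^ m - a)).
    { eapply Rle_trans; [|apply Cmod_sub_ge]. rewrite Hzm, Ha by exact Hz. lra. }
    replace (kap + 1) with (y / (y - x)) by (unfold kap; field; lra).
    apply Rmult_le_compat_l; [lra|]. apply Rinv_le_contravar; lra. }
  specialize (HFB z Hz).
  set (u := F z) in *. set (v := F z0). set (w := k z) in *. clearbody u v w.
  replace (Re _) with ((B - Re u) * (2 * (kap + 1 - Re w))).
  - apply Rmult_le_pos; lra.
  - unfold c. destruct u as [u1 u2], v as [v1 v2], w as [w1 w2].
    unfold Re, Im, Cconj, Cminus, Cmult, Cplus, Copp, RtoC; simpl. ring. }
rewrite MH in HR.
replace (Re _) with (2 * PI * (2 * kap * B + Re (F z0))) in HR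
  by (unfold Re, Cmult, Cplus, RtoC; simpl; ring).
generalize PI_RGT_0; intros HPI.
assert (0 <= 2 * kap * B + Re (F z0)).
{ apply Rmult_le_reg_l with (2 * PI); lra. }
replace (2 * B * (x / (y - x))) with (2 * kap * B) by (unfold kap; ring). lra.
Qed.

(** * Roots of unity and division by finite products *)

Fixpoint cprod (f : nat -> C) (n : nat) : C :=
  match n with O => RtoC 1 | S n => (cprod f n * f n)%C end.

Lemma cdiff_cprod (f : nat -> C -> C) (z : C) (n : nat) :
  (forall k, (k < n)%nat -> cdiff (f k) z) -> cdiff (fun w => cprod (fun k => f k w) n) z.
Proof.
induction n as [|n IH]; intros H; simpl; [apply cdiff_const|].
apply (cdiff_mult (fun w => cprod (fun k => f k w) n)); [apply IH; intros; apply H; lia|apply H; lia].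
Qed.

Lemma cprod_neq_0 (f : nat -> C) (n : nat) :
  (forall k, (k < n)%nat -> f k <> RtoC 0) <-> cprod f n <> RtoC 0.
Proof.
induction n as [|n IH]; simpl.
- split; [intros _|intros; lia]. intros E. apply RtoC_inj in E. lra.
- split.
  + intros H. apply Cmult_neq_0; [apply IH; intros; apply H; lia|apply H; lia].
  + intros H k Hk.
    assert (cprod f n <> RtoC 0) by (intros E; apply H; rewrite E; ring).
    assert (f n <> RtoC 0) by (intros E; apply H; rewrite E; ring).
    destruct (Nat.eq_dec k n) as [->|Hkn]; [assumption|]. apply IH; [assumption|lia].
Qed.

Definition omega (m : nat) : C := cexp (0, 2 * PI / INR m).

Lemma cexp_pow (z : C) (n : nat) : (cexp z ^ n)%C = cexp (RtoC (INR n) * z).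
Proof.
induction n as [|n IH].
- simpl. rewrite Cmult_0_l. symmetry. apply cexp_0.
- rewrite S_INR, RtoC_plus. simpl. rewrite IH, <- cexp_plus. f_equal. ring.
Qed.

Lemma omega_pow (m j : nat) : (omega m ^ j)%C = cexp (0, 2 * PI * INR j / INR m).
Proof.
unfold omega. rewrite cexp_pow. f_equal. unfold Cmult, RtoC; simpl. f_equal; unfold Rdiv; ring.
Qed.

Lemma cexp_2PI_period (t : R) (k : Z) : cexp (0, t + 2 * PI * IZR k) = cexp (0, t).
Proof.
assert (Hn : forall n t, cexp (0, t + 2 * PI * INR n) = cexp (0, t)).
{ intros n s. unfold cexp, Re, Im; simpl.
  replace (s + 2 * PI * INR n) with (s + 2 * INR n * PI) by ring.
  now rewrite cos_period, sin_period. }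
destruct (Z.le_gt_cases 0 k) as [Hk|Hk].
- replace (IZR k) with (INR (Z.to_nat k)); [apply Hn|]. rewrite INR_IZR_INZ, Z2Nat.id by lia. reflexivity.
- rewrite <- (Hn (Z.to_nat (- k)) (t + 2 * PI * IZR k)).
  rewrite INR_IZR_INZ, Z2Nat.id, opp_IZR by lia. do 2 f_equal. ring.
Qed.

Lemma omega_pow_m (m : nat) : (0 < m)%nat -> (omega m ^ m)%C = RtoC 1.
Proof.
intros Hm. rewrite omega_pow. apply lt_0_INR in Hm.
replace (2 * PI * INR m / INR m) with (0 + 2 * PI * IZR 1) by (field; lra).
rewrite cexp_2PI_period. apply cexp_0.
Qed.

Lemma Cmod_omega (m : nat) : Cmod (omega m) = 1.
Proof. unfold omega. rewrite Cmod_cexp. apply exp_0. Qed.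

Lemma cos_eq_1 (x : R) : cos x = 1 -> exists k : Z, x = 2 * PI * IZR k.
Proof.
intros H. destruct (sin_eq_0_0 (x / 2)) as [k Hk].
- replace x with (2 * (x / 2)) in H by field. rewrite cos_2a_sin in H. nra.
- exists k. lra.
Qed.

Lemma cexp_im_eq_1 (t : R) : cexp (0, t) = RtoC 1 -> exists k : Z, t = 2 * PI * IZR k.
Proof.
intros H. apply cos_eq_1. apply (f_equal Re) in H. unfold cexp, Re, Im, RtoC in H; simpl in H.
rewrite exp_0 in H. lra.
Qed.

Lemma polar_cexp (z : C) : exists t, -PI <= t <= PI /\ z = (RtoC (Cmod z) * cexp (0, t))%C.
Proof.
destruct (polar z) as [t [Ht E]]. exists t; split; [exact Ht|]. rewrite E at 1.
unfold cexp, Cmult, RtoC, Re, Im; simpl. rewrite exp_0. f_equal; ring.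
Qed.

Lemma unity_root (m : nat) (u : C) :
  (0 < m)%nat -> (u ^ m)%C = RtoC 1 -> exists j, (j < m)%nat /\ u = (omega m ^ j)%C.
Proof.
intros Hm E. assert (Hm' := lt_0_INR m Hm).
assert (Hu : Cmod u = 1).
{ apply pow_root_inj with m; [exact Hm|apply Cmod_ge_0|lra|].
  rewrite <- Cmod_pow, E, Cmod_1, pow1. reflexivity. }
destruct (polar_cexp u) as [t [Ht Eu]]. rewrite Hu, Cmult_1_l in Eu.
rewrite Eu, cexp_pow in E.
replace (RtoC (INR m) * (0, t))%C with (0, INR m * t) in E
  by (unfold Cmult, RtoC; simpl; f_equal; ring).
apply cexp_im_eq_1 in E. destruct E as [k Hk].
assert (Hmz : (0 < Z.of_nat m)%Z) by lia.
destruct (Z.mod_pos_bound k (Z.of_nat m) Hmz) as [H1 H2].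
exists (Z.to_nat (k mod Z.of_nat m)). split; [lia|].
rewrite Eu, omega_pow, INR_IZR_INZ, Z2Nat.id by exact H1.
replace t with (2 * PI * IZR (k mod Z.of_nat m) / INR m + 2 * PI * IZR (k / Z.of_nat m)).
- now rewrite cexp_2PI_period.
- apply Rmult_eq_reg_l with (INR m); [|lra]. rewrite Hk.
  rewrite (Z.div_mod k (Z.of_nat m)) at 3 by lia. rewrite plus_IZR, mult_IZR, <- INR_IZR_INZ. field. lra.
Qed.

Lemma csum_ext (f g : nat -> C) (n : nat) :
  (forall k, (k < n)%nat -> f k = g k) -> csum f n = csum g n.
Proof.
induction n as [|n IH]; intros H; simpl; [reflexivity|].
rewrite IH by (intros; apply H; lia). now rewrite H by lia.
Qed.

Lemma csum_shift (f : nat -> C) (n : nat) : (csum f n + f n)%C = (f O + csum (fun k => f (S k)) n)%C.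
Proof.
induction n as [|n IH]; simpl; [ring|]. rewrite IH. ring.
Qed.

(** This is [m] times the average over the rotations; the factor is cancelled at the end of
    [log_bound_step]. *)
Definition rot_sum (m : nat) (F : C -> C) (z : C) : C := csum (fun j => F (omega m ^ j * z)%C) m.

Lemma rot_sum_rot (m : nat) (F : C -> C) (z : C) (i : nat) :
  (0 < m)%nat -> rot_sum m F (omega m ^ i * z) = rot_sum m F z.
Proof.
intros Hm. assert (H1 : forall z, rot_sum m F (omega m * z) = rot_sum m F z).
{ intros w. unfold rot_sum.
  rewrite (csum_ext _ (fun j => F (omega m ^ S j * w)%C)) by (intros; f_equal; simpl; ring).
  assert (A := csum_shift (fun j => F (omega m ^ j * w)%C) m).
  cbv beta in A. rewrite omega_pow_m in A by exact Hm. simpl (omega m ^ 0)%C in A.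
  set (X := csum (fun j => F (omega m ^ j * w)%C) m) in *.
  set (Y := csum (fun j => F (omega m ^ S j * w)%C) m) in *.
  replace Y with (F (1 * w)%C + Y - F (1 * w)%C)%C by ring. rewrite <- A. ring. }
induction i as [|i IH]; [simpl; now rewrite Cmult_1_l|].
simpl. rewrite <- Cmult_assoc, H1. exact IH.
Qed.

Lemma rot_sum_sym (m : nat) (F : C -> C) (z w : C) :
  (0 < m)%nat -> (z ^ m)%C = (w ^ m)%C -> rot_sum m F z = rot_sum m F w.
Proof.
intros Hm E. destruct (Ceq_dec w 0) as [->|Hw].
- assert (Hz : z = RtoC 0).
  { apply Cmod_eq_0. apply pow_root_inj with m; [exact Hm|apply Cmod_ge_0|lra|].
    rewrite <- Cmod_pow, E, Cmod_pow, Cmod_0. reflexivity. }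
  now rewrite Hz.
- destruct (unity_root m (z / w) Hm) as [j [_ Hj]].
  { unfold Cdiv. rewrite Cpow_mult_l, Cpow_inv, E by exact Hw. apply Cinv_r. now apply Cpow_nz. }
  replace z with (omega m ^ j * w)%C by (rewrite <- Hj; field; exact Hw).
  now apply rot_sum_rot.
Qed.

(** The value [s a] is the derivative of the power at [a]. It is nonzero for [a <> 0], which makes
    the zeros of each factor of [lam_prod] simple. *)
Lemma pow_minus_factor (m : nat) (a : C) :
  exists s, (forall z, cdiff s z) /\ s a = (RtoC (INR (S m)) * a ^ m)%C /\
    forall z, (z ^ S m - a ^ S m)%C = ((z - a) * s z)%C.
Proof.
induction m as [|m [s [Hs [Ea E]]]].
- exists (fun _ => RtoC 1). split; [intros; apply cdiff_const|]. split; [simpl; ring|intros; simpl; ring].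
- exists (fun z => z * s z + a ^ S m)%C. split; [|split].
  + intros z. apply cdiff_plus; [|apply cdiff_const]. apply cdiff_mult; [apply cdiff_id|apply Hs].
  + rewrite Ea, (S_INR (S m)), RtoC_plus. simpl (a ^ S m)%C. ring.
  + intros z. specialize (E z).
    replace (z ^ S (S m) - a ^ S (S m))%C with (z * (z ^ S m - a ^ S m) + (z - a) * a ^ S m)%C
      by (simpl; ring). rewrite E. ring.
Qed.

Lemma simple_zero_mult (f g : C -> C) (a : C) :
  zero_order_eq f a 1 -> entire g -> g a <> RtoC 0 -> zero_order_eq (fun z => f z * g z)%C a 1.
Proof.
intros [h [Hh [Ha E]]] Hg Hga. exists (fun z => h z * g z)%C. split; [|split].
- apply entire_cdiff. intros z. apply cdiff_mult; now apply entire_cdiff.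
- now apply Cmult_neq_0.
- intros z. rewrite E. ring.
Qed.

Lemma zero_order_eq_ext (f g : C -> C) (a : C) (m : nat) :
  (forall z, f z = g z) -> zero_order_eq g a m -> zero_order_eq f a m.
Proof. intros E [h [Hh [Ha Eh]]]. exists h. repeat split; auto. intros z. now rewrite E. Qed.

Definition lam_prod (m : nat) (lam : nat -> R) (n : nat) (z : C) : C :=
  cprod (fun k => 1 - z ^ m / RtoC (lam k))%C n.

Lemma lam_factor_cdiff (m : nat) (l : R) (z : C) : cdiff (fun z => 1 - z ^ m / RtoC l)%C z.
Proof.
apply cdiff_minus; [apply cdiff_const|]. apply cdiff_mult; [apply cdiff_pow, cdiff_id|apply cdiff_const].
Qed.

Lemma lam_prod_cdiff (m : nat) (lam : nat -> R) (n : nat) (z : C) : cdiff (lam_prod m lam n) z.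
Proof.
apply (cdiff_cprod (fun k z => 1 - z ^ m / RtoC (lam k))%C). intros. apply lam_factor_cdiff.
Qed.

Lemma lam_factor_0 (m : nat) (l : R) (z : C) :
  0 < l -> (1 - z ^ m / RtoC l)%C = RtoC 0 <-> (z ^ m)%C = RtoC l.
Proof.
intros Hl. assert (Hl' : RtoC l <> RtoC 0) by (intros E; apply RtoC_inj in E; lra).
split; intros E.
- apply Cminus_eq_0 in E. replace (z ^ m)%C with (z ^ m / RtoC l * RtoC l)%C by (field; exact Hl').
  rewrite <- E. ring.
- rewrite E. field. exact Hl'.
Qed.

Lemma lam_prod_zero (m : nat) (lam : nat -> R) (n : nat) (a : C) :
  (0 < m)%nat -> (forall k, 0 < lam k) -> (forall j k, lam j = lam k -> j = k) ->
  lam_prod m lam n a = RtoC 0 -> zero_order_eq (lam_prod m lam n) a 1.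
Proof.
intros Hm Hpos Hinj. induction n as [|n IH]; intros E.
- unfold lam_prod in E; simpl in E. apply RtoC_inj in E. lra.
- change (lam_prod m lam n a * (1 - a ^ m / RtoC (lam n)) = RtoC 0)%C in E.
  destruct (Ceq_dec (1 - a ^ m / RtoC (lam n)) 0) as [E0|E0].
  + apply zero_order_eq_ext with (g := fun z => ((1 - z ^ m / RtoC (lam n)) * lam_prod m lam n z)%C).
    { intros z. unfold lam_prod. simpl. ring. }
    apply lam_factor_0 in E0; [|apply Hpos].
    apply simple_zero_mult.
    * destruct m as [|m]; [lia|]. destruct (pow_minus_factor m a) as [s [Hs [Ea Es]]].
      assert (Hl : RtoC (lam n) <> RtoC 0) by (intros E1; apply RtoC_inj in E1; specialize (Hpos n); lra).
      exists (fun z => (- / RtoC (lam n)) * s z)%C. split; [|split].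
      { apply entire_cdiff. intros z. apply cdiff_mult; [apply cdiff_const|apply Hs]. }
      { rewrite Ea. apply Cmult_neq_0.
        - intros E1. apply (f_equal (Cmult (- RtoC (lam n)))) in E1. rewrite Cmult_0_r in E1.
          replace (- RtoC (lam n) * - / RtoC (lam n))%C with (RtoC 1) in E1 by (field; exact Hl).
          apply RtoC_inj in E1. lra.
        - apply Cmult_neq_0.
          + intros E1. apply RtoC_inj in E1. generalize (lt_0_INR (S m) Hm). lra.
          + apply Cpow_nz. intros ->. apply Hl. rewrite <- E0. simpl. ring. }
      { intros z. simpl (_ ^ 1)%C. rewrite Cmult_1_r.
        replace ((z - a) * (- / RtoC (lam n) * s z))%C with (- / RtoC (lam n) * ((z - a) * s z))%C by ring.
        rewrite <- Es, E0. field. exact Hl. }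
    * apply entire_cdiff. intros z. apply lam_prod_cdiff.
    * apply cprod_neq_0. intros k Hk E1. apply lam_factor_0 in E1; [|apply Hpos].
      rewrite E0 in E1. apply RtoC_inj in E1. apply Hinj in E1. lia.
  + apply (simple_zero_mult (lam_prod m lam n) (fun z => 1 - z ^ m / RtoC (lam n))%C).
    * apply IH. destruct (Ceq_dec (lam_prod m lam n a) 0) as [E1|E1]; [exact E1|].
      exact (False_ind _ (Cmult_neq_0 _ _ E1 E0 E)).
    * apply entire_cdiff. intros z. apply lam_factor_cdiff.
    * exact E0.
Qed.

(** Near a common simple zero [a] the two factorizations show that the quotient is [g / T] with
    [T a] nonzero, so its value there has to be [g a / T a], again nonzero. The predicate [P]
    includes [g] and [T], so that the value chosen by [epsilon] comes with functions that witness
    it. *)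
Lemma entire_quotient (f D : C -> C) :
  entire f -> entire D ->
  (forall a, D a = RtoC 0 -> zero_order_eq f a 1 /\ zero_order_eq D a 1) ->
  exists q, entire q /\ (forall z, f z = (D z * q z)%C) /\ (forall a, D a = RtoC 0 -> q a <> RtoC 0).
Proof.
intros Hf HD H0.
set (P a v := exists g T, entire g /\ entire T /\ g a <> RtoC 0 /\ T a <> RtoC 0 /\
  (forall z, f z = ((z - a) * g z)%C) /\ (forall z, D z = ((z - a) * T z)%C) /\ v = (g a / T a)%C).
set (q z := if Ceq_dec (D z) 0 then epsilon (inhabits (RtoC 0)) (P z) else (f z / D z)%C).
assert (Hq : forall z, D z <> RtoC 0 -> q z = (f z / D z)%C).
{ intros z Hz. unfold q. destruct (Ceq_dec (D z) 0); [contradiction|reflexivity]. }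
assert (HP : forall a, D a = RtoC 0 -> P a (q a)).
{ intros a Ha. unfold q. destruct (Ceq_dec (D a) 0); [|contradiction].
  apply epsilon_spec. destruct (H0 a Ha) as [[g [Hg [Ga Eg]]] [T [HT [Ta ET]]]].
  exists (g a / T a)%C, g, T. repeat split; auto.
  - intros z. rewrite Eg. simpl. ring.
  - intros z. rewrite ET. simpl. ring. }
exists q. split; [|split].
- apply entire_cdiff. intros a.
  destruct (Ceq_dec (D a) 0) as [E|E].
  + destruct (HP a E) as [g [T [Hg [HT [Ga [Ta [Eg [ET Ev]]]]]]]].
    assert (CT : cdiff T a) by now apply entire_cdiff.
    destruct (neq_0_loc T a (cdiff_ccont _ _ CT) Ta) as [r [Hr Hn]].
    apply cdiff_ext_loc with (g := fun z => (g z / T z)%C) (r := r); [exact Hr| |].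
    * intros w Hw. destruct (Ceq_dec w a) as [->|Hwa]; [exact Ev|].
      assert (Hw1 : (w - a)%C <> RtoC 0) by (intros E1; now apply Hwa, Cminus_eq_0).
      specialize (Hn w Hw).
      rewrite Hq by (rewrite ET; now apply Cmult_neq_0). rewrite Eg, ET. field. split; assumption.
    * apply cdiff_div; [exact Ta|now apply entire_cdiff|exact CT].
  + assert (CD : cdiff D a) by now apply entire_cdiff.
    destruct (neq_0_loc D a (cdiff_ccont _ _ CD) E) as [r [Hr Hn]].
    apply cdiff_ext_loc with (g := fun z => (f z / D z)%C) (r := r); [exact Hr| |].
    * intros w Hw. apply Hq. now apply Hn.
    * apply cdiff_div; [exact E|now apply entire_cdiff|exact CD].
- intros z. destruct (Ceq_dec (D z) 0) as [E|E].
  + destruct (H0 z E) as [[g [Hg [Ga Eg]]] _]. rewrite E, (Eg z). simpl. ring.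
  + rewrite Hq by exact E. field. exact E.
- intros a Ha. destruct (HP a Ha) as [g [T [Hg [HT [Ga [Ta [Eg [ET ->]]]]]]]].
  unfold Cdiv. apply Cmult_neq_0; [exact Ga|]. 
  intros E. apply (f_equal (Cmult (T a))) in E. rewrite Cinv_r, Cmult_0_r in E by exact Ta.
  apply RtoC_inj in E. lra.
Qed.

(** * Functions with prescribed zeros on the rays *)

Fixpoint rsum (f : nat -> R) (n : nat) : R :=
  match n with O => 0 | S n => rsum f n + f n end.

Lemma Re_csum (f : nat -> C) (n : nat) : Re (csum f n) = rsum (fun k => Re (f k)) n.
Proof. induction n as [|n IH]; [reflexivity|]. simpl. rewrite <- IH. reflexivity. Qed.

Lemma rsum_le (f g : nat -> R) (n : nat) :
  (forall k, (k < n)%nat -> f k <= g k) -> rsum f n <= rsum g n.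
Proof.
induction n as [|n IH]; intros H; simpl; [lra|].
apply Rplus_le_compat; [apply IH; intros; apply H; lia|apply H; lia].
Qed.

Lemma rsum_ext (f g : nat -> R) (n : nat) :
  (forall k, (k < n)%nat -> f k = g k) -> rsum f n = rsum g n.
Proof. intros H. apply Rle_antisym; apply rsum_le; intros; rewrite H; trivial; lra. Qed.

Lemma rsum_const (c : R) (n : nat) : rsum (fun _ => c) n = INR n * c.
Proof. induction n as [|n IH]; [simpl; ring|]. rewrite S_INR. simpl. rewrite IH. ring. Qed.

Lemma rsum_mono (f : nat -> R) (n m : nat) :
  (forall k, 0 <= f k) -> (n <= m)%nat -> rsum f n <= rsum f m.
Proof. intros H. induction 1 as [|m Hm IH]; simpl; [lra|]. specialize (H m). lra. Qed.

Lemma Cmod_cprod_ln (f : nat -> C) (n : nat) :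
  (forall k, (k < n)%nat -> f k <> RtoC 0) ->
  ln (Cmod (cprod f n)) = rsum (fun k => ln (Cmod (f k))) n.
Proof.
induction n as [|n IH]; intros H; simpl; [now rewrite Cmod_1, ln_1|].
rewrite Cmod_mult, ln_mult, IH; trivial.
- intros; apply H; lia.
- apply Cmod_gt_0. apply cprod_neq_0. intros; apply H; lia.
- apply Cmod_gt_0. apply H; lia.
Qed.

(** With [p = 1 / tau] these are the values of [z ^ m] on the set. The index starts at 0 and
    [lamp p 0 = 1], so the first [n] points are those up to [n ^ p]. *)
Definition lamp (p : R) (k : nat) : R := Rpower (INR (S k)) p.

Lemma INR_S_pos (k : nat) : 0 < INR (S k).
Proof. apply lt_0_INR. lia. Qed.

Lemma Rpower_pos (x p : R) : 0 < Rpower x p.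
Proof. apply exp_pos. Qed.

Lemma lamp_pos (p : R) (k : nat) : 0 < lamp p k.
Proof. apply exp_pos. Qed.

Lemma Rpower_lt_l (x y p : R) : 0 < p -> 0 < x < y -> Rpower x p < Rpower y p.
Proof.
intros Hp Hxy. unfold Rpower. apply exp_increasing. apply Rmult_lt_compat_l; [exact Hp|].
now apply ln_increasing.
Qed.

Lemma Rpower_inv_l (x p : R) : 0 < x -> 0 < p -> Rpower (Rpower x p) (/ p) = x.
Proof. intros Hx Hp. rewrite Rpower_mult, Rinv_r by lra. now apply Rpower_1. Qed.

Lemma lamp_lt (p : R) (j k : nat) : 0 < p -> (j < k)%nat -> lamp p j < lamp p k.
Proof.
intros Hp H. apply Rpower_lt_l; [exact Hp|]. split; [apply INR_S_pos|apply lt_INR; lia].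
Qed.

Lemma lamp_inj (p : R) (j k : nat) : 0 < p -> lamp p j = lamp p k -> j = k.
Proof.
intros Hp E. destruct (Nat.lt_trichotomy j k) as [H|[H|H]]; [|exact H|];
apply (lamp_lt p) in H; lra.
Qed.

Lemma lamp_lt_inv (p : R) (j k : nat) : 0 < p -> lamp p j < lamp p k -> (j < k)%nat.
Proof.
intros Hp H. destruct (Nat.lt_trichotomy j k) as [H1|[H1|H1]]; [exact H1| |].
- subst. lra.
- apply (lamp_lt p) in H1; lra.
Qed.

Definition ray_set (m : nat) (p : R) (z : C) : nat :=
  if excluded_middle_informative (exists k, (z ^ m)%C = RtoC (lamp p k)) then 1%nat else 0%nat.

Lemma ray_set_1 (m : nat) (p : R) (z : C) (k : nat) :
  (z ^ m)%C = RtoC (lamp p k) -> ray_set m p z = 1%nat.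
Proof. intros H. unfold ray_set. destruct (excluded_middle_informative _) as [_|N]; [reflexivity|]. elim N; eauto. Qed.

Lemma ray_set_neq_0 (m : nat) (p : R) (z : C) :
  ray_set m p z <> 0%nat <-> exists k, (z ^ m)%C = RtoC (lamp p k).
Proof.
unfold ray_set. destruct (excluded_middle_informative _) as [H|N].
- split; intros; [exact H|discriminate].
- split; [congruence|contradiction].
Qed.

Lemma zeros_ray_set (f : C -> C) (m : nat) (p : R) (z : C) :
  zeros_are f (ray_set m p) ->
  (f z = RtoC 0 <-> exists k, (z ^ m)%C = RtoC (lamp p k)) /\
  (f z = RtoC 0 -> zero_order_eq f z 1).
Proof.
intros H. specialize (H z).
assert (H1 : f z = RtoC 0 -> ray_set m p z <> 0%nat).
{ intros E E1. rewrite E1 in H. destruct H as [g [_ [Hg Eg]]]. apply Hg.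
  rewrite (Eg z) in E. simpl in E. rewrite <- E. ring. }
assert (H2 : (exists k, (z ^ m)%C = RtoC (lamp p k)) -> zero_order_eq f z 1).
{ intros [k Hk]. rewrite (ray_set_1 m p z k Hk) in H. exact H. }
split; [split|].
- intros E. now apply ray_set_neq_0, H1.
- intros Hk. destruct (H2 Hk) as [g [_ [_ Eg]]]. rewrite Eg. simpl. ring.
- intros E. now apply H2, ray_set_neq_0, H1.
Qed.

Lemma Rpower_ge_self (a p : R) : 1 <= a -> 1 <= p -> a <= Rpower a p.
Proof.
intros Ha Hp. rewrite <- (Rpower_1 a) at 1 by lra.
destruct Ha as [Ha| <-]; [apply Rle_Rpower; lra|]. unfold Rpower. rewrite ln_1, !Rmult_0_r. lra.
Qed.

(** The circle separates the first [n] values of [lamp] from the others. On it the factor with index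
    [j] has modulus at least [((n + 1/2) / (j + 1)) ^ p - 1], which is at least [1 / (2 n + 1)] as
    [j + 1 <= n] and [p >= 1]. Crude as it is, the bound costs only [n * ln (2 n + 1)] in the
    logarithm. *)
Lemma lam_prod_circle_ge (m : nat) (p : R) (n : nat) (z : C) :
  1 <= p -> Cmod z ^ m = Rpower (INR n + / 2) p ->
  (/ (2 * INR n + 1)) ^ n <= Cmod (lam_prod m (lamp p) n z).
Proof.
intros Hp Hz.
assert (Hn : 0 <= INR n) by apply pos_INR.
set (c := / (2 * INR n + 1)). assert (Hc : 0 < c) by (apply Rinv_0_lt_compat; lra).
assert (G : forall j, (j <= n)%nat -> c ^ j <= Cmod (lam_prod m (lamp p) j z)).
{ induction j as [|j IH]; intros Hj.
  - unfold lam_prod; simpl. rewrite Cmod_1. lra.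
  - unfold lam_prod in *. simpl. rewrite Cmod_mult, (Rmult_comm c).
    apply Rmult_le_compat; [apply pow_le; lra|lra|apply IH; lia|].
    assert (Hl := lamp_pos p j).
    assert (Hjn : 1 + INR j <= INR n) by (rewrite Rplus_comm, <- S_INR; apply le_INR; lia).
    rewrite Cmod_sub_sym. eapply Rle_trans; [|apply Cmod_sub_ge].
    rewrite Cmod_1, Cmod_div by (intros E; apply RtoC_inj in E; lra).
    rewrite Cmod_pow, Hz, Cmod_R, Rabs_pos_eq by lra.
    assert (Hj0 := pos_INR j).
    set (a := (INR n + / 2) / INR (S j)).
    assert (Ha : 1 + c <= a).
    { unfold a. rewrite S_INR. apply Rmult_le_reg_r with (INR j + 1); [lra|].
      unfold Rdiv. rewrite Rmult_assoc, Rinv_l, Rmult_1_r by lra.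
      assert (c * (INR j + 1) <= / 2).
      { apply Rle_trans with (c * (INR n + / 2)); [apply Rmult_le_compat_l; lra|].
        right. unfold c. field. lra. } lra. }
    replace (Rpower (INR n + / 2) p / lamp p j) with (Rpower a p).
    + assert (A := Rpower_ge_self a p). lra.
    + unfold a, lamp. apply Rmult_eq_reg_r with (Rpower (INR (S j)) p).
      * rewrite Rpower_mult_distr by (try apply Rdiv_lt_0_compat; try apply INR_S_pos; lra).
        unfold Rdiv. rewrite (Rmult_assoc (INR n + / 2)), Rinv_l by (generalize (INR_S_pos j); lra).
        rewrite Rmult_1_r. field. generalize (Rpower_pos (INR (S j)) p); lra.
      * generalize (Rpower_pos (INR (S j)) p); lra. }
apply G. lia.
Qed.

(** Here [p = 1 / tau = m / rho], so [1 < p] is the inequality [rho < m]. It lets [r ^ m], which is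
    [u ^ p], outgrow the bound of order [n ln n] for the logarithm of the quotient. *)
Lemma growth_absorbed (c p : R) :
  1 < p -> exists u0, 1 <= u0 /\ forall u, u0 <= u -> c * (1 + u + u * ln u) <= Rpower u p.
Proof.
intros Hp. set (e := p - 1). assert (He : 0 < e) by (unfold e; lra).
(* With [l = ln u] the claim follows from [3 * |c| * l <= exp (e * l)]. Since [exp (e * l)] is at
   least [(e * l) ^ 2 / 4], it suffices that [12 * |c| <= e * e * l]. *)
set (l0 := Rmax 1 (12 * Rabs c / (e * e))).
exists (exp l0). assert (Hl0 : 1 <= l0) by apply Rmax_l.
assert (H1 : 1 <= exp l0) by (rewrite <- exp_0; apply exp_le; lra).
split; [exact H1|]. intros u Hu.
set (l := ln u). assert (Hu0 : 0 < u) by lra.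
assert (Hl : l0 <= l).
{ unfold l. rewrite <- (ln_exp l0). destruct Hu as [Hu|Hu]; [left; apply ln_increasing; [apply exp_pos|exact Hu]|rewrite Hu; lra]. }
assert (Hc : 12 * Rabs c <= e * e * l).
{ assert (H : 12 * Rabs c / (e * e) <= l0) by apply Rmax_r.
  apply Rle_trans with (e * e * (12 * Rabs c / (e * e))); [right; field; lra|].
  apply Rmult_le_compat_l; nra. }
assert (Eu : Rpower u p = u * exp (e * l)).
{ unfold Rpower. replace (p * ln u) with (ln u + e * l) by (unfold e, l; ring).
  rewrite exp_plus, exp_ln by exact Hu0. reflexivity. }
assert (He2 : e * l * (e * l) <= 4 * exp (e * l)).
{ replace (exp (e * l)) with (exp (e * l / 2) * exp (e * l / 2)) by (rewrite <- exp_plus; f_equal; field).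
  assert (A : 1 + e * l / 2 <= exp (e * l / 2)) by apply exp_ineq1_le.
  assert (0 <= e * l) by (apply Rmult_le_pos; lra). nra. }
rewrite Eu. fold l.
apply Rle_trans with (u * (3 * Rabs c * l)).
- pose proof (Rle_abs c). pose proof (Rabs_pos c).
  apply Rle_trans with (Rabs c * (1 + u + u * l)); [apply Rmult_le_compat_r; nra|].
  assert (1 + u + u * l <= u * (3 * l)) by nra. nra.
- apply Rmult_le_compat_l; [lra|]. nra.
Qed.

(** At such points every factor [1 - z ^ m / lamp p k] is the positive number [1 + x / lamp p k],
    the largest modulus possible for the given [Cmod z]. *)
Lemma neg_root (m : nat) (x : R) :
  (0 < m)%nat -> 0 < x -> exists z, Cmod z = Rpower x (/ INR m) /\ (z ^ m)%C = RtoC (- x).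
Proof.
intros Hm Hx. assert (Hm' := lt_0_INR m Hm).
exists (cexp (ln x / INR m, PI / INR m)). split.
- rewrite Cmod_cexp. unfold Re; simpl. unfold Rpower. f_equal. unfold Rdiv. ring.
- rewrite cexp_pow. replace (RtoC (INR m) * ((ln x / INR m)%R, (PI / INR m)%R))%C with ((ln x, PI) : C).
  + unfold cexp, Re, Im, RtoC; simpl. rewrite exp_ln, cos_PI, sin_PI by exact Hx. f_equal; ring.
  + unfold Cmult, RtoC; simpl. f_equal; field; lra.
Qed.

Lemma Rpower_root_pow (x : R) (m : nat) : (0 < m)%nat -> 0 < x -> Rpower x (/ INR m) ^ m = x.
Proof.
intros Hm Hx. assert (Hm' := lt_0_INR m Hm).
rewrite <- Rpower_pow by apply Rpower_pos. rewrite Rpower_mult, Rinv_l by lra. now apply Rpower_1.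
Qed.

Lemma lam_prod_rot (m : nat) (lam : nat -> R) (n : nat) (z w : C) :
  (z ^ m)%C = (w ^ m)%C -> lam_prod m lam n z = lam_prod m lam n w.
Proof. intros E. unfold lam_prod. now rewrite E. Qed.

Lemma omega_mult_pow (m j : nat) (z : C) : (0 < m)%nat -> ((omega m ^ j * z) ^ m)%C = (z ^ m)%C.
Proof.
intros Hm. rewrite Cpow_mult_l, <- Cpow_mult_r, Nat.mul_comm, Cpow_mult_r, omega_pow_m, Cpow_1_l by exact Hm.
ring.
Qed.

Lemma Cmod_omega_mult (m j : nat) (z : C) : Cmod (omega m ^ j * z) = Cmod z.
Proof. rewrite Cmod_mult, Cmod_pow, Cmod_omega, pow1. ring. Qed.

Lemma zero_free_quotient (m : nat) (p : R) (f : C -> C) (n : nat) :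
  (0 < m)%nat -> 1 < p -> entire f -> zeros_are f (ray_set m p) ->
  exists q, entire q /\ (forall z, f z = (lam_prod m (lamp p) n z * q z)%C) /\
    forall z, Cmod z ^ m < lamp p n -> q z <> RtoC 0.
Proof.
intros Hm Hp Hf Hz.
assert (Hlam : forall a, lam_prod m (lamp p) n a = RtoC 0 -> exists k, (a ^ m)%C = RtoC (lamp p k)).
{ intros a Ha. apply NNPP. intros N. revert Ha. apply cprod_neq_0. intros k Hk E.
  apply lam_factor_0 in E; [|apply lamp_pos]. apply N. now exists k. }
destruct (entire_quotient f (lam_prod m (lamp p) n)) as [q [Hq [Eq Hq0]]].
- exact Hf.
- apply entire_cdiff. intros z. apply lam_prod_cdiff.
- intros a Ha. split.
  + apply (zeros_ray_set f m p a Hz). apply (zeros_ray_set f m p a Hz). now apply Hlam.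
  + apply lam_prod_zero; [exact Hm|apply lamp_pos|intros j k; apply lamp_inj; lra|exact Ha].
- exists q. split; [exact Hq|split; [exact Eq|]]. intros z Hzn E.
  destruct (Ceq_dec (lam_prod m (lamp p) n z) 0) as [E1|E1]; [now apply (Hq0 z E1)|].
  assert (Ef : f z = RtoC 0) by (rewrite Eq, E; ring).
  apply (proj1 (zeros_ray_set f m p z Hz)) in Ef. destruct Ef as [k Hk].
  assert (k < n)%nat.
  { apply lamp_lt_inv with p; [lra|]. rewrite <- Cmod_pow, Hk, Cmod_R, Rabs_pos_eq in Hzn; [exact Hzn|].
    left; apply lamp_pos. }
  apply (proj2 (cprod_neq_0 _ n) E1 k); [assumption|]. apply lam_factor_0; [apply lamp_pos|exact Hk].
Qed.

Lemma zeros_ray_set_0 (m : nat) (p : R) (f : C -> C) :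
  (0 < m)%nat -> zeros_are f (ray_set m p) -> f (RtoC 0) <> RtoC 0.
Proof.
intros Hm Hz E. apply (proj1 (zeros_ray_set f m p (RtoC 0) Hz)) in E. destruct E as [k Hk].
destruct m as [|m']; [lia|]. simpl in Hk. rewrite Cmult_0_l in Hk. apply RtoC_inj in Hk.
generalize (lamp_pos p k). lra.
Qed.

(** This is [symmetric_harnack] for the rotation sum of a logarithm of [q = f / D]. On the circle
    [ln |q|] is bounded above by the growth of [f] and by [lam_prod_circle_ge]. At [z0] with
    [z0 ^ m = - x] the growth of [f] gives the upper bound [ln K + A * Rpower x (/ p) - ln |D z0|],
    and Harnack's lower bound cannot exceed it. In this lemma and the next, [A] stands for a type
    bound of [f], not for the integral. *)
Lemma log_bound_step (m : nat) (p : R) (f : C -> C) (K A : R) (n : nat) (x : R) :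
  (0 < m)%nat -> 1 < p -> entire f -> zeros_are f (ray_set m p) ->
  0 < K -> 0 <= A ->
  (forall z, z <> RtoC 0 -> Cmod (f z) <= K * exp (A * Rpower (Cmod z ^ m) (/ p))) ->
  0 < x < Rpower (INR n + / 2) p ->
  rsum (fun k => ln (1 + x / lamp p k)) n <= ln K + A * Rpower x (/ p) - ln (Cmod (f (RtoC 0)))
    + 2 * (Rabs (ln K) + Rabs (ln (Cmod (f (RtoC 0)))) + A * (INR n + / 2) + INR n * ln (2 * INR n + 1))
      * (x / (Rpower (INR n + / 2) p - x)).
Proof.
intros Hm Hp Hf Hz HK HA Hg Hx. destruct (zero_free_quotient m p f n Hm Hp Hf Hz) as [q [Hq [Eq Hq0]]].
set (T := Rpower (INR n + / 2) p) in *. set (D := lam_prod m (lamp p) n) in *.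
assert (Hn := pos_INR n). assert (Hm' := lt_0_INR m Hm).
assert (HT : 0 < T) by apply Rpower_pos.
(* The gap between [T] and the next value of [lamp] leaves an annulus beyond the circle of radius
   [r] without zeros of [q]; both [log_on_disc] and [symmetric_harnack] ask for such room. *)
assert (HTn : T < lamp p n).
{ apply Rpower_lt_l; [lra|]. rewrite S_INR. lra. }
set (r := Rpower T (/ INR m)). set (R1 := Rpower (lamp p n) (/ INR m)).
assert (Hr0 : 0 < r) by apply Rpower_pos.
assert (HrR : r < R1).
{ apply Rpower_lt_l; [now apply Rinv_0_lt_compat|lra]. }
assert (Erm : r ^ m = T) by now apply Rpower_root_pow.
assert (ERm : R1 ^ m = lamp p n) by (apply Rpower_root_pow; [exact Hm|apply lamp_pos]).
set (r2 := (r + R1) / 2).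
assert (D0 : D (RtoC 0) = RtoC 1).
{ unfold D, lam_prod. assert (E0 : (RtoC 0 ^ m)%C = RtoC 0) by (destruct m; [lia|simpl; ring]).
  rewrite E0. clear. induction n as [|n IH]; [reflexivity|]. simpl. rewrite IH. unfold Cdiv. ring. }
assert (Q0 : q (RtoC 0) = f (RtoC 0)) by (rewrite Eq, D0; ring).
assert (F0 := zeros_ray_set_0 m p f Hm Hz).
destruct (log_on_disc q R1 r2) as [L [HL [L0 HLr]]]; [unfold r2; lra| |].
{ intros z Hz1. split; [now apply entire_cdiff|]. apply Hq0. rewrite <- ERm, <- Cmod_pow.
  now apply Cmod_pow_lt. }
set (l0 := ln (Cmod (f (RtoC 0)))) in *. rewrite Q0 in HLr. fold l0 in HLr.
(* The absolute values keep [B1] nonnegative, as [symmetric_harnack] demands of its bound. *)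
set (B1 := Rabs (ln K) + Rabs l0 + A * (INR n + / 2) + INR n * ln (2 * INR n + 1)).
assert (HlnN : 0 <= ln (2 * INR n + 1)).
{ rewrite <- ln_1. destruct Hn as [Hn| <-]; [left; apply ln_increasing; lra|]. rewrite Rmult_0_r, Rplus_0_l. lra. }
assert (HB1 : 0 <= B1).
{ unfold B1. pose proof (Rabs_pos (ln K)). pose proof (Rabs_pos l0).
  assert (0 <= A * (INR n + / 2)) by (apply Rmult_le_pos; lra).
  assert (0 <= INR n * ln (2 * INR n + 1)) by (apply Rmult_le_pos; lra). lra. }
assert (Hlnf : forall z, z <> RtoC 0 -> f z <> RtoC 0 ->
  ln (Cmod (f z)) <= ln K + A * Rpower (Cmod z ^ m) (/ p)).
{ intros z Hz1 Hz2. specialize (Hg z Hz1). apply Cmod_gt_0 in Hz2.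
  rewrite <- (ln_exp (A * Rpower (Cmod z ^ m) (/ p))), <- ln_mult by (assumption || apply exp_pos).
  destruct Hg as [Hg1|Hg1]; [left; now apply ln_increasing|rewrite Hg1; lra]. }
destruct (neg_root m x Hm (proj1 Hx)) as [z0 [Mz0 Ez0]].
assert (Mz0m : Cmod z0 ^ m = x) by (rewrite Mz0; apply Rpower_root_pow; [exact Hm|lra]).
assert (Hz0r : 0 < Cmod z0 < r).
{ rewrite Mz0. split; [apply Rpower_pos|]. apply Rpower_lt_l; [now apply Rinv_0_lt_compat|lra]. }
assert (HH := symmetric_harnack (rot_sum m L) m z0 r r2 (INR m * B1) Hm Hz0r).
assert (HRe : forall z, Cmod z < r2 ->
  Re (rot_sum m L z) = rsum (fun j => ln (Cmod (q (omega m ^ j * z)%C))) m - INR m * l0).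
{ intros z Hz1. unfold rot_sum. rewrite Re_csum.
  rewrite (rsum_ext _ (fun j => ln (Cmod (q (omega m ^ j * z)%C)) + (- l0))).
  - assert (E : forall (g : nat -> R) c k, rsum (fun j => g j + c) k = rsum g k + INR k * c).
    { intros g c k. induction k as [|k IH]; [simpl; ring|]. rewrite S_INR. simpl. rewrite IH. ring. }
    rewrite E. ring.
  - intros j Hj. rewrite HLr; [ring|]. now rewrite Cmod_omega_mult. }
assert (HH' : - (2 * (INR m * B1) * (Cmod z0 ^ m / (r ^ m - Cmod z0 ^ m))) <= Re (rot_sum m L z0)).
{ apply HH.
  - unfold r2; lra.
  - apply Rmult_le_pos; lra.
  - intros z Hz1. apply (cdiff_csum (fun j z => L (omega m ^ j * z)%C)). intros j Hj.
    apply (cdiff_comp L (fun z => (omega m ^ j * z)%C)).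
    + apply HL. now rewrite Cmod_omega_mult.
    + apply cdiff_mult; [apply cdiff_const|apply cdiff_id].
  - intros z w. now apply rot_sum_sym.
  - unfold rot_sum. apply csum_0. intros k _. now rewrite Cmult_0_r.
  - intros z Hzr. rewrite HRe by (unfold r2; lra).
    assert (Hj : forall j, (j < m)%nat -> ln (Cmod (q (omega m ^ j * z)%C)) <= B1 + l0).
    { intros j _. set (w := (omega m ^ j * z)%C).
      assert (Hw : Cmod w = r) by (unfold w; now rewrite Cmod_omega_mult).
      assert (HD := lam_prod_circle_ge m p n w ltac:(lra)). fold D T in HD.
      rewrite Hw in HD. specialize (HD Erm).
      assert (Hc : 0 < (/ (2 * INR n + 1)) ^ n) by (apply pow_lt, Rinv_0_lt_compat; lra).
      assert (HDw : D w <> RtoC 0) by (apply Cmod_gt_0; lra).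
      assert (Hqw : q w <> RtoC 0).
      { apply Hq0. rewrite Hw, Erm. exact HTn. }
      assert (Hfw : f w <> RtoC 0) by (rewrite Eq; now apply Cmult_neq_0).
      assert (Hw0 : w <> RtoC 0) by (apply Cmod_gt_0; lra).
      assert (E1 := Hlnf w Hw0 Hfw). rewrite Hw, Erm in E1.
      unfold T in E1. rewrite Rpower_inv_l in E1 by lra.
      rewrite Eq, Cmod_mult, ln_mult in E1 by (now apply Cmod_gt_0).
      assert (E2 : - (INR n * ln (2 * INR n + 1)) <= ln (Cmod (D w))).
      { replace (- (INR n * ln (2 * INR n + 1))) with (ln ((/ (2 * INR n + 1)) ^ n)).
        - destruct HD as [HD|HD]; [left; now apply ln_increasing|rewrite HD; lra].
        - rewrite ln_pow by (apply Rinv_0_lt_compat; lra). rewrite ln_Rinv by lra. ring. }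
      unfold B1. pose proof (Rle_abs (ln K)). pose proof (Rle_abs (- l0)). rewrite Rabs_Ropp in *. lra. }
    assert (E := rsum_le _ (fun _ => B1 + l0) m Hj). rewrite rsum_const in E. lra. }
rewrite Erm, Mz0m in HH'. rewrite HRe in HH' by (unfold r2; lra).
assert (HDz : forall j, D (omega m ^ j * z0)%C = D z0).
{ intros j. apply lam_prod_rot. now apply omega_mult_pow. }
assert (HDk : forall k, (1 - z0 ^ m / RtoC (lamp p k))%C = RtoC (1 + x / lamp p k)).
{ intros k. assert (Hl := lamp_pos p k). rewrite Ez0, RtoC_plus, RtoC_div, RtoC_opp by lra.
  field. intros E; apply RtoC_inj in E; lra. }
assert (Hpos : forall k, 0 < 1 + x / lamp p k).
{ intros k. assert (0 < x / lamp p k) by (apply Rdiv_lt_0_compat; [lra|apply lamp_pos]). lra. }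
assert (HDn : D z0 <> RtoC 0).
{ apply cprod_neq_0. intros k _. rewrite HDk. intros E. apply RtoC_inj in E. specialize (Hpos k). lra. }
assert (HDl : ln (Cmod (D z0)) = rsum (fun k => ln (1 + x / lamp p k)) n).
{ unfold D, lam_prod. rewrite Cmod_cprod_ln.
  - apply rsum_ext. intros k _. rewrite HDk, Cmod_R, Rabs_pos_eq; [reflexivity|]. left; apply Hpos.
  - intros k _. rewrite HDk. intros E. apply RtoC_inj in E. specialize (Hpos k). lra. }
rewrite <- HDl.
assert (Hj : forall j, (j < m)%nat ->
  ln (Cmod (q (omega m ^ j * z0)%C)) <= ln K + A * Rpower x (/ p) - ln (Cmod (D z0))).
{ intros j _. set (w := (omega m ^ j * z0)%C).
  assert (Hw : Cmod w = Cmod z0) by (unfold w; now rewrite Cmod_omega_mult).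
  assert (Hw0 : w <> RtoC 0) by (apply Cmod_gt_0; lra).
  assert (Hqw : q w <> RtoC 0).
  { apply Hq0. rewrite Hw, Mz0m. lra. }
  assert (HDw : D w = D z0) by apply HDz.
  assert (Hfw : f w <> RtoC 0) by (rewrite Eq; fold D; rewrite HDw; now apply Cmult_neq_0).
  assert (E1 := Hlnf w Hw0 Hfw). rewrite Hw, Mz0m in E1.
  rewrite Eq, Cmod_mult in E1. fold D in E1. rewrite HDw, ln_mult in E1 by (now apply Cmod_gt_0). lra. }
assert (E := rsum_le _ (fun _ => ln K + A * Rpower x (/ p) - ln (Cmod (D z0))) m Hj).
rewrite rsum_const in E.
set (kap := x / (T - x)) in *. fold B1.
assert (HF : INR m * ln (Cmod (D z0)) <= INR m * (ln K + A * Rpower x (/ p) - l0 + 2 * B1 * kap)).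
{ lra. }
apply Rmult_le_reg_l in HF; lra.
Qed.

(** Let [n] tend to infinity in [log_bound_step] with [x] fixed: the last term there is of order
    [n ln n / n ^ p] and disappears. Passing from [N] to [n] only enlarges the sum, because its
    terms are positive. *)
Lemma log_lower_bound (m : nat) (p : R) (f : C -> C) (K A : R) (N : nat) (x : R) :
  (0 < m)%nat -> 1 < p -> entire f -> zeros_are f (ray_set m p) ->
  0 < K -> 0 <= A ->
  (forall z, z <> RtoC 0 -> Cmod (f z) <= K * exp (A * Rpower (Cmod z ^ m) (/ p))) ->
  0 < x ->
  rsum (fun k => ln (1 + x / lamp p k)) N <= ln K + A * Rpower x (/ p) - ln (Cmod (f (RtoC 0))).
Proof.
intros Hm Hp Hf Hz HK HA Hg Hx. set (l0 := ln (Cmod (f (RtoC 0)))).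
apply Rnot_lt_le. intros Hlt.
set (eps := rsum (fun k => ln (1 + x / lamp p k)) N - (ln K + A * Rpower x (/ p) - l0)).
assert (Heps : 0 < eps) by (unfold eps; lra). 
set (a := Rabs (ln K) + Rabs l0). assert (Ha : 0 <= a) by (unfold a; pose proof (Rabs_pos (ln K)); pose proof (Rabs_pos l0); lra).
set (b := a + A + 2).
(* The bracket [W] in [log_bound_step] will be at most [b * V]. This [c] ensures
   [Rpower u p - x >= 4 * b * x / eps * V], so the error term is at most [eps / 2]. *)
set (c := x + 4 * b * x / eps).
destruct (growth_absorbed c p Hp) as [u0 [Hu0 Hu]].
destruct (nfloor_ex u0) as [n0 Hn0]; [lra|].
set (n := (N + S n0)%nat).
assert (Hn : INR N + INR n0 + 1 = INR n) by (unfold n; rewrite plus_INR, S_INR; ring).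
assert (HN := pos_INR N).
set (u := INR n + / 2). specialize (Hu u ltac:(unfold u; lra)).
assert (Hul : 0 <= ln u).
{ rewrite <- ln_1. left. apply ln_increasing; unfold u; lra. }
assert (Hu1 : 1 <= u) by (unfold u; lra).
set (V := 1 + u + u * ln u) in *. assert (HV : 1 <= V) by (unfold V; nra).
assert (Hb : 0 < b) by (unfold b; lra).
assert (Hbx : 0 < 4 * b * x / eps) by (apply Rdiv_lt_0_compat; [nra|lra]).
assert (HT : x + 4 * b * x / eps * V <= Rpower u p).
{ unfold c in Hu. set (d := 4 * b * x / eps) in *.
  replace ((x + d) * V) with (x * V + d * V) in Hu by ring. assert (x * 1 <= x * V) by (apply Rmult_le_compat_l; lra). lra. }
assert (HxT : x < Rpower u p).
{ assert (0 < 4 * b * x / eps * V) by (apply Rmult_lt_0_compat; lra). lra. }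
assert (E := log_bound_step m p f K A n x Hm Hp Hf Hz HK HA Hg (conj Hx HxT)). fold l0 a u in E.
assert (HmonoS : rsum (fun k => ln (1 + x / lamp p k)) N <= rsum (fun k => ln (1 + x / lamp p k)) n).
{ apply rsum_mono; [|unfold n; lia]. intros k. rewrite <- ln_1. left. apply ln_increasing; [lra|].
  assert (0 < x / lamp p k) by (apply Rdiv_lt_0_compat; [lra|apply lamp_pos]). lra. }
set (W := a + A * u + INR n * ln (2 * INR n + 1)) in *.
assert (Hln2 : ln (2 * INR n + 1) <= 1 + ln u).
{ replace (2 * INR n + 1) with (2 * u) by (unfold u; field). rewrite ln_mult by lra.
  generalize ln_lt_2. intros. assert (ln 2 <= 1); [|lra].
  rewrite <- (ln_exp 1). left. apply ln_increasing; [lra|]. generalize (exp_ineq1 1). lra. }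
assert (HW : W <= b * V).
{ unfold W, V, b.
  assert (INR n * ln (2 * INR n + 1) <= u * (1 + ln u)).
  { apply Rle_trans with (INR n * (1 + ln u)); [apply Rmult_le_compat_l; [apply pos_INR|exact Hln2]|].
    apply Rmult_le_compat_r; [lra|unfold u; lra]. }
  fold V. assert (0 <= u * ln u) by (apply Rmult_le_pos; lra).
  assert (a * 1 <= a * V) by (apply Rmult_le_compat_l; lra).
  assert (A * u <= A * V) by (apply Rmult_le_compat_l; unfold V; lra).
  assert (u * (1 + ln u) <= V) by (unfold V; lra).
  replace ((a + A + 2) * V) with (a * V + A * V + 2 * V) by ring. lra. }
assert (HW0 : 2 * W * (x / (Rpower u p - x)) <= eps / 2).
{ assert (HTx : 4 * b * x / eps * V <= Rpower u p - x) by lra.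
  assert (Hpos : 0 < Rpower u p - x) by lra.
  apply Rmult_le_reg_r with (Rpower u p - x); [exact Hpos|].
  replace (2 * W * (x / (Rpower u p - x)) * (Rpower u p - x)) with (2 * W * x) by (field; lra).
  apply Rle_trans with (eps / 2 * (4 * b * x / eps * V)); [|apply Rmult_le_compat_l; lra].
  replace (eps / 2 * (4 * b * x / eps * V)) with (2 * (b * V) * x) by (field; lra).
  apply Rmult_le_compat_r; lra. }
unfold eps in *. lra.
Qed.

(** * The integral A and rotation of the contour *)

Definition Afun (tau s : R) : R := exp (tau * s) / (1 + exp s).
Definition Aint (tau a b : R) : R := RInt (Afun tau) a b.

Lemma ex_derive_continuous_R (f : R -> R) (x : R) : ex_derive f x -> continuous f x.
Proof. apply (ex_derive_continuous (K := R_AbsRing) (V := R_NormedModule)). Qed.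

Lemma ex_RInt_derivable (f : R -> R) (a b : R) : (forall x, ex_derive f x) -> ex_RInt f a b.
Proof.
intros H. apply (ex_RInt_continuous (V := R_CompleteNormedModule)). intros z _.
now apply ex_derive_continuous_R.
Qed.

Lemma Afun_derivable (tau s : R) : ex_derive (Afun tau) s.
Proof. unfold Afun. auto_derive. generalize (exp_pos s). lra. Qed.

Lemma Afun_ex_RInt (tau a b : R) : ex_RInt (Afun tau) a b.
Proof. apply ex_RInt_derivable. apply Afun_derivable. Qed.

Lemma Afun_pos (tau s : R) : 0 < Afun tau s.
Proof. apply Rdiv_lt_0_compat; [apply exp_pos|generalize (exp_pos s); lra]. Qed.

Lemma RInt_exp (c a b : R) : c <> 0 -> RInt (fun s => exp (c * s)) a b = (exp (c * b) - exp (c * a)) / c.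
Proof.
intros Hc. apply is_RInt_unique.
replace ((exp (c * b) - exp (c * a)) / c) with (minus (exp (c * b) / c) (exp (c * a) / c))
  by (unfold minus, plus, opp; simpl; field; exact Hc).
apply (is_RInt_derive (V := R_CompleteNormedModule) (fun s => exp (c * s) / c)).
- intros x _. auto_derive; [trivial|field; exact Hc].
- intros x _. apply ex_derive_continuous_R. auto_derive. trivial.
Qed.

Lemma Aint_le (tau a b a' b' : R) : a' <= a -> a <= b -> b <= b' -> Aint tau a b <= Aint tau a' b'.
Proof.
intros H1 H2 H3. unfold Aint.
rewrite <- (RInt_Chasles (V := R_CompleteNormedModule) (Afun tau) a' a b') by apply Afun_ex_RInt.
rewrite <- (RInt_Chasles (V := R_CompleteNormedModule) (Afun tau) a b b') by apply Afun_ex_RInt.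
unfold plus; simpl.
assert (0 <= RInt (Afun tau) a' a).
{ apply RInt_ge_0; [lra|apply Afun_ex_RInt|intros; left; apply Afun_pos]. }
assert (0 <= RInt (Afun tau) b b').
{ apply RInt_ge_0; [lra|apply Afun_ex_RInt|intros; left; apply Afun_pos]. }
lra.
Qed.

(** The integrand is below [exp (tau * s)] on the negative half-line and below [exp ((tau - 1) * s)]
    on the positive one. *)
Lemma Aint_bounded (tau a b : R) :
  0 < tau < 1 -> a <= 0 <= b -> Aint tau a b <= / tau + / (1 - tau).
Proof.
intros Ht Hab. unfold Aint.
rewrite <- (RInt_Chasles (V := R_CompleteNormedModule) (Afun tau) a 0 b) by apply Afun_ex_RInt.
unfold plus; simpl. apply Rplus_le_compat.
- apply Rle_trans with (RInt (fun s => exp (tau * s)) a 0).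
  + apply RInt_le; [lra|apply Afun_ex_RInt|apply ex_RInt_derivable; intros; auto_derive; trivial|].
    intros s _. unfold Afun. generalize (exp_pos (tau * s)) (exp_pos s). intros.
    apply Rmult_le_reg_r with (1 + exp s); [lra|]. unfold Rdiv. rewrite Rmult_assoc, Rinv_l; nra.
  + rewrite RInt_exp by lra. rewrite Rmult_0_r, exp_0. generalize (exp_pos (tau * a)). intros.
    unfold Rdiv. rewrite <- (Rmult_1_l (/ tau)) at 2. apply Rmult_le_compat_r; [|lra].
    left. apply Rinv_0_lt_compat. lra.
- apply Rle_trans with (RInt (fun s => exp ((tau - 1) * s)) 0 b).
  + apply RInt_le; [lra|apply Afun_ex_RInt|apply ex_RInt_derivable; intros; auto_derive; trivial|].
    intros s _. unfold Afun. generalize (exp_pos (tau * s)) (exp_pos s). intros.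
    apply Rmult_le_reg_r with (1 + exp s); [lra|]. unfold Rdiv. rewrite Rmult_assoc, Rinv_l by lra.
    replace (tau * s) with ((tau - 1) * s + s) by ring. rewrite exp_plus.
    generalize (exp_pos ((tau - 1) * s)). nra.
  + rewrite RInt_exp by lra. rewrite Rmult_0_r, exp_0. generalize (exp_pos ((tau - 1) * b)). intros.
    replace ((exp ((tau - 1) * b) - 1) / (tau - 1)) with ((1 - exp ((tau - 1) * b)) * / (1 - tau)) by (field; lra).
    rewrite <- (Rmult_1_l (/ (1 - tau))) at 2. apply Rmult_le_compat_r; [|lra].
    left. apply Rinv_0_lt_compat. lra.
Qed.

(** The improper integral is taken as a supremum over bounded intervals. Positivity, the upper bound
    and the approximation from below are all that is known of [A] later; the lemmas that follow
    receive them as hypotheses. *)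
Lemma Aint_limit (tau : R) : 0 < tau < 1 ->
  exists A, 0 < A /\ (forall a b, a <= 0 <= b -> Aint tau a b <= A) /\
    forall delta, 0 < delta -> exists X, 0 < X /\ forall a b, a <= - X -> X <= b -> A - delta <= Aint tau a b.
Proof.
intros Ht.
destruct (completeness (fun y => exists a b, a <= 0 <= b /\ y = Aint tau a b)) as [A [HA1 HA2]].
- exists (/ tau + / (1 - tau)). intros y [a [b [Hab ->]]]. now apply Aint_bounded.
- exists (Aint tau 0 0), 0, 0. split; [lra|reflexivity].
- exists A. split; [|split].
  + apply Rlt_le_trans with (Aint tau 0 1).
    * apply RInt_gt_0; [lra|intros; apply Afun_pos|]. intros s _.
      apply ex_derive_continuous_R, Afun_derivable.
    * apply HA1. exists 0, 1. split; [lra|reflexivity].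
  + intros a b Hab. apply HA1. now exists a, b.
  + intros delta Hd. apply NNPP. intros N.
    assert (A <= A - delta); [|lra]. apply HA2. intros y [a [b [Hab ->]]].
    apply Rnot_lt_le. intros Hlt. apply N. exists (Rmax 1 (Rmax (- a) b)). split.
    * apply Rlt_le_trans with 1; [lra|apply Rmax_l].
    * intros a' b' Ha' Hb'.
      assert (- a <= Rmax 1 (Rmax (- a) b)) by (eapply Rle_trans; [apply Rmax_l|apply Rmax_r]).
      assert (b <= Rmax 1 (Rmax (- a) b)) by (eapply Rle_trans; [apply Rmax_r|apply Rmax_r]).
      apply Rle_trans with (Aint tau a b); [lra|]. apply Aint_le; lra.
Qed.

(* [ell phi s] is [ln |1 + exp (- s - i phi)|]. *)
Definition ell (phi s : R) : R := ln (1 + 2 * cos phi * exp (- s) + exp (- s) * exp (- s)) / 2.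

(** Minus the derivative of [ell phi]; it is the real part of [1 / (1 + exp (s + i phi))]. *)
Definition dell (phi s : R) : R :=
  (1 + exp s * cos phi) / (1 + 2 * cos phi * exp s + exp s * exp s).

Lemma quad_ge (c y : R) : -1 <= c <= 1 -> 1 - c * c <= 1 + 2 * c * y + y * y.
Proof. intros Hc. assert (0 <= (y + c) * (y + c)) by apply Rle_0_sqr. nra. Qed.

Lemma cos_sq_lt_1 (phi : R) : 0 < phi < PI -> 0 < 1 - cos phi * cos phi.
Proof.
intros H. assert (Hs := sin_gt_0 phi (proj1 H) (proj2 H)).
generalize (sin2_cos2 phi). unfold Rsqr. nra.
Qed.

Lemma quad_pos (phi y : R) : 0 <= phi < PI -> 0 < y -> 0 < 1 + 2 * cos phi * y + y * y.
Proof.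
intros H Hy. destruct (Req_dec phi 0) as [->|H0]; [rewrite cos_0; nra|].
apply Rlt_le_trans with (1 - cos phi * cos phi); [apply cos_sq_lt_1; lra|].
apply quad_ge. apply COS_bound.
Qed.

Lemma is_derive_ell (phi s : R) : 0 <= phi < PI -> is_derive (ell phi) s (- dell phi s).
Proof.
intros H. assert (Hq := quad_pos phi (exp (- s)) H (exp_pos _)).
assert (Hq' := quad_pos phi (exp s) H (exp_pos _)).
unfold ell, dell. auto_derive; [exact Hq|].
assert (E : exp (- s) * exp s = 1) by (rewrite <- exp_plus, <- exp_0; f_equal; ring).
set (y := exp (- s)) in *. set (z := exp s) in *.
assert (Hz : 0 < z) by apply exp_pos.
assert (Ey : y = / z) by (apply Rmult_eq_reg_r with z; [rewrite E; field; lra|lra]).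
rewrite Ey in *. field. repeat split; nra.
Qed.

(** Under [s = ln (t / r)] the counting function [t ^ tau] of the values of [lamp] becomes
    [r ^ tau * exp (tau * s)]. So [r ^ tau * ell_int] is the integral counterpart of the sum of
    [ln |1 + r exp (- i phi) / lamp k|] over [k]. *)
Definition ell_int (tau phi a b : R) : R := RInt (fun s => ell phi s * (tau * exp (tau * s))) a b.

Lemma ell_derivable (tau phi s : R) : 0 <= phi < PI -> ex_derive (fun s => ell phi s * (tau * exp (tau * s))) s.
Proof.
intros H. apply (ex_derive_mult (ell phi) (fun s => tau * exp (tau * s))).
- exists (- dell phi s). now apply is_derive_ell.
- auto_derive. trivial.
Qed.

Lemma dell_derivable (tau phi s : R) : 0 <= phi < PI -> ex_derive (fun s => dell phi s * exp (tau * s)) s.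
Proof.
intros H. unfold dell. auto_derive. generalize (quad_pos phi (exp s) H (exp_pos _)). lra.
Qed.

(** Integration by parts replaces the logarithm by [dell], the real part of a meromorphic function,
    to which contour rotation applies. *)
Lemma ell_int_parts (tau phi a b : R) :
  0 <= phi < PI ->
  ell_int tau phi a b = ell phi b * exp (tau * b) - ell phi a * exp (tau * a)
    + RInt (fun s => dell phi s * exp (tau * s)) a b.
Proof.
intros H. unfold ell_int.
assert (E : is_RInt (fun s => ell phi s * (tau * exp (tau * s)) - dell phi s * exp (tau * s)) a b
  (minus (ell phi b * exp (tau * b)) (ell phi a * exp (tau * a)))).
{ apply (is_RInt_derive (V := R_CompleteNormedModule) (fun s => ell phi s * exp (tau * s))).
  - intros s _. 
    assert (D := is_derive_mult (K := R_AbsRing) (ell phi) (fun s => exp (tau * s)) s _ (tau * exp (tau * s))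
      (is_derive_ell phi s H)).
    replace (ell phi s * (tau * exp (tau * s)) - dell phi s * exp (tau * s))
      with (plus (mult (- dell phi s) (exp (tau * s))) (mult (ell phi s) (tau * exp (tau * s))))
      by (unfold plus, mult; simpl; ring).
    apply D; [auto_derive; [trivial|ring]|apply Rmult_comm].
  - intros s _. apply ex_derive_continuous_R.
    apply (ex_derive_minus (K := R_AbsRing) (V := R_NormedModule)
      (fun s => ell phi s * (tau * exp (tau * s))) (fun s => dell phi s * exp (tau * s))).
    + now apply ell_derivable.
    + now apply dell_derivable. }
apply (is_RInt_unique (V := R_CompleteNormedModule)) in E.
assert (E2 := RInt_minus (V := R_CompleteNormedModule) (fun s => ell phi s * (tau * exp (tau * s)))
  (fun s => dell phi s * exp (tau * s)) a b
  (ex_RInt_derivable _ a b (fun s => ell_derivable tau phi s H))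
  (ex_RInt_derivable _ a b (fun s => dell_derivable tau phi s H))).
unfold minus, plus, opp in E, E2; simpl in E, E2. unfold Rminus in E. rewrite E in E2. lra.
Qed.

(** Extends [Afun tau] from the real axis. The nearest poles are at heights [PI] and [- PI], whence
    the restriction [phi < PI] on rotations. *)
Definition kernel (tau : R) (z : C) : C := (cexp (RtoC tau * z) / (1 + cexp z))%C.

Lemma one_plus_cexp_neq_0 (x y : R) : 0 <= y < PI -> (1 + cexp (x, y))%C <> RtoC 0.
Proof.
intros Hy E. apply (f_equal Cmod) in E.
assert (E2 : (Cmod (1 + cexp (x, y))) ^ 2 = 1 + 2 * cos y * exp x + exp x * exp x).
{ rewrite Cmod2_alt. unfold cexp, Re, Im, Cplus, RtoC; simpl.
  generalize (sin2_cos2 y). unfold Rsqr. intros.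
  transitivity (1 + 2 * cos y * exp x + exp x * exp x * (sin y * sin y + cos y * cos y)); [ring|].
  rewrite H. ring. }
rewrite E, Cmod_0 in E2. generalize (quad_pos y (exp x) Hy (exp_pos _)). simpl in E2. lra.
Qed.

Lemma kernel_cdiff (tau x y : R) : 0 <= y < PI -> cdiff (kernel tau) (x, y).
Proof.
intros Hy. apply (cdiff_div (fun z => cexp (RtoC tau * z)) (fun z => 1 + cexp z)%C).
- now apply one_plus_cexp_neq_0.
- apply (cdiff_cexp (fun z => RtoC tau * z)%C). apply cdiff_mult; [apply cdiff_const|apply cdiff_id].
- apply cdiff_plus; [apply cdiff_const|]. apply (cdiff_cexp (fun z => z)). apply cdiff_id.
Qed.

Lemma kernel_bound (tau x y d : R) :
  0 < d -> d <= Rabs (1 - exp x) -> Cmod (kernel tau (x, y)) <= exp (tau * x) / d.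
Proof.
intros Hd H. unfold kernel.
assert (Hc : Rabs (1 - exp x) <= Cmod (1 + cexp (x, y))).
{ assert (E : Cmod (cexp (x, y)) = exp x) by apply Cmod_cexp.
  apply Rabs_le. split.
  - generalize (Cmod_sub_ge (cexp (x, y)) (- (1))).
    replace (cexp (x, y) - - (1))%C with (1 + cexp (x, y))%C by ring.
    rewrite E, Cmod_opp, Cmod_1. lra.
  - generalize (Cmod_sub_ge 1 (- cexp (x, y))).
    replace (1 - - cexp (x, y))%C with (1 + cexp (x, y))%C by ring.
    rewrite Cmod_opp, E, Cmod_1. lra. }
rewrite Cmod_div by (apply Cmod_gt_0; lra). rewrite Cmod_cexp.
replace (Re (RtoC tau * (x, y))%C) with (tau * x) by (unfold Re, Cmult, RtoC; simpl; ring).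
apply Rmult_le_compat_l; [left; apply exp_pos|]. apply Rinv_le_contravar; lra.
Qed.

(* Rotation of the half-line of integration by the angle [phi]. *)
Lemma dell_int_rotate (tau phi a b : R) :
  0 <= phi < PI -> a <= -1 -> 1 <= b ->
  RInt (fun s => dell phi s * exp (tau * s)) a b <=
  cos (tau * phi) * Aint tau a b + 4 * PI * (exp ((tau - 1) * b) + exp (tau * a)).
Proof.
intros Hphi Ha Hb.
assert (G := goursat (kernel tau) a 0 (b - a) phi ltac:(lra) ltac:(lra)).
unfold rect_int in G. replace (a + (b - a)) with b in G by ring. rewrite Rplus_0_l in G.
assert (Hc : forall x y, 0 <= y <= phi -> ccont (kernel tau) (x, y)).
{ intros x y Hy. apply cdiff_ccont, kernel_cdiff. lra. }
assert (G0 := G ltac:(intros s t Hs Ht; apply kernel_cdiff; lra)). clear G.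
assert (Pphi : pcont (fun t => kernel tau (t, phi)) a b) by (apply pcont_hor; intros; apply Hc; lra).
assert (E1 : CInt (fun t => kernel tau (t, 0)) a b = RtoC (Aint tau a b)).
{ rewrite (CInt_ext _ (fun t => RtoC (Afun tau t))).
  - unfold CInt, Re, Im, RtoC; simpl. rewrite RInt_const. unfold scal; simpl; unfold mult; simpl.
    rewrite Rmult_0_r. reflexivity.
  - lra.
  - intros t _. unfold kernel, Afun.
    assert (E : cexp (t, 0) = RtoC (exp t)).
    { unfold cexp, Re, Im, RtoC; simpl. rewrite cos_0, sin_0. f_equal; ring. }
    assert (E' : cexp (RtoC tau * (t, 0)) = RtoC (exp (tau * t))).
    { replace (RtoC tau * (t, 0))%C with ((tau * t, 0) : C) by (unfold Cmult, RtoC; simpl; f_equal; ring).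
      unfold cexp, Re, Im, RtoC; simpl. rewrite cos_0, sin_0. f_equal; ring. }
    rewrite E, E', RtoC_div, RtoC_plus; [reflexivity|]. generalize (exp_pos t); lra. }
set (Va := CInt (fun t => kernel tau (a, t)) 0 phi) in *.
set (Vb := CInt (fun t => kernel tau (b, t)) 0 phi) in *.
rewrite E1 in G0.
assert (E2 : CInt (fun t => kernel tau (t, phi)) a b = (RtoC (Aint tau a b) + Ci * (Vb - Va))%C).
{ set (Y := CInt (fun t => kernel tau (t, phi)) a b) in *.
  replace Y with (RtoC (Aint tau a b) + Ci * Vb - Ci * Va - (RtoC (Aint tau a b) + Ci * Vb - Y - Ci * Va))%C by ring.
  rewrite G0. ring. }
(* This factor removes the phase of [exp (tau z)] on the top side, where the real part then becomes
   the integrand with [dell]; on the bottom side it produces [cos (tau * phi)]. *)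
set (u := cexp (0, - (tau * phi))).
assert (E3 : RInt (fun s => dell phi s * exp (tau * s)) a b = Re (u * CInt (fun t => kernel tau (t, phi)) a b)).
{ rewrite <- CInt_scal by (exact Pphi || lra). 
  change (RInt (fun s => dell phi s * exp (tau * s)) a b = RInt (fun t => Re (u * kernel tau (t, phi))%C) a b).
  apply RInt_ext. intros s _. unfold kernel.
  assert (Eu : (u * cexp (RtoC tau * (s, phi)))%C = RtoC (exp (tau * s))).
  { unfold u. rewrite <- cexp_plus.
    replace ((0%R, (- (tau * phi))%R) + RtoC tau * (s, phi))%C with ((tau * s, 0) : C)
      by (unfold Cmult, Cplus, RtoC; simpl; f_equal; ring).
    unfold cexp, Re, Im, RtoC; simpl. rewrite cos_0, sin_0. f_equal; ring. }
  unfold Cdiv. rewrite Cmult_assoc, Eu. unfold dell.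
  assert (Q := quad_pos phi (exp s) ltac:(lra) (exp_pos _)).
  unfold cexp, Re, Im, Cmult, Cinv, Cplus, RtoC; simpl.
  generalize (sin2_cos2 phi). unfold Rsqr. intros Hsc.
  assert (ED : (1 + exp s * cos phi) * ((1 + exp s * cos phi) * 1) + (0 + exp s * sin phi) * ((0 + exp s * sin phi) * 1)
    = 1 + 2 * cos phi * exp s + exp s * exp s).
  { transitivity (1 + 2 * cos phi * exp s + exp s * exp s * (sin phi * sin phi + cos phi * cos phi)); [ring|].
    rewrite Hsc. ring. }
  rewrite ED. unfold Rdiv. ring. }
rewrite E3, E2.
assert (Mu : Cmod u = 1) by (unfold u; rewrite Cmod_cexp; apply exp_0).
assert (E4 : Re (u * (RtoC (Aint tau a b) + Ci * (Vb - Va)))%C =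
  cos (tau * phi) * Aint tau a b + Re (u * (Ci * (Vb - Va)))%C).
{ unfold u, cexp, Re, Im, Cmult, Cplus, RtoC; simpl. rewrite exp_0, cos_neg, sin_neg. ring. }
rewrite E4. apply Rplus_le_compat_l.
eapply Rle_trans; [apply Rle_abs|]. eapply Rle_trans; [apply re_le_Cmod|].
rewrite !Cmod_mult, Mu, Cmod_Ci, !Rmult_1_l.
eapply Rle_trans; [apply Cmod_triangle|]. rewrite Cmod_opp.
generalize PI_RGT_0. intros HPI.
assert (He1 : 2 <= exp 1) by (generalize (exp_ineq1_le 1); lra).
assert (HVb : Cmod Vb <= 4 * PI * exp ((tau - 1) * b)).
{ assert (Eb : 2 <= exp b) by (apply Rle_trans with (exp 1); [lra|apply exp_le; lra]).
  apply Rle_trans with (2 * (exp (tau * b) / (exp b / 2)) * (phi - 0)).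
  - apply CInt_bound; [lra|apply pcont_ver; intros; apply Hc; lra|].
    intros t _. apply kernel_bound; [lra|]. rewrite Rabs_left by lra. lra.
  - replace (tau * b) with ((tau - 1) * b + b) by ring. rewrite exp_plus.
    replace (2 * (exp ((tau - 1) * b) * exp b / (exp b / 2)) * (phi - 0)) with (4 * phi * exp ((tau - 1) * b)) by (field; lra).
    apply Rmult_le_compat_r; [left; apply exp_pos|lra]. }
assert (HVa : Cmod Va <= 4 * PI * exp (tau * a)).
{ assert (Ea : exp a <= / 2).
  { apply Rle_trans with (exp (- (1))); [apply exp_le; lra|]. rewrite exp_Ropp.
    apply Rinv_le_contravar; lra. }
  apply Rle_trans with (2 * (exp (tau * a) / (/ 2)) * (phi - 0)).
  - apply CInt_bound; [lra|apply pcont_ver; intros; apply Hc; lra|].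
    intros t _. apply kernel_bound; [lra|]. rewrite Rabs_pos_eq by lra. lra.
  - replace (2 * (exp (tau * a) / (/ 2)) * (phi - 0)) with (4 * phi * exp (tau * a)) by field.
    apply Rmult_le_compat_r; [left; apply exp_pos|lra]. }
lra.
Qed.

(** * From sums to integrals *)

Lemma exp_decay_small (c eps : R) : 0 < c -> 0 < eps -> exists X, 1 <= X /\ forall x, X <= x -> exp (- (c * x)) <= eps.
Proof.
intros Hc He. exists (1 + / (c * eps)).
assert (H : 0 < / (c * eps)) by (apply Rinv_0_lt_compat, Rmult_lt_0_compat; lra).
split; [lra|]. intros x Hx.
rewrite exp_Ropp. rewrite <- (Rinv_inv eps). apply Rinv_le_contravar; [now apply Rinv_0_lt_compat|].
apply Rle_trans with (c * x); [|generalize (exp_ineq1_le (c * x)); lra].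
apply Rle_trans with (c * / (c * eps)); [right; field; lra|]. apply Rmult_le_compat_l; lra.
Qed.

Lemma ln_le (x y : R) : 0 < x -> x <= y -> ln x <= ln y.
Proof. intros Hx [H| ->]; [left; now apply ln_increasing|lra]. Qed.

Lemma ln_1_plus_le (y : R) : 0 <= y -> ln (1 + y) <= y.
Proof.
intros Hy. rewrite <- (ln_exp y) at 2. apply ln_le; [lra|]. apply exp_ineq1_le.
Qed.

Lemma ell_le (phi s : R) : 0 <= phi < PI -> ell phi s <= ln (1 + exp (- s)).
Proof.
intros H. unfold ell. set (y := exp (- s)). assert (Hy : 0 < y) by apply exp_pos.
assert (H1 := quad_pos phi y H Hy). generalize (COS_bound phi). intros Hc.
apply Rle_trans with (ln ((1 + y) * (1 + y)) / 2).
- apply Rmult_le_compat_r; [lra|]. apply ln_le; [exact H1|]. nra.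
- rewrite ln_mult by lra. lra.
Qed.

Lemma ell_ge_0 (phi s : R) : 0 <= phi < PI -> s <= -1 -> 0 <= ell phi s.
Proof.
intros H Hs. unfold ell. set (y := exp (- s)).
assert (Hy : 2 <= y).
{ apply Rle_trans with (exp 1); [generalize (exp_ineq1_le 1); lra|apply exp_le; lra]. }
generalize (COS_bound phi). intros Hc.
apply Rmult_le_pos; [|lra]. rewrite <- ln_1. apply ln_le; [lra|]. nra.
Qed.

(** One [X] serves all [phi]. Of the boundary terms in [ell_int_parts], the one at [a] has the
    favourable sign and the one at [b] is at most [exp ((tau - 1) * b)]. *)
Lemma ell_int_upper (tau A : R) : 0 < tau < 1 ->
  (forall a b, a <= 0 <= b -> Aint tau a b <= A) ->
  (forall delta, 0 < delta -> exists X, 0 < X /\ forall a b, a <= - X -> X <= b -> A - delta <= Aint tau a b) ->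
  forall delta, 0 < delta -> exists X, 1 <= X /\ forall phi a b, 0 <= phi < PI -> a <= - X -> X <= b ->
    ell_int tau phi a b <= A * cos (tau * phi) + delta.
Proof.
intros Ht HA1 HA2 delta Hd. generalize PI_RGT_0. intros HPI.
destruct (HA2 (delta / 2)) as [X1 [HX1 H1]]; [lra|].
destruct (exp_decay_small (1 - tau) (delta / 4 / (1 + 4 * PI))) as [X2 [HX2 H2]];
  [lra|apply Rdiv_lt_0_compat; lra|].
destruct (exp_decay_small tau (delta / 4 / (4 * PI))) as [X3 [HX3 H3]];
  [lra|apply Rdiv_lt_0_compat; lra|].
set (X := Rmax X1 (Rmax X2 X3)).
assert (L1 : X1 <= X) by apply Rmax_l.
assert (L2 : X2 <= X) by (eapply Rle_trans; [apply Rmax_l|apply Rmax_r]).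
assert (L3 : X3 <= X) by (eapply Rle_trans; [apply Rmax_r|apply Rmax_r]).
exists X. split; [lra|]. intros phi a b Hphi Ha Hb.
rewrite ell_int_parts by exact Hphi.
assert (B1 := dell_int_rotate tau phi a b Hphi ltac:(lra) ltac:(lra)).
assert (B2 : 0 <= ell phi a * exp (tau * a)).
{ apply Rmult_le_pos; [apply ell_ge_0; [exact Hphi|lra]|left; apply exp_pos]. }
assert (B3 : ell phi b * exp (tau * b) <= exp ((tau - 1) * b)).
{ replace ((tau - 1) * b) with (- b + tau * b) by ring. rewrite exp_plus.
  apply Rmult_le_compat_r; [left; apply exp_pos|]. eapply Rle_trans; [now apply ell_le|].
  apply ln_1_plus_le. left; apply exp_pos. }
assert (B4 : exp ((tau - 1) * b) <= delta / 4 / (1 + 4 * PI)).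
{ replace ((tau - 1) * b) with (- ((1 - tau) * b)) by ring. apply H2. lra. }
assert (B5 : exp (tau * a) <= delta / 4 / (4 * PI)).
{ replace (tau * a) with (- (tau * - a)) by ring. apply H3. lra. }
(* The cosine may be negative, so the upper and the lower bound for [Aint] are both used. *)
assert (B6 : cos (tau * phi) * Aint tau a b <= A * cos (tau * phi) + delta / 2).
{ generalize (COS_bound (tau * phi)). intros Hc.
  assert (C1 := HA1 a b ltac:(lra)). assert (C2 := H1 a b ltac:(lra) ltac:(lra)). nra. }
apply (Rmult_le_compat_l (1 + 4 * PI)) in B4; [|lra].
apply (Rmult_le_compat_l (4 * PI)) in B5; [|lra].
replace ((1 + 4 * PI) * (delta / 4 / (1 + 4 * PI))) with (delta / 4) in B4 by (field; lra).
replace (4 * PI * (delta / 4 / (4 * PI))) with (delta / 4) in B5 by (field; lra).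
lra.
Qed.

(** In the direction [phi = 0] the integrand with [dell] is [Afun] itself and no rotation takes
    place. The boundary term at [a] now has the unfavourable sign, but it is of order
    [|a| * exp (tau * a)]. *)
Lemma ell_int_lower (tau A : R) : 0 < tau < 1 ->
  (forall delta, 0 < delta -> exists X, 0 < X /\ forall a b, a <= - X -> X <= b -> A - delta <= Aint tau a b) ->
  forall delta, 0 < delta -> exists X, 1 <= X /\ forall a b, a <= - X -> X <= b ->
    A - delta <= ell_int tau 0 a b.
Proof.
intros Ht HA2 delta Hd. generalize PI_RGT_0. intros HPI.
destruct (HA2 (delta / 2)) as [X1 [HX1 H1]]; [lra|].
(* The decay is split in two: one factor [exp (- tau x / 2)] absorbs the growth of [1 + x], the
   other makes the product small. *)
destruct (exp_decay_small (tau / 2) (delta / 2 * (tau / 2))) as [X2 [HX2 H2]];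
  [lra|apply Rmult_lt_0_compat; lra|].
set (X := Rmax X1 X2).
assert (L1 : X1 <= X) by apply Rmax_l. assert (L2 : X2 <= X) by apply Rmax_r.
exists X. split; [lra|]. intros a b Ha Hb.
rewrite ell_int_parts by lra.
assert (E : RInt (fun s => dell 0 s * exp (tau * s)) a b = Aint tau a b).
{ assert (E' : forall s, dell 0 s * exp (tau * s) = Afun tau s).
  { intros s. unfold dell, Afun. rewrite cos_0. generalize (exp_pos s). intros. field. nra. }
  apply RInt_ext. intros s _. apply E'. }
rewrite E.
assert (C2 := H1 a b ltac:(lra) ltac:(lra)).
assert (E0 : forall s, ell 0 s = ln (1 + exp (- s))).
{ intros s. unfold ell. rewrite cos_0. generalize (exp_pos (- s)). intros.
  replace (1 + 2 * 1 * exp (- s) + exp (- s) * exp (- s)) with ((1 + exp (- s)) * (1 + exp (- s))) by ring.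
  rewrite ln_mult by lra. field. }
assert (B1 : 0 <= ell 0 b * exp (tau * b)).
{ apply Rmult_le_pos; [|left; apply exp_pos]. rewrite E0, <- ln_1. apply ln_le; [lra|].
  generalize (exp_pos (- b)). lra. }
assert (B2 : ell 0 a * exp (tau * a) <= delta / 2).
{ set (x := - a). assert (Hx : X2 <= x) by (unfold x; lra).
  assert (G1 : ell 0 a <= 1 + x).
  { rewrite E0. fold x. rewrite <- (ln_exp (1 + x)). apply ln_le; [generalize (exp_pos x); lra|].
    rewrite exp_plus. assert (2 <= exp 1) by (generalize (exp_ineq1_le 1); lra).
    assert (1 <= exp x) by (rewrite <- exp_0; apply exp_le; lra). nra. }
  specialize (H2 x Hx). set (w := exp (- (tau / 2 * x))) in *.
  assert (Ew : exp (tau * a) = w * w).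
  { unfold w, x. rewrite <- exp_plus. f_equal. field. }
  assert (Hw : 0 < w) by apply exp_pos.
  assert (G2 : (1 + x) * (tau / 2) * w <= 1).
  { assert (G3 : exp (tau / 2 * x) * w = 1) by (unfold w; rewrite <- exp_plus, <- exp_0; f_equal; ring).
    rewrite <- G3. apply Rmult_le_compat_r; [lra|]. generalize (exp_ineq1_le (tau / 2 * x)). nra. }
  rewrite Ew.
  apply Rle_trans with ((1 + x) * (w * w)).
  { apply Rmult_le_compat_r; nra. }
  assert (G4 : (1 + x) * w <= / (tau / 2)).
  { apply Rmult_le_reg_r with (tau / 2); [lra|]. rewrite Rinv_l by lra. lra. }
  apply Rle_trans with (/ (tau / 2) * (delta / 2 * (tau / 2))); [|right; field; lra].
  rewrite <- Rmult_assoc. apply Rmult_le_compat; [|lra|exact G4|exact H2].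
  apply Rmult_le_pos; lra. }
lra.
Qed.

(** This is [ln (lamp (/ tau) k / r)], the position of the [k]-th value in the variable of
    [ell_int]. By [snode_weight], consecutive nodes bound cells of mass 1 for the measure
    [r ^ tau d(exp (tau s))]. *)
Definition snode (tau r : R) (k : nat) : R := / tau * ln (INR (S k)) - ln r.

Lemma exp_snode (tau r : R) (k : nat) : 0 < r -> exp (- snode tau r k) = r / lamp (/ tau) k.
Proof.
intros Hr. unfold snode, lamp, Rpower.
replace (- (/ tau * ln (INR (S k)) - ln r)) with (ln r + - (/ tau * ln (INR (S k)))) by ring.
rewrite exp_plus, exp_ln, exp_Ropp by exact Hr. reflexivity.
Qed.

Lemma snode_weight (tau r : R) (k : nat) : 0 < tau -> 0 < r ->
  Rpower r tau * exp (tau * snode tau r k) = INR (S k).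
Proof.
intros Ht Hr. unfold snode, Rpower. rewrite <- exp_plus.
replace (tau * ln r + tau * (/ tau * ln (INR (S k)) - ln r)) with (ln (INR (S k))) by (field; lra).
apply exp_ln. apply INR_S_pos.
Qed.

Lemma snode_lt (tau r : R) (k : nat) : 0 < tau -> snode tau r k < snode tau r (S k).
Proof.
intros Ht. unfold snode. apply Rplus_lt_compat_r. apply Rmult_lt_compat_l; [now apply Rinv_0_lt_compat|].
apply ln_increasing; [apply INR_S_pos|]. apply lt_INR. lia.
Qed.

Lemma RInt_weight (tau c a b : R) : 0 < tau ->
  RInt (fun s => c * (tau * exp (tau * s))) a b = c * (exp (tau * b) - exp (tau * a)).
Proof.
intros Ht. apply (is_RInt_unique (V := R_CompleteNormedModule)).
replace (c * (exp (tau * b) - exp (tau * a))) with (minus (c * exp (tau * b)) (c * exp (tau * a)))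
  by (unfold minus, plus, opp; simpl; ring).
apply (is_RInt_derive (V := R_CompleteNormedModule) (fun s => c * exp (tau * s))).
- intros x _. auto_derive; [trivial|ring].
- intros x _. apply ex_derive_continuous_R. auto_derive. trivial.
Qed.

Definition seg (tau phi r : R) (j k : nat) : R :=
  Rpower r tau * ell_int tau phi (snode tau r j) (snode tau r k).

Lemma ell_ex_RInt (tau phi a b : R) : 0 <= phi < PI -> ex_RInt (fun s => ell phi s * (tau * exp (tau * s))) a b.
Proof. intros H. apply ex_RInt_derivable. intros s. now apply ell_derivable. Qed.

(** The cell has mass 1, so [seg] over it is a mean value of [ell phi]. *)
Lemma seg_step_ge (tau phi r c : R) (j : nat) : 0 < tau -> 0 <= phi < PI -> 0 < r ->
  (forall s, snode tau r j <= s <= snode tau r (S j) -> c <= ell phi s) ->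
  c <= seg tau phi r j (S j).
Proof.
intros Ht Hphi Hr H. unfold seg.
assert (Hw : 0 < Rpower r tau) by apply Rpower_pos.
apply Rle_trans with (Rpower r tau * RInt (fun s => c * (tau * exp (tau * s))) (snode tau r j) (snode tau r (S j))).
- rewrite RInt_weight by exact Ht.
  replace (Rpower r tau * (c * (exp (tau * snode tau r (S j)) - exp (tau * snode tau r j))))
    with (c * (Rpower r tau * exp (tau * snode tau r (S j)) - Rpower r tau * exp (tau * snode tau r j))) by ring.
  rewrite !snode_weight by assumption. rewrite (S_INR (S j)). right; ring.
- apply Rmult_le_compat_l; [lra|]. apply RInt_le.
  + left. now apply snode_lt.
  + apply ex_RInt_derivable. intros s. auto_derive. trivial.
  + now apply ell_ex_RInt.
  + intros s Hs. apply Rmult_le_compat_r; [left; apply Rmult_lt_0_compat; [lra|apply exp_pos]|]. apply H. lra.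
Qed.

Lemma seg_step_le (tau phi r c : R) (j : nat) : 0 < tau -> 0 <= phi < PI -> 0 < r ->
  (forall s, snode tau r j <= s <= snode tau r (S j) -> ell phi s <= c) ->
  seg tau phi r j (S j) <= c.
Proof.
intros Ht Hphi Hr H. unfold seg.
assert (Hw : 0 < Rpower r tau) by apply Rpower_pos.
apply Rle_trans with (Rpower r tau * RInt (fun s => c * (tau * exp (tau * s))) (snode tau r j) (snode tau r (S j))).
- apply Rmult_le_compat_l; [lra|]. apply RInt_le.
  + left. now apply snode_lt.
  + now apply ell_ex_RInt.
  + apply ex_RInt_derivable. intros s. auto_derive. trivial.
  + intros s Hs. apply Rmult_le_compat_r; [left; apply Rmult_lt_0_compat; [lra|apply exp_pos]|]. apply H. lra.
- rewrite RInt_weight by exact Ht.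
  replace (Rpower r tau * (c * (exp (tau * snode tau r (S j)) - exp (tau * snode tau r j))))
    with (c * (Rpower r tau * exp (tau * snode tau r (S j)) - Rpower r tau * exp (tau * snode tau r j))) by ring.
  rewrite !snode_weight by assumption. rewrite (S_INR (S j)). right; ring.
Qed.

Lemma seg_Chasles (tau phi r : R) (i j k : nat) : 0 <= phi < PI ->
  seg tau phi r i k = seg tau phi r i j + seg tau phi r j k.
Proof.
intros H. unfold seg, ell_int.
rewrite <- (RInt_Chasles (V := R_CompleteNormedModule) _ (snode tau r i) (snode tau r j) (snode tau r k))
  by now apply ell_ex_RInt.
unfold plus; simpl. ring.
Qed.

Lemma seg_refl (tau phi r : R) (i : nat) : seg tau phi r i i = 0.
Proof. unfold seg, ell_int. rewrite RInt_point. unfold zero; simpl. ring. Qed.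

Lemma ell_quad_le (phi s t : R) : 0 <= phi < PI ->
  1 + 2 * cos phi * exp (- s) + exp (- s) * exp (- s) <= 1 + 2 * cos phi * exp (- t) + exp (- t) * exp (- t) ->
  ell phi s <= ell phi t.
Proof.
intros H Hq. unfold ell. apply Rmult_le_compat_r; [lra|]. apply ln_le; [|exact Hq].
apply quad_pos; [exact H|apply exp_pos].
Qed.

(* As a function of [k], [ell phi (snode tau r k)] first decreases and then
   increases, so that each term is dominated by the integral over a neighbouring
   cell; only the cell at the turning point is lost. *)
Lemma rsum_ell_le (tau phi r C0 : R) (n : nat) :
  0 < tau -> 0 <= phi < PI -> 0 < r -> 0 <= C0 -> (forall s, - C0 <= ell phi s) ->
  rsum (fun k => ell phi (snode tau r (S k))) n <= seg tau phi r 0 (S n) + C0.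
Proof.
intros Ht Hphi Hr HC0 HC.
assert (Hst : forall j, - C0 <= seg tau phi r j (S j)).
{ intros j. apply seg_step_ge; auto. }
set (y k := exp (- snode tau r k)).
assert (Hy : forall k, y (S k) <= y k).
{ intros k. unfold y. apply exp_le. generalize (snode_lt tau r k Ht). lra. }
assert (HD : forall k, - cos phi <= y (S k) -> ell phi (snode tau r (S k)) <= seg tau phi r k (S k)).
{ intros k Hk. apply seg_step_ge; auto. intros s Hs. apply ell_quad_le; [exact Hphi|]. fold (y (S k)).
  assert (y (S k) <= exp (- s)) by (unfold y; apply exp_le; lra). nra. }
assert (HI : forall k, y k <= - cos phi -> ell phi (snode tau r k) <= seg tau phi r k (S k)).
{ intros k Hk. apply seg_step_ge; auto. intros s Hs. apply ell_quad_le; [exact Hphi|]. fold (y k).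
  assert (exp (- s) <= y k) by (unfold y; apply exp_le; lra). nra. }
(* The quadratic [1 + 2 y cos phi + y ^ 2] is smallest at [y = - cos phi]. Until [y k] passes this
   value, a term is dominated by the cell on its left, afterwards by the cell on its right; hence
   the upper end [n] in the first case and [S n] in the second. *)
assert (G : (- cos phi <= y n -> rsum (fun k => ell phi (snode tau r (S k))) n <= seg tau phi r 0 n) /\
  (y n <= - cos phi -> rsum (fun k => ell phi (snode tau r (S k))) n <= seg tau phi r 0 (S n) + C0)).
{ induction n as [|n [IH1 IH2]].
  - simpl. split; intros _; [rewrite seg_refl; lra|]. specialize (Hst 0%nat). lra.
  - split; intros Hn; simpl.
    + rewrite (seg_Chasles tau phi r 0 n (S n)) by exact Hphi.
      specialize (IH1 ltac:(generalize (Hy n); lra)). specialize (HD n Hn). lra.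
    + rewrite (seg_Chasles tau phi r 0 (S n) (S (S n))) by exact Hphi. specialize (HI (S n) Hn).
      destruct (Rle_dec (- cos phi) (y n)) as [H1|H1].
      * specialize (IH1 H1). specialize (Hst n).
        rewrite (seg_Chasles tau phi r 0 n (S n)) by exact Hphi. lra.
      * specialize (IH2 ltac:(lra)). lra. }
destruct (Rle_dec (- cos phi) (y n)) as [H1|H1].
- rewrite (seg_Chasles tau phi r 0 n (S n)) by exact Hphi. specialize (Hst n). apply (proj1 G) in H1. lra.
- apply (proj2 G). lra.
Qed.

Lemma rsum_split_first (f : nat -> R) (n : nat) : rsum f (S n) = f O + rsum (fun k => f (S k)) n.
Proof. induction n as [|n IH]; [simpl; ring|]. simpl in *. rewrite IH. ring. Qed.

Lemma snode_large (tau r X : R) : 0 < tau -> exists n0, forall n, (n0 <= n)%nat -> X <= snode tau r n.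
Proof.
intros Ht. set (Y := exp (tau * (X + ln r))).
destruct (nfloor_ex Y) as [n0 Hn0]; [left; apply exp_pos|].
exists n0. intros n Hn. unfold snode.
assert (HY : tau * (X + ln r) <= ln (INR (S n))).
{ rewrite <- (ln_exp (tau * (X + ln r))). apply ln_le; [apply exp_pos|]. fold Y.
  rewrite S_INR. apply le_INR in Hn. lra. }
apply (Rmult_le_compat_l (/ tau)) in HY; [|left; now apply Rinv_0_lt_compat].
rewrite <- Rmult_assoc, Rinv_l, Rmult_1_l in HY by lra. lra.
Qed.

(** The quadratic under the logarithm stays above [sin eta ^ 2]. The bound degenerates as [phi]
    tends to [PI], the direction of the zeros. *)
Lemma ell_lower_bound (phi eta s : R) : 0 < eta < PI / 2 -> 0 <= phi <= PI - eta ->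
  ln (sin eta * sin eta) / 2 <= ell phi s.
Proof.
intros He Hphi. generalize PI_RGT_0; intros HPI.
assert (Hs := sin_gt_0 eta ltac:(lra) ltac:(lra)).
unfold ell. apply Rmult_le_compat_r; [lra|]. apply ln_le; [nra|].
assert (Hc : - cos eta <= cos phi).
{ replace (- cos eta) with (cos (PI - eta)).
  - apply cos_decr_1; lra.
  - rewrite cos_minus, cos_PI, sin_PI. ring. }
generalize (sin2_cos2 eta). unfold Rsqr. intros Hsc.
assert (Hy := exp_pos (- s)). set (y := exp (- s)) in *.
assert (Hq := quad_ge (- cos eta) y ltac:(generalize (COS_bound eta); lra)). nra.
Qed.

(** Comes from [ln y <= y] at [y = delta * tau * Rpower r tau], together with [1 + r <= 2 r]. *)
Lemma ln_1_plus_absorbed (tau delta : R) : 0 < tau -> 0 < delta ->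
  exists C0, 0 <= C0 /\ forall r, 1 <= r -> ln (1 + r) <= delta * Rpower r tau + C0.
Proof.
intros Ht Hd. exists (ln 2 + Rabs (ln (delta * tau)) / tau). split.
- assert (0 <= ln 2) by (rewrite <- ln_1; apply ln_le; lra).
  assert (0 <= Rabs (ln (delta * tau)) / tau) by (apply Rdiv_le_0_compat; [apply Rabs_pos|exact Ht]). lra.
- intros r Hr.
  assert (H1 : ln (1 + r) <= ln 2 + ln r) by (rewrite <- ln_mult by lra; apply ln_le; lra).
  assert (Hw := Rpower_pos r tau).
  assert (H2 : ln (delta * tau) + tau * ln r <= delta * tau * Rpower r tau).
  { replace (tau * ln r) with (ln (Rpower r tau)) by (unfold Rpower; apply ln_exp).
    rewrite <- ln_mult by nra. set (y := delta * tau * Rpower r tau).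
    assert (Hy : 0 < y) by (unfold y; apply Rmult_lt_0_compat; nra).
    rewrite <- (ln_exp y) at 2. apply ln_le; [exact Hy|]. generalize (exp_ineq1_le y). lra. }
  pose proof (Rle_abs (- ln (delta * tau))) as H3. rewrite Rabs_Ropp in H3.
  assert (H4 : ln r <= delta * Rpower r tau + Rabs (ln (delta * tau)) / tau).
  { apply Rmult_le_reg_l with tau; [exact Ht|].
    replace (tau * (delta * Rpower r tau + Rabs (ln (delta * tau)) / tau))
      with (delta * tau * Rpower r tau + Rabs (ln (delta * tau))) by (field; lra). lra. }
  lra.
Qed.

Lemma snode_0 (tau r : R) : snode tau r 0 = - ln r.
Proof. unfold snode. simpl. rewrite ln_1. ring. Qed.

(** The quantifiers matter: [C0] and [X] depend on neither [r] nor [phi], and [n0] does not depend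
    on [phi]. The term [k = 0] has no cell on its left; it is at most [ln (1 + r)] and is absorbed
    by [ln_1_plus_absorbed]. *)
Lemma rsum_ell_upper (tau A : R) : 0 < tau < 1 ->
  (forall a b, a <= 0 <= b -> Aint tau a b <= A) ->
  (forall delta, 0 < delta -> exists X, 0 < X /\ forall a b, a <= - X -> X <= b -> A - delta <= Aint tau a b) ->
  forall eta delta, 0 < eta < PI / 2 -> 0 < delta -> exists C0 X, 1 <= X /\
    forall r, X <= r -> exists n0, forall n phi, (n0 <= n)%nat -> 0 <= phi <= PI - eta ->
      rsum (fun k => ell phi (snode tau r k)) n <= (A * cos (tau * phi) + delta) * Rpower r tau + C0.
Proof.
intros Ht HA1 HA2 eta delta He Hd. generalize PI_RGT_0; intros HPI.
destruct (ell_int_upper tau A Ht HA1 HA2 (delta / 2)) as [X [HX H]]; [lra|].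
destruct (ln_1_plus_absorbed tau (delta / 2)) as [C1 [HC1 H1]]; [lra|lra|].
assert (Hs := sin_gt_0 eta ltac:(lra) ltac:(lra)).
set (C2 := - (ln (sin eta * sin eta) / 2)).
assert (HC2 : 0 <= C2).
{ unfold C2. generalize (SIN_bound eta). intros Hb.
  assert (ln (sin eta * sin eta) <= 0); [|lra]. rewrite <- ln_1. apply ln_le; nra. }
exists (C1 + C2), (exp X). split.
{ rewrite <- exp_0. apply exp_le. lra. }
intros r Hr. assert (Hr0 : 0 < r) by (generalize (exp_pos X); lra).
assert (Hr1 : 1 <= r) by (apply Rle_trans with (exp X); [rewrite <- exp_0; apply exp_le; lra|exact Hr]).
assert (HlX : X <= ln r) by (rewrite <- (ln_exp X); apply ln_le; [apply exp_pos|exact Hr]).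
destruct (snode_large tau r X (proj1 Ht)) as [n0 Hn0].
exists (S n0). intros n phi Hn Hphi. destruct n as [|n]; [lia|].
rewrite rsum_split_first.
assert (B1 : ell phi (snode tau r 0) <= ln (1 + r)).
{ eapply Rle_trans; [apply ell_le; lra|]. rewrite snode_0, Ropp_involutive, exp_ln by exact Hr0. lra. }
assert (B2 := rsum_ell_le tau phi r C2 n (proj1 Ht) ltac:(lra) Hr0 HC2).
specialize (B2 ltac:(intros s; unfold C2; rewrite Ropp_involutive; now apply ell_lower_bound)).
assert (B3 : seg tau phi r 0 (S n) <= Rpower r tau * (A * cos (tau * phi) + delta / 2)).
{ unfold seg. apply Rmult_le_compat_l; [left; apply Rpower_pos|]. apply H; [lra| |].
  - rewrite snode_0. lra.
  - apply Hn0. lia. }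
specialize (H1 r Hr1). lra.
Qed.

(** For [phi = 0] the function [ell] decreases, so each term is at least the integral over the cell
    on its right. *)
Lemma rsum_ln_lower (tau A : R) : 0 < tau < 1 ->
  (forall delta, 0 < delta -> exists X, 0 < X /\ forall a b, a <= - X -> X <= b -> A - delta <= Aint tau a b) ->
  forall delta, 0 < delta -> exists X, 1 <= X /\
    forall r, X <= r -> exists n, (A - delta) * Rpower r tau <= rsum (fun k => ln (1 + r / lamp (/ tau) k)) n.
Proof.
intros Ht HA2 delta Hd. generalize PI_RGT_0; intros HPI.
destruct (ell_int_lower tau A Ht HA2 delta Hd) as [X [HX H]].
exists (exp X). split.
{ rewrite <- exp_0. apply exp_le. lra. }
intros r Hr. assert (Hr0 : 0 < r) by (generalize (exp_pos X); lra).
assert (HlX : X <= ln r) by (rewrite <- (ln_exp X); apply ln_le; [apply exp_pos|exact Hr]).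
destruct (snode_large tau r X (proj1 Ht)) as [n Hn]. exists n.
assert (E : forall k, ln (1 + r / lamp (/ tau) k) = ell 0 (snode tau r k)).
{ intros k. unfold ell. rewrite cos_0, exp_snode by exact Hr0.
  assert (0 < r / lamp (/ tau) k) by (apply Rdiv_lt_0_compat; [exact Hr0|apply lamp_pos]).
  set (y := r / lamp (/ tau) k) in *.
  replace (1 + 2 * 1 * y + y * y) with ((1 + y) * (1 + y)) by ring. rewrite ln_mult by lra. field. }
rewrite (rsum_ext _ (fun k => ell 0 (snode tau r k))) by (intros; apply E).
apply Rle_trans with (seg tau 0 r 0 n).
- unfold seg. rewrite Rmult_comm. apply Rmult_le_compat_l; [left; apply Rpower_pos|].
  apply H; [rewrite snode_0; lra|]. apply Hn. lia.
- clear Hn. induction n as [|n IH]; [rewrite seg_refl; simpl; lra|].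
  simpl. rewrite (seg_Chasles tau 0 r 0 n (S n)) by lra. apply Rplus_le_compat; [exact IH|].
  apply seg_step_le; try lra. intros s Hs. apply ell_quad_le; [lra|]. rewrite cos_0.
  assert (exp (- s) <= exp (- snode tau r n)) by (apply exp_le; lra).
  generalize (exp_pos (- s)). nra.
Qed.

(** * Infinite products *)

Definition Clim (u : nat -> C) (l : C) : Prop :=
  forall eps, 0 < eps -> exists N, forall n, (N <= n)%nat -> Cmod (u n - l) <= eps.

Lemma Clim_of_increments (u : nat -> C) (a : nat -> R) (c S0 : R) :
  0 <= c -> (forall k, 0 <= a k) -> (forall n, rsum a n <= S0) ->
  (forall n, Cmod (u (S n) - u n) <= c * a n) -> exists l, Clim u l.
Proof.
intros Hc Ha HS Hu.
assert (Hd : forall n k, Cmod (u (n + k)%nat - u n) <= c * (rsum a (n + k) - rsum a n)).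
{ intros n k. induction k as [|k IH].
  - rewrite Nat.add_0_r. replace (u n - u n)%C with (RtoC 0) by ring. rewrite Cmod_0. lra.
  - rewrite Nat.add_succ_r. simpl rsum. specialize (Hu (n + k)%nat).
    eapply Rle_trans; [apply (Cmod_sub_triangle _ (u (n + k)%nat))|]. lra. }
assert (Hmono : forall n k, rsum a n <= rsum a (n + k)) by (intros; apply rsum_mono; [exact Ha|lia]).
destruct (completeness (fun x => exists n, x = rsum a n)) as [T [HT1 HT2]].
{ exists S0. intros x [n ->]. apply HS. }
{ exists 0, 0%nat. reflexivity. }
assert (HC : forall eps, 0 < eps -> exists N, forall n, (N <= n)%nat -> c * (T - rsum a n) <= eps).
{ intros eps He. apply NNPP. intros Hn.
  assert (T <= T - eps / (c + 1)).
  { apply HT2. intros x [N ->]. apply Rnot_lt_le. intros Hlt. apply Hn. exists N. intros n HNn.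
    assert (rsum a N <= rsum a n) by (apply rsum_mono; assumption).
    assert (H1 : T - rsum a n <= eps / (c + 1)) by lra.
    assert (H2 : rsum a n <= T) by (apply HT1; now exists n).
    apply Rle_trans with ((c + 1) * (eps / (c + 1))); [|right; field; lra]. nra. }
  assert (0 < eps / (c + 1)) by (apply Rdiv_lt_0_compat; lra). lra. }
assert (HCau : forall eps, 0 < eps -> exists N, forall n m, (N <= n)%nat -> (N <= m)%nat ->
  Cmod (u n - u m) < eps).
{ intros eps He. destruct (HC (eps / 3)) as [N HN]; [lra|]. exists N. intros n m Hn Hm.
  assert (G : forall k, (N <= k)%nat -> Cmod (u k - u N) <= eps / 3).
  { intros k Hk. replace k with (N + (k - N))%nat by lia. eapply Rle_trans; [apply Hd|].
    eapply Rle_trans; [|apply (HN N); lia]. apply Rmult_le_compat_l; [exact Hc|].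
    assert (rsum a (N + (k - N)) <= T) by (apply HT1; eauto). lra. }
  eapply Rle_lt_trans; [apply (Cmod_sub_triangle _ (u N))|].
  rewrite (Cmod_sub_sym (u N)). generalize (G n Hn) (G m Hm). lra. }
destruct (Rcomplete.R_complete (fun n => Re (u n))) as [x Hx].
{ intros eps He. destruct (HCau eps He) as [N HN]. exists N. intros n m Hn Hm.
  eapply Rle_lt_trans; [|apply (HN n m Hn Hm)].
  replace (R_dist (Re (u n)) (Re (u m))) with (Rabs (Re (u n - u m)%C)) by reflexivity. apply re_le_Cmod. }
destruct (Rcomplete.R_complete (fun n => Im (u n))) as [y Hy].
{ intros eps He. destruct (HCau eps He) as [N HN]. exists N. intros n m Hn Hm.
  eapply Rle_lt_trans; [|apply (HN n m Hn Hm)].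
  replace (R_dist (Im (u n)) (Im (u m))) with (Rabs (Im (u n - u m)%C)) by reflexivity. apply im_le_Cmod. }
exists (x, y). intros eps He.
destruct (Hx (eps / 2)) as [N1 H1]; [lra|]. destruct (Hy (eps / 2)) as [N2 H2]; [lra|].
exists (Nat.max N1 N2). intros n Hn. eapply Rle_trans; [apply Cmod_le_abs|].
specialize (H1 n ltac:(lia)). specialize (H2 n ltac:(lia)).
replace (R_dist (Re (u n)) x) with (Rabs (Re (u n - (x, y))%C)) in H1 by reflexivity.
replace (R_dist (Im (u n)) y) with (Rabs (Im (u n - (x, y))%C)) in H2 by reflexivity. lra.
Qed.

Lemma Clim_Cmod_le (u : nat -> C) (l : C) (B : R) (N : nat) :
  Clim u l -> (forall n, (N <= n)%nat -> Cmod (u n) <= B) -> Cmod l <= B.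
Proof.
intros Hl Hu. assert (Cmod l - B <= 0); [|lra]. apply le_all_eps. intros eps He.
destruct (Hl eps He) as [N' H]. specialize (H (Nat.max N N') ltac:(lia)).
specialize (Hu (Nat.max N N') ltac:(lia)).
generalize (Cmod_sub_ge l (u (Nat.max N N'))). rewrite Cmod_sub_sym. lra.
Qed.

Lemma Clim_lin (u v : nat -> C) (l l' c d : C) :
  Clim u l -> Clim v l' -> Clim (fun n => c * u n + d * v n)%C (c * l + d * l')%C.
Proof.
intros Hu Hv eps He.
assert (Hc := Cmod_ge_0 c). assert (Hd := Cmod_ge_0 d).
destruct (Hu (eps / 2 / (Cmod c + 1))) as [N1 H1]; [repeat apply Rdiv_lt_0_compat; lra|].
destruct (Hv (eps / 2 / (Cmod d + 1))) as [N2 H2]; [repeat apply Rdiv_lt_0_compat; lra|].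
exists (Nat.max N1 N2). intros n Hn. specialize (H1 n ltac:(lia)). specialize (H2 n ltac:(lia)).
replace (c * u n + d * v n - (c * l + d * l'))%C with (c * (u n - l) + d * (v n - l'))%C by ring.
eapply Rle_trans; [apply Cmod_triangle|]. rewrite !Cmod_mult.
assert (G1 : Cmod c * Cmod (u n - l) <= eps / 2).
{ apply Rle_trans with ((Cmod c + 1) * (eps / 2 / (Cmod c + 1))); [|right; field; lra].
  apply Rmult_le_compat; try lra. apply Cmod_ge_0. }
assert (G2 : Cmod d * Cmod (v n - l') <= eps / 2).
{ apply Rle_trans with ((Cmod d + 1) * (eps / 2 / (Cmod d + 1))); [|right; field; lra].
  apply Rmult_le_compat; try lra. apply Cmod_ge_0. }
lra.
Qed.

Lemma Clim_unique (u : nat -> C) (l l' : C) : Clim u l -> Clim u l' -> l = l'.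
Proof.
intros H H'. apply Cminus_eq_0, Cmod_eq_0. apply Rle_antisym; [|apply Cmod_ge_0].
apply le_all_eps. intros eps He.
destruct (H (eps / 2)) as [N1 H1]; [lra|]. destruct (H' (eps / 2)) as [N2 H2]; [lra|].
specialize (H1 (Nat.max N1 N2) ltac:(lia)). specialize (H2 (Nat.max N1 N2) ltac:(lia)).
eapply Rle_trans; [apply (Cmod_sub_triangle _ (u (Nat.max N1 N2)))|]. rewrite Cmod_sub_sym. lra.
Qed.

Lemma Clim_ext (u v : nat -> C) (l : C) (N : nat) :
  (forall n, (N <= n)%nat -> u n = v n) -> Clim u l -> Clim v l.
Proof.
intros E H eps He. destruct (H eps He) as [N' H']. exists (Nat.max N N'). intros n Hn.
rewrite <- E by lia. apply H'. lia.
Qed.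

Definition pprod (a : nat -> R) (n : nat) (w : C) : C := cprod (fun k => 1 - RtoC (a k) * w)%C n.

(** The derivative of [pprod a n], generated by the product rule. *)
Fixpoint dpprod (a : nat -> R) (n : nat) (w : C) : C :=
  match n with
  | O => RtoC 0
  | S n => (dpprod a n w * (1 - RtoC (a n) * w) - RtoC (a n) * pprod a n w)%C
  end.

Lemma pprod_S (a : nat -> R) (n : nat) (w : C) : pprod a (S n) w = (pprod a n w * (1 - RtoC (a n) * w))%C.
Proof. reflexivity. Qed.

Lemma factor_bound (a M : R) (w : C) : 0 <= a -> Cmod w <= M -> Cmod (1 - RtoC a * w) <= exp (a * M).
Proof.
intros Ha Hw. eapply Rle_trans; [apply Cmod_triangle|].
rewrite Cmod_opp, Cmod_1, Cmod_mult, Cmod_R, Rabs_pos_eq by exact Ha.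
eapply Rle_trans; [|apply exp_ineq1_le]. nra.
Qed.

Lemma rsum_nonneg (a : nat -> R) (n : nat) : (forall k, 0 <= a k) -> 0 <= rsum a n.
Proof. intros H. change 0 with (rsum a 0). apply rsum_mono; [exact H|lia]. Qed.

Lemma pprod_bound (a : nat -> R) (n : nat) (M : R) (w : C) : (forall k, 0 <= a k) -> Cmod w <= M ->
  Cmod (pprod a n w) <= exp (rsum a n * M).
Proof.
intros Ha Hw. induction n as [|n IH].
- unfold pprod; simpl. rewrite Cmod_1, Rmult_0_l, exp_0. lra.
- rewrite pprod_S, Cmod_mult. simpl rsum. rewrite Rmult_plus_distr_r, exp_plus.
  apply Rmult_le_compat; [apply Cmod_ge_0|apply Cmod_ge_0|exact IH|now apply factor_bound].
Qed.

Lemma dpprod_bound (a : nat -> R) (n : nat) (M : R) (w : C) : (forall k, 0 <= a k) -> Cmod w <= M ->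
  Cmod (dpprod a n w) <= rsum a n * exp (rsum a n * M).
Proof.
intros Ha Hw. assert (HM : 0 <= M) by (generalize (Cmod_ge_0 w); lra).
induction n as [|n IH].
- simpl. rewrite Cmod_0. lra.
- simpl dpprod. simpl rsum. set (s := rsum a n) in *.
  replace (exp ((s + a n) * M)) with (exp (s * M) * exp (a n * M)) by (rewrite <- exp_plus; f_equal; ring).
  assert (H1 := factor_bound (a n) M w (Ha n) Hw). assert (H2 := pprod_bound a n M w Ha Hw). fold s in H2.
  eapply Rle_trans; [apply Cmod_triangle|]. rewrite Cmod_opp, !Cmod_mult, Cmod_R, Rabs_pos_eq by apply Ha.
  assert (He : 1 <= exp (a n * M)).
  { rewrite <- exp_0. apply exp_le. apply Rmult_le_pos; [apply Ha|exact HM]. }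
  assert (Hs : 0 <= s) by now apply rsum_nonneg.
  assert (Hes := exp_pos (s * M)).
  assert (G1 : Cmod (dpprod a n w) * Cmod (1 - RtoC (a n) * w) <= s * exp (s * M) * exp (a n * M)).
  { apply Rmult_le_compat; trivial; apply Cmod_ge_0. }
  assert (G2 : a n * Cmod (pprod a n w) <= a n * (exp (s * M) * exp (a n * M))).
  { apply Rmult_le_compat_l; [apply Ha|]. nra. }
  lra.
Qed.

(** A second-order Taylor estimate whose constant involves [n] only through [rsum a n]. It therefore
    survives the passage to the limit and yields the derivative of the infinite product directly. *)
Lemma pprod_remainder (a : nat -> R) (n : nat) (M : R) (w h : C) :
  (forall k, 0 <= a k) -> Cmod w <= M -> Cmod (w + h) <= M ->
  Cmod (pprod a n (w + h) - pprod a n w - h * dpprod a n w) <=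
  rsum a n * rsum a n * exp (rsum a n * M) * (Cmod h * Cmod h).
Proof.
intros Ha Hw Hwh. assert (HM : 0 <= M) by (generalize (Cmod_ge_0 w); lra).
induction n as [|n IH].
- unfold pprod; simpl. replace (1 - 1 - h * 0)%C with (RtoC 0) by ring. rewrite Cmod_0. lra.
- rewrite !pprod_S. simpl dpprod. simpl rsum. set (s := rsum a n) in *.
  set (P := pprod a n w) in *. set (d := dpprod a n w) in *. set (Q := pprod a n (w + h)) in *.
  replace (Q * (1 - RtoC (a n) * (w + h)) - P * (1 - RtoC (a n) * w) - h * (d * (1 - RtoC (a n) * w) - RtoC (a n) * P))%C
    with ((Q - P - h * d) * (1 - RtoC (a n) * (w + h)) - RtoC (a n) * d * (h * h))%C by ring.
  assert (H1 := factor_bound (a n) M (w + h) (Ha n) Hwh).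
  assert (H2 := dpprod_bound a n M w Ha Hw). fold s d in H2.
  eapply Rle_trans; [apply Cmod_triangle|]. rewrite Cmod_opp, !Cmod_mult, Cmod_R, Rabs_pos_eq by apply Ha.
  assert (He : 1 <= exp (a n * M)).
  { rewrite <- exp_0. apply exp_le. apply Rmult_le_pos; [apply Ha|exact HM]. }
  assert (Hs : 0 <= s) by now apply rsum_nonneg.
  replace (exp ((s + a n) * M)) with (exp (s * M) * exp (a n * M)) by (rewrite <- exp_plus; f_equal; ring).
  assert (Hes := exp_pos (s * M)). set (E := exp (s * M)) in *. set (e := exp (a n * M)) in *.
  set (H := Cmod h * Cmod h) in *. assert (HH : 0 <= H) by (unfold H; generalize (Cmod_ge_0 h); nra).
  assert (G1 : Cmod (Q - P - h * d) * Cmod (1 - RtoC (a n) * (w + h)) <= s * s * E * H * e).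
  { apply Rmult_le_compat; trivial; apply Cmod_ge_0. }
  assert (Han := Ha n).
  assert (G2 : a n * Cmod d * H <= a n * (s * E * e) * H).
  { apply Rmult_le_compat_r; [exact HH|]. apply Rmult_le_compat_l; [exact Han|].
    eapply Rle_trans; [exact H2|]. assert (0 <= s * E) by nra. nra. }
  eapply Rle_trans; [apply Rplus_le_compat; [exact G1|exact G2]|].
  assert (0 <= E * e * H) by (apply Rmult_le_pos; [apply Rmult_le_pos; lra|exact HH]).
  replace ((s + a n) * (s + a n) * (E * e) * H) with (((s + a n) * (s + a n)) * (E * e * H)) by ring.
  replace (s * s * E * H * e + a n * (s * E * e) * H) with ((s * s + a n * s) * (E * e * H)) by ring.
  apply Rmult_le_compat_r; [assumption|]. nra.
Qed.

Lemma infinite_product (a : nat -> R) (S0 : R) :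
  (forall k, 0 <= a k) -> (forall n, rsum a n <= S0) ->
  exists G, entire G /\ forall w, Clim (fun n => pprod a n w) (G w).
Proof.
intros Ha HS. assert (HS0 : 0 <= S0) by (apply Rle_trans with (2 := HS O); simpl; lra).
assert (Hs : forall n, 0 <= rsum a n) by (intros; now apply rsum_nonneg).
assert (HE : forall n M, 0 <= M -> exp (rsum a n * M) <= exp (S0 * M)).
{ intros n M HM. apply exp_le. apply Rmult_le_compat_r; [exact HM|apply HS]. }
assert (HP : forall w, exists l, Clim (fun n => pprod a n w) l).
{ intros w. apply (Clim_of_increments _ a (Cmod w * exp (S0 * Cmod w)) S0); trivial.
  - apply Rmult_le_pos; [apply Cmod_ge_0|left; apply exp_pos].
  - intros n. rewrite pprod_S.
    replace (pprod a n w * (1 - RtoC (a n) * w) - pprod a n w)%C with (- (RtoC (a n) * w * pprod a n w))%C by ring.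
    rewrite Cmod_opp, !Cmod_mult, Cmod_R, Rabs_pos_eq by apply Ha.
    assert (H := pprod_bound a n (Cmod w) w Ha (Rle_refl _)).
    assert (H' := HE n (Cmod w) (Cmod_ge_0 w)).
    rewrite Rmult_comm, <- Rmult_assoc, (Rmult_comm _ (a n)), (Rmult_comm _ (a n)).
    rewrite Rmult_assoc. apply Rmult_le_compat_l; [apply Ha|]. rewrite Rmult_comm.
    apply Rmult_le_compat_l; [apply Cmod_ge_0|lra]. }
assert (HD : forall w, exists l, Clim (fun n => dpprod a n w) l).
{ intros w. set (M := Cmod w). assert (HM : 0 <= M) by apply Cmod_ge_0.
  apply (Clim_of_increments _ a (M * (S0 * exp (S0 * M)) + exp (S0 * M)) S0); trivial.
  - generalize (exp_pos (S0 * M)). intros.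
    assert (0 <= M * (S0 * exp (S0 * M))) by (apply Rmult_le_pos; [|apply Rmult_le_pos]; lra). lra.
  - intros n. simpl dpprod.
    replace (dpprod a n w * (1 - RtoC (a n) * w) - RtoC (a n) * pprod a n w - dpprod a n w)%C
      with (- (RtoC (a n) * (w * dpprod a n w + pprod a n w)))%C by ring.
    rewrite Cmod_opp, Cmod_mult, Cmod_R, Rabs_pos_eq, Rmult_comm by apply Ha.
    apply Rmult_le_compat_r; [apply Ha|]. eapply Rle_trans; [apply Cmod_triangle|].
    assert (H := pprod_bound a n M w Ha (Rle_refl _)). assert (H2 := dpprod_bound a n M w Ha (Rle_refl _)).
    assert (H' := HE n M HM). rewrite Cmod_mult. apply Rplus_le_compat; [|lra].
    apply Rmult_le_compat_l; [exact HM|]. eapply Rle_trans; [exact H2|].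
    apply Rmult_le_compat; trivial. left; apply exp_pos. }
destruct (choice _ HP) as [G HG].
exists G. split; [|exact HG].
apply entire_cdiff. intros w. destruct (HD w) as [d Hd]. exists d.
set (M := Cmod w + 1). assert (HM : 0 <= M) by (unfold M; generalize (Cmod_ge_0 w); lra).
set (B := S0 * S0 * exp (S0 * M)). assert (HB : 0 <= B).
{ unfold B. generalize (exp_pos (S0 * M)). intros. apply Rmult_le_pos; nra. }
assert (Hrem : forall h, Cmod h <= 1 -> Cmod (G (w + h)%C - G w - h * d) <= B * (Cmod h * Cmod h)).
{ intros h Hh. apply (Clim_Cmod_le (fun n => pprod a n (w + h) - pprod a n w - h * dpprod a n w)%C _ _ 0%nat).
  - assert (L1 := Clim_lin _ _ _ _ (RtoC 1) (- (1))%C (HG (w + h)%C) (HG w)).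
    assert (L2 := Clim_lin _ _ _ _ (RtoC 1) (- h)%C L1 Hd).
    replace (G (w + h)%C - G w - h * d)%C with (1 * (1 * G (w + h)%C + - (1) * G w) + - h * d)%C by ring.
    apply Clim_ext with (2 := L2) (N := 0%nat). intros n _. ring.
  - intros n _.
    assert (Hw : Cmod w <= M) by (unfold M; lra).
    assert (Hwh : Cmod (w + h) <= M) by (unfold M; generalize (Cmod_triangle w h); lra).
    eapply Rle_trans; [apply (pprod_remainder a n M w h Ha Hw Hwh)|].
    apply Rmult_le_compat_r; [generalize (Cmod_ge_0 h); nra|]. unfold B.
    assert (H1 := Hs n). assert (H2 := HS n).
    apply Rmult_le_compat; [nra|left; apply exp_pos|nra|now apply HE]. }
intros eps He. exists (Rmin 1 (eps / (B + 1))). split.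
{ apply Rmin_pos; [lra|]. apply Rdiv_lt_0_compat; lra. }
intros v Hv. set (h := (v - w)%C) in *.
assert (H1 : Cmod h <= 1) by (left; eapply Rlt_le_trans; [exact Hv|apply Rmin_l]).
assert (H2 : Cmod h <= eps / (B + 1)) by (left; eapply Rlt_le_trans; [exact Hv|apply Rmin_r]).
specialize (Hrem h H1). replace (w + h)%C with v in Hrem by (unfold h; ring).
replace (G v - G w - d * h)%C with (G v - G w - h * d)%C by ring.
eapply Rle_trans; [exact Hrem|]. rewrite <- Rmult_assoc. apply Rmult_le_compat_r; [apply Cmod_ge_0|].
apply Rle_trans with ((B + 1) * (eps / (B + 1))); [|right; field; lra].
apply Rmult_le_compat; try lra. apply Cmod_ge_0.
Qed.

(** A telescoping bound: with [q = p - 1], [q / x ^ p] is at most [(x - 1) ^ (- q) - x ^ (- q)],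
    because [(1 - 1 / x) ^ (- q) >= 1 + q / x]. *)
Lemma inv_lamp_summable (p : R) (n : nat) : 1 < p -> rsum (fun k => / lamp p k) n <= 1 + / (p - 1).
Proof.
intros Hp. set (q := p - 1). assert (Hq : 0 < q) by (unfold q; lra).
assert (H : forall j, rsum (fun k => / lamp p k) (S j) <= 1 + (1 - / Rpower (INR (S j)) q) / q).
{ induction j as [|j IH].
  - simpl rsum. unfold lamp, Rpower. change (INR 1) with 1. rewrite ln_1, !Rmult_0_r, exp_0, Rinv_1. lra.
  - change (rsum (fun k => / lamp p k) (S (S j))) with (rsum (fun k => / lamp p k) (S j) + / lamp p (S j)).
    assert (G : q * / lamp p (S j) <= / Rpower (INR (S j)) q - / Rpower (INR (S (S j))) q).
    { unfold lamp. set (x := INR (S (S j))).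
      assert (Ex : INR (S j) = x - 1) by (unfold x; rewrite (S_INR (S j)); ring).
      assert (Hx : 1 < x) by (generalize (INR_S_pos j); lra).
      rewrite Ex. rewrite <- !Rpower_Ropp.
      assert (E1 : Rpower x (- p) = Rpower x (- q) * / x).
      { replace (- p) with (- q + - (1)) by (unfold q; ring). rewrite Rpower_plus, (Rpower_Ropp x 1), Rpower_1 by lra.
        reflexivity. }
      assert (E2 : Rpower (x - 1) (- q) = Rpower x (- q) * Rpower (1 - / x) (- q)).
      { rewrite Rpower_mult_distr; [f_equal; field; lra|lra|].
        assert (/ x < 1) by (rewrite <- Rinv_1; apply Rinv_lt_contravar; lra). lra. }
      assert (E3 : 1 + q * / x <= Rpower (1 - / x) (- q)).
      { unfold Rpower. eapply Rle_trans; [|apply exp_ineq1_le].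
        assert (Hi : / x < 1) by (rewrite <- Rinv_1; apply Rinv_lt_contravar; lra).
        assert (ln (1 - / x) <= - / x).
        { rewrite <- (ln_exp (- / x)). apply ln_le; [lra|]. generalize (exp_ineq1_le (- / x)). lra. }
        nra. }
      rewrite E1, E2. assert (0 < Rpower x (- q)) by apply Rpower_pos. nra. }
    apply Rle_trans with (1 + (1 - / Rpower (INR (S j)) q) / q
      + (/ Rpower (INR (S j)) q - / Rpower (INR (S (S j))) q) / q).
    + apply Rplus_le_compat; [exact IH|]. apply Rmult_le_reg_l with q; [exact Hq|].
      eapply Rle_trans; [exact G|]. right. field. repeat split; try lra; apply Rgt_not_eq, Rpower_pos.
    + right. field. repeat split; try lra; apply Rgt_not_eq, Rpower_pos. }
destruct n as [|n].
- simpl. assert (0 < / q) by now apply Rinv_0_lt_compat. fold q. lra.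
- eapply Rle_trans; [apply H|]. fold q. apply Rplus_le_compat_l.
  apply Rle_trans with (1 * / q); [|lra].
  apply Rmult_le_compat_r; [left; now apply Rinv_0_lt_compat|].
  assert (0 < / Rpower (INR (S n)) q) by apply Rinv_0_lt_compat, Rpower_pos. lra.
Qed.

(** * A function of small type vanishing on the rays *)

Lemma cos_lipschitz (a b : R) : a <= b -> cos a - cos b <= b - a.
Proof.
intros H. rewrite form2.
replace (-2 * sin ((a - b) / 2) * sin ((a + b) / 2)) with (2 * sin ((b - a) / 2) * sin ((a + b) / 2)).
- generalize (SIN_bound ((a + b) / 2)). intros Hb.
  destruct H as [H| ->].
  + set (x := (b - a) / 2). assert (Hx : 0 < x) by (unfold x; lra).
    assert (H1 := sin_lt_x x Hx).
    assert (H2 : - x < sin x).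
    { destruct (Rlt_dec x PI) as [Hp|Hp].
      - generalize (sin_gt_0 x Hx Hp). lra.
      - generalize (SIN_bound x) PI2_1. intros. unfold PI2 in *. lra. }
    assert (2 * sin x * sin ((a + b) / 2) <= 2 * x); [|unfold x in *; lra].
    set (s := sin x) in *. set (t := sin ((a + b) / 2)) in *. nra.
  + replace ((b - b) / 2) with 0 by field. rewrite sin_0. lra.
- replace ((b - a) / 2) with (- ((a - b) / 2)) by field. rewrite sin_neg. ring.
Qed.

Lemma rpow_ge_0 (x t : R) : 0 <= rpow x t.
Proof. unfold rpow. destruct (Rlt_dec 0 x); [left; apply Rpower_pos|lra]. Qed.

Lemma rpow_le (x y t : R) : 0 < t -> x <= y -> 0 < y -> rpow x t <= Rpower y t.
Proof.
intros Ht Hxy Hy. unfold rpow. destruct (Rlt_dec 0 x) as [Hx|Hx]; [|left; apply Rpower_pos].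
destruct Hxy as [Hxy| ->]; [|lra]. left. apply Rpower_lt_l; lra.
Qed.

Lemma rpow_pos_eq (x t : R) : 0 < x -> rpow x t = Rpower x t.
Proof. intros Hx. unfold rpow. destruct (Rlt_dec 0 x); [reflexivity|lra]. Qed.

Lemma Cmod_factor_le (r psi phi l : R) :
  0 < r -> 0 < l -> 0 <= phi < PI -> cos psi <= cos phi ->
  Cmod (1 - RtoC (/ l) * - ((r * cos psi)%R, (r * sin psi)%R)) <=
  exp (ln (1 + 2 * cos phi * (r / l) + r / l * (r / l)) / 2).
Proof.
intros Hr Hl Hphi Hc. set (y := r / l). assert (Hy : 0 < y) by (apply Rdiv_lt_0_compat; assumption).
assert (Q := quad_pos phi y Hphi Hy). set (q := 1 + 2 * cos phi * y + y * y) in *.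
apply Rsqr_incr_0; [|apply Cmod_ge_0|left; apply exp_pos].
unfold Rsqr. rewrite <- exp_plus. replace (ln q / 2 + ln q / 2) with (ln q) by field.
rewrite exp_ln by exact Q.
replace (1 - RtoC (/ l) * - ((r * cos psi)%R, (r * sin psi)%R))%C with (((1 + y * cos psi)%R, (y * sin psi)%R) : C)
  by (unfold y, Rdiv, Cminus, Cmult, Cplus, Copp, RtoC; simpl; f_equal; ring).
assert (E : Cmod (1 + y * cos psi, y * sin psi) ^ 2 = 1 + 2 * cos psi * y + y * y).
{ rewrite Cmod2_alt. unfold Re, Im; simpl. generalize (sin2_cos2 psi). unfold Rsqr. intros Hs.
  transitivity (1 + 2 * cos psi * y + y * y * (sin psi * sin psi + cos psi * cos psi)); [ring|].
  rewrite Hs. ring. }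
simpl in E. rewrite Rmult_1_r in E. rewrite E. unfold q. nra.
Qed.

(** The angle [psi] is measured from the ray opposite to the zeros. Close to the zeros it is
    replaced by [PI - eta]: a smaller angle only enlarges every factor, and since the cosine is
    Lipschitz this raises the indicator by at most [delta / 2]. The logarithmic singularities are
    thereby avoided. *)
Lemma product_growth (tau A S0 : R) (G : C -> C) : 0 < tau < 1 -> 0 < A ->
  (forall a b, a <= 0 <= b -> Aint tau a b <= A) ->
  (forall delta, 0 < delta -> exists X, 0 < X /\ forall a b, a <= - X -> X <= b -> A - delta <= Aint tau a b) ->
  (forall n, rsum (fun k => / lamp (/ tau) k) n <= S0) ->
  (forall w, Clim (fun n => pprod (fun k => / lamp (/ tau) k) n w) (G w)) ->
  forall delta, 0 < delta -> exists C0, forall w psi, - PI <= psi <= PI ->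
    (- w)%C = (Cmod w * cos psi, Cmod w * sin psi) ->
    Cmod (G w) <= exp ((A * cos (tau * psi) + delta) * rpow (Cmod w) tau + C0).
Proof.
intros Ht HA HA1 HA2 HS HG delta Hd. generalize PI_RGT_0; intros HPI.
assert (Ha : forall k, 0 <= / lamp (/ tau) k).
{ intros k. left. apply Rinv_0_lt_compat, lamp_pos. }
assert (HS0 : 0 <= S0) by (apply Rle_trans with (2 := HS O); simpl; lra).
set (eta := Rmin (PI / 4) (delta / 2 / A)).
assert (He0 : 0 < eta) by (apply Rmin_pos; [lra|repeat apply Rdiv_lt_0_compat; lra]).
assert (He1 : eta <= PI / 4) by apply Rmin_l.
assert (He2 : A * eta <= delta / 2).
{ apply Rle_trans with (A * (delta / 2 / A)); [|right; field; lra].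
  apply Rmult_le_compat_l; [lra|apply Rmin_r]. }
destruct (rsum_ell_upper tau A Ht HA1 HA2 eta (delta / 2)) as [C1 [X [HX H]]]; [lra|lra|].
(* For [Cmod w < X], the term [S0 * X] bounds the product crudely, and [A * Rpower X tau] makes up
   for an indicator that may be negative. *)
exists (Rabs C1 + S0 * X + A * Rpower X tau). intros w psi Hpsi Ew.
assert (Hw := Cmod_ge_0 w). assert (HrX := Rpower_pos X tau).
assert (Hrp := rpow_ge_0 (Cmod w) tau).
assert (Hcos := COS_bound (tau * psi)).
destruct (Rlt_dec (Cmod w) X) as [Hlt|Hge].
- apply Rle_trans with (exp (S0 * X)).
  + apply (Clim_Cmod_le _ _ _ 0%nat (HG w)). intros n _.
    eapply Rle_trans; [apply (pprod_bound _ n X w Ha); lra|].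
    apply exp_le. apply Rmult_le_compat_r; [lra|apply HS].
  + apply exp_le. assert (Hr := rpow_le (Cmod w) X tau ltac:(lra) ltac:(lra) ltac:(lra)).
    pose proof (Rabs_pos C1).
    assert (- (A * Rpower X tau) <= (A * cos (tau * psi) + delta) * rpow (Cmod w) tau); [|lra].
    assert (- A <= A * cos (tau * psi) + delta) by nra.
    apply Rle_trans with (- A * rpow (Cmod w) tau); [nra|]. apply Rmult_le_compat_r; lra.
- set (r := Cmod w) in *. assert (Hr0 : 0 < r) by lra.
  rewrite rpow_pos_eq by exact Hr0.
  destruct (H r ltac:(lra)) as [n0 Hn0].
  set (phi := Rmin (Rabs psi) (PI - eta)).
  assert (Hpa : 0 <= Rabs psi <= PI) by (split; [apply Rabs_pos|apply Rabs_le; lra]).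
  assert (Hphi : 0 <= phi <= PI - eta) by (split; [apply Rmin_glb; lra|apply Rmin_r]).
  assert (Hphi2 : phi <= Rabs psi) by apply Rmin_l.
  assert (Hphi3 : Rabs psi <= phi + eta).
  { unfold phi. apply Rmin_case_strong; lra. }
  assert (Eabs : forall t, cos (t * psi) = cos (t * Rabs psi)).
  { intros t. unfold Rabs. destruct (Rcase_abs psi); [|reflexivity].
    rewrite <- cos_neg. f_equal. ring. }
  assert (Hc1 : cos psi <= cos phi).
  { assert (E := Eabs 1). rewrite !Rmult_1_l in E. rewrite E. apply cos_decr_1; lra. }
  assert (Hc2 : A * cos (tau * phi) <= A * cos (tau * psi) + delta / 2).
  { rewrite Eabs. assert (L := cos_lipschitz (tau * phi) (tau * Rabs psi)).
    assert (L' := L ltac:(apply Rmult_le_compat_l; lra)).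
    assert (cos (tau * phi) - cos (tau * Rabs psi) <= eta) by nra. nra. }
  apply (Clim_Cmod_le _ _ _ n0 (HG w)). intros n Hn.
  apply Rle_trans with (exp (rsum (fun k => ell phi (snode tau r k)) n)).
  + assert (E : w = (- ((r * cos psi)%R, (r * sin psi)%R))%C) by (rewrite <- Ew; ring).
    clear Hn. induction n as [|n IH].
    * unfold pprod; simpl. rewrite Cmod_1, exp_0. lra.
    * rewrite pprod_S, Cmod_mult. simpl rsum. rewrite exp_plus.
      apply Rmult_le_compat; [apply Cmod_ge_0|apply Cmod_ge_0|exact IH|].
      rewrite E. unfold ell. rewrite exp_snode by exact Hr0.
      apply Cmod_factor_le; [exact Hr0|apply lamp_pos|lra|exact Hc1].
  + apply exp_le. eapply Rle_trans; [apply (Hn0 n phi Hn Hphi)|].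
    pose proof (Rle_abs C1). assert (0 <= S0 * X) by (apply Rmult_le_pos; lra).
    assert (0 <= A * Rpower X tau) by (apply Rmult_le_pos; lra).
    assert ((A * cos (tau * phi) + delta / 2) * Rpower r tau <= (A * cos (tau * psi) + delta) * Rpower r tau).
    { apply Rmult_le_compat_r; [left; apply Rpower_pos|lra]. }
    lra.
Qed.

Lemma opposite_angle (psi : R) : - PI <= psi <= PI -> exists psi', - PI <= psi' <= PI /\
  cos psi' = - cos psi /\ sin psi' = - sin psi /\ forall t, cos (t * psi') = cos (t * (PI - Rabs psi)).
Proof.
intros H. destruct (Rle_dec 0 psi) as [H0|H0].
- exists (psi - PI). rewrite Rabs_pos_eq by exact H0. split; [lra|].
  rewrite cos_minus, sin_minus, cos_PI, sin_PI. split; [ring|split; [ring|]].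
  intros t. rewrite <- cos_neg. f_equal. ring.
- exists (psi + PI). rewrite Rabs_left by lra. split; [lra|].
  rewrite neg_cos, neg_sin. split; [reflexivity|split; [reflexivity|]].
  intros t. f_equal. ring.
Qed.

(* With [c = - cos (pi tau)] the sum of the two indicators collapses to a single
   sine of amplitude [sin (pi tau)]. *)
Lemma indicator_sum_le (tau u : R) : 0 <= sin (PI * tau) ->
  cos (tau * u) + - cos (PI * tau) * cos (tau * (PI - u)) <= sin (PI * tau).
Proof.
intros Hs.
assert (E : cos (tau * u) + - cos (PI * tau) * cos (tau * (PI - u)) = sin (PI * tau) * sin (tau * (PI - u))).
{ replace (tau * u) with (PI * tau - tau * (PI - u)) by ring. rewrite cos_minus. ring. }
rewrite E. generalize (SIN_bound (tau * (PI - u))). nra.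
Qed.

Lemma ray_set_vanishes (m : nat) (p : R) (D : C -> C) :
  (0 < m)%nat -> entire D ->
  (forall k, exists H, entire H /\ forall z, D z = ((1 - z ^ m / RtoC (lamp p k)) * H z)%C) ->
  vanishes_on D (ray_set m p).
Proof.
intros Hm HD Hk z. unfold ray_set. destruct (excluded_middle_informative _) as [[k Ek]|_].
- destruct (Hk k) as [H [HH EH]].
  assert (Hl : RtoC (lamp p k) <> RtoC 0).
  { intros E. apply RtoC_inj in E. generalize (lamp_pos p k). lra. }
  destruct m as [|m]; [lia|]. destruct (pow_minus_factor m z) as [s [Hs [_ Es]]].
  exists (fun w => - / RtoC (lamp p k) * s w * H w)%C. split.
  + apply entire_cdiff. intros w. apply cdiff_mult; [|now apply entire_cdiff].
    apply cdiff_mult; [apply cdiff_const|apply Hs].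
  + intros w. rewrite EH. simpl (_ ^ 1)%C. rewrite Cmult_1_r.
    replace ((w - z) * (- / RtoC (lamp p k) * s w * H w))%C
      with (- / RtoC (lamp p k) * ((w - z) * s w) * H w)%C by ring.
    rewrite <- Es, Ek. field. exact Hl.
- exists D. split; [exact HD|]. intros w. simpl. ring.
Qed.

(** Replacing [a j] by 0 turns the factor with index [j] into 1 and preserves the bound [S0]; [H] is
    the product so obtained. *)
Lemma infinite_product_factor (a : nat -> R) (S0 : R) (G : C -> C) (j : nat) :
  (forall k, 0 <= a k) -> (forall n, rsum a n <= S0) ->
  (forall w, Clim (fun n => pprod a n w) (G w)) ->
  exists H, entire H /\ forall w, G w = ((1 - RtoC (a j) * w) * H w)%C.
Proof.
intros Ha HS HG.
set (b k := if Nat.eq_dec k j then 0 else a k).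
destruct (infinite_product b S0) as [H [HH Hl]].
- intros k. unfold b. destruct (Nat.eq_dec k j); [lra|apply Ha].
- intros n. eapply Rle_trans; [|apply (HS n)]. apply rsum_le. intros k _. unfold b.
  destruct (Nat.eq_dec k j); [apply Ha|lra].
- exists H. split; [exact HH|]. intros w. apply (Clim_unique _ _ _ (HG w)).
  assert (L := Clim_lin _ _ _ _ (1 - RtoC (a j) * w)%C (RtoC 0) (Hl w) (Hl w)).
  replace ((1 - RtoC (a j) * w) * H w)%C with ((1 - RtoC (a j) * w) * H w + 0 * H w)%C by ring.
  apply Clim_ext with (2 := L) (N := S j). intros n Hn.
  assert (E1 : forall i, (i <= j)%nat -> pprod b i w = pprod a i w).
  { induction i as [|i IH]; intros Hi; [reflexivity|]. rewrite !pprod_S, IH by lia.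
    unfold b. destruct (Nat.eq_dec i j); [lia|reflexivity]. }
  assert (E2 : forall i, pprod a (S j + i) w = ((1 - RtoC (a j) * w) * pprod b (S j + i) w)%C).
  { induction i as [|i IH].
    - rewrite Nat.add_0_r, !pprod_S, E1 by lia. unfold b. destruct (Nat.eq_dec j j); [ring|lia].
    - rewrite Nat.add_succ_r, (pprod_S a), (pprod_S b), IH. unfold b.
      destruct (Nat.eq_dec (S j + i) j); [lia|ring]. }
  replace n with (S j + (n - S j))%nat by lia. rewrite E2. ring.
Qed.

Lemma annihilator_exists (tau rho A : R) (m : nat) :
  1 / 2 < tau < 1 -> (0 < m)%nat -> rho = INR m * tau -> 0 < A ->
  (forall a b, a <= 0 <= b -> Aint tau a b <= A) ->
  (forall delta, 0 < delta -> exists X, 0 < X /\ forall a b, a <= - X -> X <= b -> A - delta <= Aint tau a b) ->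
  exists s f, 0 <= s < A /\ class_E rho s f /\ f (RtoC 0) <> RtoC 0 /\ vanishes_on f (ray_set m (/ tau)).
Proof.
intros Ht Hm Hrho HA HA1 HA2. generalize PI_RGT_0; intros HPI.
assert (Hm' := lt_0_INR m Hm).
assert (Hp : 1 < / tau) by (rewrite <- Rinv_1; apply Rinv_lt_contravar; lra).
set (a k := / lamp (/ tau) k). set (S0 := 1 + / (/ tau - 1)).
assert (Ha : forall k, 0 <= a k) by (intros k; left; apply Rinv_0_lt_compat, lamp_pos).
assert (HS : forall n, rsum a n <= S0) by (intros n; now apply inv_lamp_summable).
destruct (infinite_product a S0 Ha HS) as [G [HG HGl]].
set (c := - cos (PI * tau)).
assert (Hc : 0 < c).
{ unfold c. assert (cos (PI * tau) < 0); [|lra]. apply cos_lt_0; nra. }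
set (s0 := sin (PI * tau)).
(* Strictness holds because [cos (PI * tau)] is nonzero, thanks to [1 / 2 < tau]. The gap between
   the two types originates here. *)
assert (Hs0 : 0 <= s0 < 1).
{ split; [apply sin_ge_0; nra|]. unfold s0. generalize (sin2_cos2 (PI * tau)) (SIN_bound (PI * tau)).
  unfold Rsqr, c in *. nra. }
set (c' := Rpower c (/ tau)). assert (Hc' : 0 < c') by apply Rpower_pos.
assert (Hc't : Rpower c' tau = c).
{ unfold c'. rewrite Rpower_mult, Rinv_l by lra. now apply Rpower_1. }
(* Midway between [A * s0] and [A]. The difference to [A * s0] is shared out as [delta], spent once
   on the first factor and [c] times on the second. *)
set (s := A * (1 + s0) / 2).
set (delta := A * (1 - s0) / 2 / (1 + c)).
assert (Hdelta : 0 < delta) by (apply Rdiv_lt_0_compat; nra).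
assert (Es : A * s0 + (1 + c) * delta = s) by (unfold s, delta; field; lra).
destruct (product_growth tau A S0 G) with (delta := delta) as [C0 HC0]; try assumption; [lra|].
exists s, (fun z => G (z ^ m) * G (- RtoC c' * z ^ m))%C.
assert (D1 : forall H, entire H -> entire (fun z => H (z ^ m))%C).
{ intros H HH. apply entire_cdiff. intros z. apply (cdiff_comp H (fun z => z ^ m)%C).
  - now apply entire_cdiff.
  - apply cdiff_pow, cdiff_id. }
assert (D2 : forall H e, entire H -> entire (fun z => H (e * z ^ m))%C).
{ intros H e HH. apply entire_cdiff. intros z. apply (cdiff_comp H (fun z => e * z ^ m)%C).
  - now apply entire_cdiff.
  - apply cdiff_mult; [apply cdiff_const|apply cdiff_pow, cdiff_id]. }
assert (D3 : forall H H', entire H -> entire H' -> entire (fun z => H z * H' z)%C).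
{ intros H H' HH HH'. apply entire_cdiff. intros z. apply cdiff_mult; now apply entire_cdiff. }
assert (Ent : entire (fun z => G (z ^ m) * G (- RtoC c' * z ^ m))%C) by (apply D3; auto).
assert (Hs : 0 <= s < A) by (unfold s; nra).
split; [exact Hs|split; [split; [exact Ent|]|split]].
- intros eps Heps. exists (exp (2 * C0)). intros z.
  set (w := (z ^ m)%C). set (r := Cmod w).
  destruct (polar (- w)) as [psi [Hpsi Ew]]. rewrite Cmod_opp in Ew.
  destruct (opposite_angle psi Hpsi) as [psi' [Hpsi' [Ec [Esn Et]]]].
  assert (B1 := HC0 w psi Hpsi Ew).
  set (w' := (- RtoC c' * w)%C).
  assert (Mw' : Cmod w' = c' * r).
  { unfold w'. rewrite Cmod_mult, Cmod_opp, Cmod_R, Rabs_pos_eq by lra. reflexivity. }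
  assert (B2 := HC0 w' psi' Hpsi').
  assert (Ew' : (- w')%C = (Cmod w' * cos psi', Cmod w' * sin psi')).
  { rewrite Mw', Ec, Esn. unfold w'. replace (- (- RtoC c' * w))%C with (- RtoC c' * - w)%C by ring.
    rewrite Ew. fold r. unfold Cmult, Copp, RtoC; simpl. f_equal; ring. }
  specialize (B2 Ew'). rewrite Et in B2.
  assert (Ea : cos (tau * psi) = cos (tau * Rabs psi)).
  { unfold Rabs. destruct (Rcase_abs psi); [|reflexivity]. rewrite <- cos_neg. f_equal. ring. }
  rewrite Ea in B1. fold r in B1. rewrite Mw' in B2.
  assert (Hrr : rpow (c' * r) tau = c * rpow r tau).
  { unfold rpow. destruct (Rlt_dec 0 r) as [Hr|Hr].
    - destruct (Rlt_dec 0 (c' * r)) as [_|N]; [|elim N; now apply Rmult_lt_0_compat].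
      rewrite <- Rpower_mult_distr by assumption. now rewrite Hc't.
    - assert (Hr0 : r = 0) by (assert (0 <= r) by apply Cmod_ge_0; lra). rewrite Hr0, Rmult_0_r.
      destruct (Rlt_dec 0 0); [lra|ring]. }
  rewrite Hrr in B2.
  assert (Hrho' : rpow r tau = rpow (Cmod z) rho).
  { unfold r, w. rewrite Cmod_pow. assert (Hz := Cmod_ge_0 z). unfold rpow.
    destruct (Rlt_dec 0 (Cmod z)) as [Hz0|Hz0].
    - destruct (Rlt_dec 0 (Cmod z ^ m)) as [_|N]; [|elim N; now apply pow_lt].
      rewrite <- Rpower_pow by exact Hz0. rewrite Rpower_mult. now rewrite Hrho.
    - replace (Cmod z) with 0 by lra. rewrite pow_i by exact Hm. destruct (Rlt_dec 0 0); [lra|reflexivity]. }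
  rewrite <- Hrho'. rewrite Cmod_mult.
  set (R0 := rpow r tau) in *. assert (HR0 : 0 <= R0) by apply rpow_ge_0.
  apply Rle_trans with (exp ((A * cos (tau * Rabs psi) + delta) * R0 + C0)
    * exp ((A * cos (tau * (PI - Rabs psi)) + delta) * (c * R0) + C0)).
  { apply Rmult_le_compat; [apply Cmod_ge_0|apply Cmod_ge_0|exact B1|exact B2]. }
  rewrite <- !exp_plus. apply exp_le.
  assert (I := indicator_sum_le tau (Rabs psi) (proj1 Hs0)). fold s0 c in I.
  set (x1 := cos (tau * Rabs psi)) in *. set (x2 := cos (tau * (PI - Rabs psi))) in *.
  assert (I2 : A * (x1 + c * x2) <= A * s0) by (apply Rmult_le_compat_l; lra).
  assert (I3 : (A * (x1 + c * x2) + (1 + c) * delta) * R0 <= (s + eps) * R0).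
  { apply Rmult_le_compat_r; [exact HR0|]. lra. }
  lra.
- assert (G0 : G (RtoC 0) = RtoC 1).
  { apply (Clim_unique (fun n => pprod a n (RtoC 0))); [apply HGl|].
    intros e He. exists 0%nat. intros n _.
    assert (E : pprod a n (RtoC 0) = RtoC 1).
    { clear. induction n as [|n IH]; [reflexivity|]. rewrite pprod_S, IH. ring. }
    rewrite E. replace (1 - 1)%C with (RtoC 0) by ring. rewrite Cmod_0. lra. }
  assert (Z : (0 ^ m)%C = RtoC 0) by (destruct m; [lia|simpl; ring]).
  rewrite Z, Cmult_0_r, G0. intros E. 
  replace (1 * 1)%C with (RtoC 1) in E by ring. apply RtoC_inj in E. lra.
- apply ray_set_vanishes; [exact Hm|exact Ent|]. intros k.
  destruct (infinite_product_factor a S0 G k Ha HS HGl) as [H [HH EH]].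
  exists (fun z => H (z ^ m) * G (- RtoC c' * z ^ m))%C. split; [apply D3; auto|].
  intros z. rewrite (EH (z ^ m)%C). unfold a. rewrite RtoC_inv by (generalize (lamp_pos (/ tau) k); lra).
  unfold Cdiv. ring.
Qed.

(** * Regularity of the rays *)

Definition ray_point (m : nat) (p : R) (k j : nat) : C :=
  (RtoC (Rpower (lamp p k) (/ INR m)) * omega m ^ j)%C.

Lemma Cmod_ray_point (m : nat) (p : R) (k j : nat) :
  Cmod (ray_point m p k j) = Rpower (lamp p k) (/ INR m).
Proof.
unfold ray_point. rewrite Cmod_mult, Cmod_pow, Cmod_omega, pow1, Rmult_1_r, Cmod_R.
apply Rabs_pos_eq. left; apply Rpower_pos.
Qed.

Lemma ray_point_pow (m : nat) (p : R) (k j : nat) : (0 < m)%nat ->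
  (ray_point m p k j ^ m)%C = RtoC (lamp p k).
Proof.
intros Hm. unfold ray_point. rewrite Cmult_comm, omega_mult_pow by exact Hm.
rewrite <- RtoC_pow, Rpower_root_pow; [reflexivity|exact Hm|apply lamp_pos].
Qed.

Lemma ray_point_complete (m : nat) (p : R) (k : nat) (z : C) : (0 < m)%nat ->
  (z ^ m)%C = RtoC (lamp p k) -> exists j, (j < m)%nat /\ z = ray_point m p k j.
Proof.
intros Hm E. set (r := Rpower (lamp p k) (/ INR m)).
assert (Hr : RtoC r <> RtoC 0).
{ intros E1. apply RtoC_inj in E1. generalize (Rpower_pos (lamp p k) (/ INR m)). fold r. lra. }
destruct (unity_root m (z / RtoC r) Hm) as [j [Hj Ej]].
- unfold Cdiv. rewrite Cpow_mult_l, Cpow_inv, E by exact Hr. unfold r.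
  rewrite <- RtoC_pow, Rpower_root_pow by (exact Hm || apply lamp_pos). apply Cinv_r.
  intros E1. apply RtoC_inj in E1. generalize (lamp_pos p k). lra.
- exists j. split; [exact Hj|]. unfold ray_point. fold r. rewrite <- Ej. field. exact Hr.
Qed.

Lemma omega_pow_eq_1 (m d : nat) : (d < m)%nat -> (omega m ^ d)%C = RtoC 1 -> d = 0%nat.
Proof.
intros Hd E. rewrite omega_pow in E. apply cexp_im_eq_1 in E. destruct E as [k Hk].
assert (Hm : 0 < INR m) by (apply lt_0_INR; lia). generalize PI_RGT_0; intros HPI.
assert (E : INR d = INR m * IZR k).
{ apply Rmult_eq_reg_l with (2 * PI / INR m); [|apply Rgt_not_eq, Rdiv_lt_0_compat; lra].
  replace (2 * PI / INR m * INR d) with (2 * PI * INR d / INR m) by (unfold Rdiv; ring).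
  rewrite Hk. field. lra. }
rewrite !INR_IZR_INZ, <- mult_IZR in E. apply eq_IZR in E.
assert (Hk0 : (k = 0)%Z) by nia. subst k. lia.
Qed.

Lemma omega_pow_inj (m i j : nat) : (i < m)%nat -> (j < m)%nat -> (omega m ^ i)%C = (omega m ^ j)%C -> i = j.
Proof.
assert (H : forall i d, (i + d < m)%nat -> (omega m ^ i)%C = (omega m ^ (i + d))%C -> d = 0%nat).
{ intros a d Hd E. apply (omega_pow_eq_1 m); [lia|].
  assert (Ha : (omega m ^ a)%C <> RtoC 0) by apply Cpow_nz, cexp_neq_0.
  rewrite Cpow_add_r in E.
  replace (omega m ^ d)%C with (/ (omega m ^ a) * (omega m ^ a * omega m ^ d))%C by (field; exact Ha).
  rewrite <- E. field. exact Ha. }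
intros Hi Hj E. destruct (Nat.le_ge_cases i j) as [L|L].
- assert (G := H i (j - i)%nat). replace (i + (j - i))%nat with j in G by lia. specialize (G Hj E). lia.
- assert (G := H j (i - j)%nat). replace (j + (i - j))%nat with i in G by lia. specialize (G Hi (eq_sym E)). lia.
Qed.

Lemma ray_point_inj (m : nat) (p : R) (k k' j j' : nat) : 0 < p -> (j < m)%nat -> (j' < m)%nat ->
  ray_point m p k j = ray_point m p k' j' -> k = k' /\ j = j'.
Proof.
intros Hp Hj Hj' E. assert (Hm : (0 < m)%nat) by lia.
assert (Ek : k = k').
{ apply (lamp_inj p k k' Hp). apply RtoC_inj. rewrite <- (ray_point_pow m p k j), <- (ray_point_pow m p k' j') by exact Hm.
  now rewrite E. }
split; [exact Ek|]. subst k'. apply (omega_pow_inj m); trivial.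
unfold ray_point in E. set (r := RtoC (Rpower (lamp p k) (/ INR m))) in *.
assert (Hr : r <> RtoC 0).
{ intros E1. apply RtoC_inj in E1. generalize (Rpower_pos (lamp p k) (/ INR m)). lra. }
replace (omega m ^ j)%C with (/ r * (r * omega m ^ j))%C by (field; exact Hr).
rewrite E. field. exact Hr.
Qed.

(** An explicit enumeration. The list [enum] is only specified up to order, and is compared with
    this one as duplicate-free lists with the same elements. *)
Definition ray_list (m : nat) (p : R) (N : nat) (J : list nat) : list C :=
  map (fun q => ray_point m p (fst q) (snd q)) (list_prod (seq 0 N) J).

Lemma ray_list_In (m : nat) (p : R) (N : nat) (J : list nat) (z : C) :
  In z (ray_list m p N J) <-> exists k j, (k < N)%nat /\ In j J /\ z = ray_point m p k j.
Proof.
unfold ray_list. rewrite in_map_iff. split.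
- intros [[k j] [E H]]. apply in_prod_iff in H. rewrite in_seq in H. exists k, j.
  split; [lia|]. split; [tauto|now symmetry].
- intros [k [j [Hk [Hj E]]]]. exists (k, j). split; [now symmetry|]. apply in_prod_iff. rewrite in_seq.
  split; [lia|exact Hj].
Qed.

Lemma NoDup_map_inj {A B : Type} (f : A -> B) (l : list A) :
  (forall x y, In x l -> In y l -> f x = f y -> x = y) -> NoDup l -> NoDup (map f l).
Proof.
intros H Hl. induction Hl as [|x l Hx Hl IH]; simpl; [constructor|].
constructor.
- intros Hin. apply in_map_iff in Hin. destruct Hin as [y [E Hy]].
  apply Hx. rewrite <- (H y x); [exact Hy|now right|now left|exact E].
- apply IH. intros a b Ha Hb. apply H; now right.
Qed.

Lemma NoDup_list_prod {A B : Type} (l : list A) (l' : list B) :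
  NoDup l -> NoDup l' -> NoDup (list_prod l l').
Proof.
intros Hl Hl'. induction Hl as [|x l Hx Hl IH]; simpl; [constructor|].
apply NoDup_app; [apply NoDup_map_inj; [congruence|exact Hl']|exact IH|].
intros [a b] H1 H2. apply in_map_iff in H1. destruct H1 as [y [E _]]. inversion E; subst.
apply in_prod_iff in H2. tauto.
Qed.

Lemma ray_list_NoDup (m : nat) (p : R) (N : nat) (J : list nat) :
  0 < p -> NoDup J -> (forall j, In j J -> (j < m)%nat) -> NoDup (ray_list m p N J).
Proof.
intros Hp HJ Hm. apply NoDup_map_inj; [|apply NoDup_list_prod; [apply seq_NoDup|exact HJ]].
intros [k j] [k' j'] H1 H2 E. simpl in E. apply in_prod_iff in H1, H2.
destruct (ray_point_inj m p k k' j j' Hp) as [-> ->]; auto; apply Hm; tauto.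
Qed.

Lemma lamp_ge (p : R) (k : nat) : 1 <= p -> INR (S k) <= lamp p k.
Proof.
intros Hp. apply Rpower_ge_self; [|exact Hp]. change 1 with (INR 1). apply le_INR. lia.
Qed.

Lemma ray_set_discrete (m : nat) (p : R) : (0 < m)%nat -> 1 <= p -> discrete_mset (ray_set m p).
Proof.
intros Hm Hp r.
destruct (nfloor_ex (Rabs r ^ m)) as [N HN]; [apply pow_le, Rabs_pos|].
exists (ray_list m p (S N) (seq 0 m)). intros z Hz Hne.
apply ray_set_neq_0 in Hne. destruct Hne as [k Hk].
destruct (ray_point_complete m p k z Hm Hk) as [j [Hj Ez]].
apply ray_list_In. exists k, j. split; [|split; [apply in_seq; lia|exact Ez]].
assert (H : INR (S k) <= Rabs r ^ m).
{ eapply Rle_trans; [apply (lamp_ge p); exact Hp|]. apply (f_equal Cmod) in Hk.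
  rewrite Cmod_R, Rabs_pos_eq in Hk by (left; apply lamp_pos). rewrite <- Hk, Cmod_pow.
  apply pow_incr. split; [apply Cmod_ge_0|]. pose proof (Rle_abs r). lra. }
apply INR_lt. rewrite S_INR in *. lra.
Qed.

(** Because the inequality [INR (S k) < x] is strict, the count is [x - 1] when [x] is an integer
    and the integer part of [x] otherwise. *)
Lemma count_below (x : R) : 0 < x -> exists N, (forall k, INR (S k) < x <-> (k < N)%nat) /\ x - 1 <= INR N <= x.
Proof.
intros Hx. destruct (nfloor_ex x) as [n [Hn1 Hn2]]; [lra|].
destruct Hn1 as [Hn1|Hn1].
- exists n. split; [|lra]. intros k. split; intros H.
  + assert (INR (S k) < INR (S n)) by (rewrite (S_INR n); lra).
    apply INR_lt in H0. lia.
  + apply Rle_lt_trans with (INR n); [apply le_INR; lia|exact Hn1].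
- destruct n as [|n]; [simpl in Hn1; lra|]. exists n. rewrite S_INR in *. split; [|lra].
  intros k. rewrite <- Hn1, <- S_INR. split; intros H.
  + apply INR_lt in H. lia.
  + apply lt_INR. lia.
Qed.

Lemma in_sector_scale (alpha beta t : R) (u : C) : 0 < t ->
  in_sector alpha beta (RtoC t * u) <-> in_sector alpha beta u.
Proof.
intros Ht. unfold in_sector.
assert (Ht' : RtoC t <> RtoC 0) by (intros E; apply RtoC_inj in E; lra).
assert (E : Cmod (RtoC t * u) = t * Cmod u).
{ rewrite Cmod_mult, Cmod_R, Rabs_pos_eq by lra. reflexivity. }
rewrite E. split; intros [Hne [th [Hth Eu]]]; (split; [|exists th; split; [exact Hth|]]).
- intros E1. apply Hne. rewrite E1. ring.
- replace u with (RtoC (/ t) * (RtoC t * u))%C by (rewrite RtoC_inv by lra; field; exact Ht').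
  rewrite Eu. rewrite Cmod_mult, Cmod_R, (Rabs_pos_eq (/ t)) by (left; now apply Rinv_0_lt_compat).
  assert (E2 : Cmod (t * Cmod u * cos th, t * Cmod u * sin th) = t * Cmod u).
  { apply Cmod_pair_polar. apply Rmult_le_pos; [lra|apply Cmod_ge_0]. }
  rewrite E2. unfold Cmult, RtoC; simpl. f_equal; field; lra.
- now apply Cmult_neq_0.
- rewrite Eu at 1. unfold Cmult, RtoC; simpl. f_equal; ring.
Qed.

Lemma list_sum_ones (L : C -> nat) (l : list C) : (forall z, In z l -> L z = 1%nat) ->
  list_sum (map L l) = length l.
Proof.
induction l as [|z l IH]; intros H; [reflexivity|]. simpl.
rewrite (H z) by now left. simpl. f_equal. apply IH. intros w Hw. apply H. now right.
Qed.

Lemma ray_set_density (m : nat) (p rho : R) :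
  (0 < m)%nat -> 1 <= p -> rho * p = INR m -> has_angular_density rho (ray_set m p).
Proof.
intros Hm Hp Hrho. assert (Hm' := lt_0_INR m Hm).
assert (Hrho0 : 0 < rho) by nra.
exists (fun _ => 0). intros alpha beta _ _ _.
(* Each ray lies wholly inside or wholly outside the sector, as decided by its direction
   [omega m ^ j]. The count is thus the number [N] of admissible radii times the number of selected
   rays. *)
set (t j := if excluded_middle_informative (in_sector alpha beta (omega m ^ j)) then true else false).
set (J := filter t (seq 0 m)).
assert (HJ : forall j, In j J <-> (j < m)%nat /\ in_sector alpha beta (omega m ^ j)).
{ intros j. unfold J. rewrite filter_In, in_seq. unfold t.
  destruct (excluded_middle_informative _) as [H|H]; split; intros [H1 H2]; try easy; split; (lia || trivial). }
assert (Hcount : forall r, 0 < r -> exists N, n_sector (ray_set m p) r alpha beta = (N * length J)%nat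
  /\ Rpower r rho - 1 <= INR N <= Rpower r rho).
{ intros r Hr. destruct (count_below (Rpower r rho) (Rpower_pos _ _)) as [N [HN HNx]].
  exists N. split; [|exact HNx].
  assert (Hlt : forall k, Rpower (lamp p k) (/ INR m) < r <-> (k < N)%nat).
  { intros k. rewrite <- HN. unfold lamp. rewrite Rpower_mult.
    assert (Ep : p * / INR m = / rho) by (rewrite <- Hrho; field; split; lra). rewrite Ep.
    assert (Ir : 0 < / rho) by now apply Rinv_0_lt_compat. split; intros H.
    - assert (H' := Rpower_lt_l _ _ rho Hrho0 (conj (Rpower_pos (INR (S k)) (/ rho)) H)).
      rewrite Rpower_mult, Rinv_l, Rpower_1 in H' by (lra || apply INR_S_pos). exact H'.
    - assert (H' := Rpower_lt_l _ _ (/ rho) Ir (conj (INR_S_pos k) H)).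
      rewrite Rpower_inv_l in H' by lra. exact H'. }
  unfold n_sector, mcount. set (P := fun z : C => Cmod z < r /\ in_sector alpha beta z).
  destruct (enum_spec (ray_set m p) P r (ray_set_discrete m p Hm Hp)) as [HE1 HE2].
  { intros z [Hz _]. lra. }
  rewrite list_sum_ones.
  - transitivity (length (ray_list m p N J)).
    + apply Permutation_length. apply NoDup_Permutation; [exact HE1| |].
      * apply ray_list_NoDup; [lra|apply NoDup_filter, seq_NoDup|]. intros j Hj. now apply HJ in Hj.
      * intros z. rewrite HE2, ray_set_neq_0, ray_list_In. split.
        { intros [[k Hk] [Hz1 Hz2]]. destruct (ray_point_complete m p k z Hm Hk) as [j [Hj Ez]].
          exists k, j. subst z. rewrite Cmod_ray_point in Hz1. split; [now apply Hlt|].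
          split; [|reflexivity]. apply HJ. split; [exact Hj|].
          unfold ray_point in Hz2. apply in_sector_scale in Hz2; [exact Hz2|apply Rpower_pos]. }
        { intros [k [j [Hk [Hj ->]]]]. apply HJ in Hj. split.
          - exists k. now apply ray_point_pow.
          - split; [rewrite Cmod_ray_point; now apply Hlt|].
            unfold ray_point. apply in_sector_scale; [apply Rpower_pos|tauto]. }
    + unfold ray_list. rewrite length_map, length_prod, length_seq. reflexivity.
  - intros z Hz. apply HE2 in Hz. destruct Hz as [Hz _]. apply ray_set_neq_0 in Hz. destruct Hz as [k Hk].
    now apply ray_set_1 with k. }
exists (INR (length J)). apply is_lim_spec. intros eps.
assert (Hl := pos_INR (length J)). set (l := INR (length J)) in *.
(* With [x = Rpower r rho] the count differs from [l * x] by at most [l], so [x > y] brings the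
   error of the quotient below [eps]. *)
set (y := (l + 1) / eps). assert (Hy : 0 < y) by (apply Rdiv_lt_0_compat; [lra|apply cond_pos]).
exists (Rpower y (/ rho)). intros r Hr.
assert (Hr0 : 0 < r) by (generalize (Rpower_pos y (/ rho)); lra).
assert (Hx : y < Rpower r rho).
{ rewrite <- (Rpower_1 y) at 1 by exact Hy. rewrite <- (Rinv_l rho) by lra. rewrite <- Rpower_mult.
  apply Rpower_lt_l; [exact Hrho0|]. split; [apply Rpower_pos|exact Hr]. }
destruct (Hcount r Hr0) as [N [-> HN]]. rewrite mult_INR. fold l.
set (x := Rpower r rho) in *. assert (Hx0 : 0 < x) by lra.
assert (Hey : (l + 1) = y * eps) by (unfold y; field; apply Rgt_not_eq, cond_pos).
assert (Heps := cond_pos eps).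
replace (INR N * l / x - l) with (- ((x - INR N) * l / x)) by (field; lra).
rewrite Rabs_Ropp, Rabs_pos_eq by (apply Rdiv_le_0_compat; [apply Rmult_le_pos|]; lra).
apply Rmult_lt_reg_r with x; [exact Hx0|]. unfold Rdiv. rewrite Rmult_assoc, Rinv_l, Rmult_1_r by lra.
apply Rle_lt_trans with l; [nra|]. nra.
Qed.

Definition list_csum (l : list C) : C := fold_right Cplus (RtoC 0) l.

Lemma list_csum_perm (l l' : list C) : Permutation l l' -> list_csum l = list_csum l'.
Proof.
unfold list_csum. induction 1; simpl; trivial.
- now rewrite IHPermutation.
- ring.
- congruence.
Qed.

Lemma list_csum_scal (c : C) (g : C -> C) (l : list C) :
  list_csum (map (fun z => c * g z)%C l) = (c * list_csum (map g l))%C.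
Proof. unfold list_csum. induction l as [|z l IH]; simpl; [ring|]. rewrite IH. ring. Qed.

(* Invariance under the rotation by [omega m] multiplies each sum by
   [/ omega m ^ n <> 1]. *)
Lemma ray_set_lindelof (m n : nat) (p : R) : (0 < n < m)%nat -> 1 <= p -> lindelof n (ray_set m p).
Proof.
intros Hn Hp. assert (Hm : (0 < m)%nat) by lia.
exists (RtoC 0). apply filterlim_ext with (f := fun _ => RtoC 0).
- intros r. unfold msum. symmetry. set (P := fun z : C => 0 < Cmod z <= r).
  destruct (enum_spec (ray_set m p) P r (ray_set_discrete m p Hm Hp)) as [HE1 HE2].
  { intros z [_ Hz]. exact Hz. }
  set (E := enum (ray_set m p) P) in *.
  set (g := fun z => (RtoC (INR (ray_set m p z)) * / z ^ n)%C). change (list_csum (map g E) = RtoC 0).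
  set (w := omega m). assert (Hw : w <> RtoC 0) by apply cexp_neq_0.
  assert (Hwn : (w ^ n)%C <> RtoC 0) by now apply Cpow_nz.
  assert (Hrot : forall z, ray_set m p (w * z) = ray_set m p z).
  { intros z. unfold ray_set.
    assert (Ez : ((w * z) ^ m)%C = (z ^ m)%C).
    { rewrite Cpow_mult_l. unfold w. rewrite omega_pow_m by exact Hm. ring. }
    now rewrite Ez. }
  assert (HP : Permutation (map (fun z => w * z)%C E) E).
  { apply NoDup_Permutation; [apply NoDup_map_inj; [|exact HE1]|exact HE1|].
    - intros x y _ _ Exy. replace x with (/ w * (w * x))%C by (field; exact Hw). rewrite Exy. field. exact Hw.
    - assert (HMod : forall z, Cmod (w * z) = Cmod z).
      { intros z. rewrite Cmod_mult. unfold w. rewrite Cmod_omega. ring. }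
      intros z. rewrite in_map_iff. split.
      + intros [x [<- Hx]]. apply HE2 in Hx. apply HE2. unfold P in *. rewrite Hrot, HMod. exact Hx.
      + intros Hz. exists (/ w * z)%C. split; [field; exact Hw|]. apply HE2 in Hz. apply HE2. unfold P in *.
        rewrite <- (Hrot (/ w * z)%C), <- (HMod (/ w * z)%C).
        replace (w * (/ w * z))%C with z by (field; exact Hw). exact Hz. }
  assert (Eg : list_csum (map g E) = (/ w ^ n * list_csum (map g E))%C).
  { rewrite <- list_csum_scal. rewrite <- (list_csum_perm _ _ (Permutation_map g HP)). rewrite map_map.
    f_equal. apply map_ext_in. intros z Hz. unfold g. rewrite Hrot. apply HE2 in Hz. destruct Hz as [_ [Hz _]].
    apply Cmod_gt_0 in Hz. rewrite Cpow_mult_l. field. split; [now apply Cpow_nz|exact Hwn]. }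
  set (T := list_csum (map g E)) in *.
  assert (ET : (T * (w ^ n - 1))%C = RtoC 0).
  { rewrite Eg. replace (/ w ^ n * T * (w ^ n - 1))%C with (T - / w ^ n * T)%C by (field; exact Hwn).
    rewrite <- Eg. ring. }
  destruct (Ceq_dec T 0) as [E0|E0]; [exact E0|].
  destruct (Ceq_dec (w ^ n - 1) 0) as [E1|E1].
  + apply Cminus_eq_0 in E1. apply omega_pow_eq_1 in E1; lia.
  + exact (False_ind _ (Cmult_neq_0 _ _ E0 E1 ET)).
- apply filterlim_const.
Qed.

(** * The lower bound for [sigma_Z] and the conclusion *)

Lemma ray_type_lower_bound (m : nat) (tau rho A s : R) (f : C -> C) :
  0 < tau < 1 -> (0 < m)%nat -> rho = INR m * tau ->
  (forall delta, 0 < delta -> exists X, 0 < X /\ forall a b, a <= - X -> X <= b -> A - delta <= Aint tau a b) ->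
  0 <= s -> class_E rho s f -> zeros_are f (ray_set m (/ tau)) -> A <= s.
Proof.
intros Ht Hm Hrho HA2 Hs [Hf Hg] Hz. apply Rnot_lt_le. intros Hlt.
assert (Hp : 1 < / tau) by (rewrite <- Rinv_1; apply Rinv_lt_contravar; lra).
(* As [A = s + 4 * eps], comparing [rsum_ln_lower] with [log_lower_bound] leaves
   [2 * eps * Rpower x tau <= c] with [c] constant, which fails for large [x]. *)
set (eps := (A - s) / 4). assert (Heps : 0 < eps) by (unfold eps; lra).
destruct (Hg eps Heps) as [K HK].
assert (F0 := zeros_ray_set_0 m (/ tau) f Hm Hz).
assert (HKpos : 0 < K).
(* At 0 the growth bound reads [Cmod (f 0) <= K], because [rpow 0 rho] is 0. *)
{ apply Cmod_gt_0 in F0. specialize (HK (RtoC 0)). rewrite Cmod_0 in HK. unfold rpow in HK.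
  destruct (Rlt_dec 0 0); [lra|]. rewrite Rmult_0_r, exp_0 in HK. lra. }
assert (LB' : forall N x, 0 < x ->
  rsum (fun k => ln (1 + x / lamp (/ tau) k)) N <= ln K + (s + eps) * Rpower x tau - ln (Cmod (f (RtoC 0)))).
{ intros N x Hx. replace (Rpower x tau) with (Rpower x (/ / tau)) by now rewrite Rinv_inv.
  apply (log_lower_bound m); trivial; [lra|].
  intros z Hz0. apply Cmod_gt_0 in Hz0. specialize (HK z). rewrite rpow_pos_eq in HK by exact Hz0.
  rewrite Rinv_inv, <- Rpower_pow, Rpower_mult, <- Hrho by exact Hz0. exact HK. }
destruct (rsum_ln_lower tau A Ht HA2 eps Heps) as [X [HX H]].
set (c := ln K - ln (Cmod (f (RtoC 0)))).
set (y := Rabs c / (2 * eps) + 1). assert (Hy : 0 < y).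
{ unfold y. assert (0 <= Rabs c / (2 * eps)) by (apply Rdiv_le_0_compat; [apply Rabs_pos|lra]). lra. }
set (x := Rmax X (Rpower y (/ tau))).
assert (Hx1 : X <= x) by apply Rmax_l. assert (Hx2 : Rpower y (/ tau) <= x) by apply Rmax_r.
destruct (H x Hx1) as [n Hn]. specialize (LB' n x ltac:(lra)).
assert (Hxy : y <= Rpower x tau).
{ rewrite <- (Rpower_1 y) by exact Hy. rewrite <- (Rinv_l tau) by lra. rewrite <- Rpower_mult.
  destruct Hx2 as [Hx2| <-]; [|lra]. left. apply Rpower_lt_l; [lra|]. split; [apply Rpower_pos|exact Hx2]. }
assert (E1 : 2 * eps * Rpower x tau <= c).
{ assert (A = s + 4 * eps) by (unfold eps; field). unfold c. nra. }
assert (E2 : 2 * eps * y = Rabs c + 2 * eps) by (unfold y; field; lra).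
assert (2 * eps * y <= 2 * eps * Rpower x tau) by (apply Rmult_le_compat_l; lra).
pose proof (Rle_abs c). lra.
Qed.

(** For [rho < 1] the integer 1 serves; for [rho > 1] the least integer above [rho] does, being at
    most [rho + 1 < 2 * rho]. At [rho = 1] the open interval from 1 to 2 contains no integer. *)
Lemma symmetry_order (rho : R) : 1 / 2 < rho -> rho <> 1 -> exists m : nat, (0 < m)%nat /\ rho < INR m < 2 * rho.
Proof.
intros H1 H2. destruct (Rlt_dec rho 1) as [H|H].
- exists 1%nat. split; [lia|]. simpl. lra.
- destruct (nfloor_ex rho) as [n Hn]; [lra|]. exists (S n). split; [lia|]. rewrite S_INR. lra.
Qed.

Theorem theorem1p4 (rho : R) (hrho : 1 / 2 < rho) (hrho1 : rho <> 1) :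
  exists L : C -> nat,
    discrete_mset L /\ rho_regular rho L /\
    Rbar_lt (sigma_U rho L) (sigma_Z rho L).
Proof.
destruct (symmetry_order rho hrho hrho1) as [m [Hm Hmr]].
assert (Hm' := lt_0_INR m Hm).
set (tau := rho / INR m).
assert (Hrho : rho = INR m * tau) by (unfold tau; field; lra).
assert (Ht : 1 / 2 < tau < 1).
{ split; apply Rmult_lt_reg_l with (INR m); lra. }
assert (Hp : 1 <= / tau) by (left; rewrite <- Rinv_1; apply Rinv_lt_contravar; lra).
destruct (Aint_limit tau ltac:(lra)) as [A [HA [HA1 HA2]]].
exists (ray_set m (/ tau)). split; [now apply ray_set_discrete|split; [split|]].
- apply ray_set_density; trivial. rewrite Hrho. field. lra.
(* Since [rho = INR n] lies strictly between 0 and [INR m], the root of unity [omega m ^ n] is not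
   1. *)
- intros n En. apply ray_set_lindelof; [|exact Hp]. split.
  + apply INR_lt. simpl. lra.
  + apply INR_lt. lra.
- destruct (annihilator_exists tau rho A m Ht Hm Hrho HA HA1 HA2) as [s [f [Hs [Hf [F0 Hv]]]]].
  (* The numbers [s < A] separate the two quantities: the function from [annihilator_exists] puts
     [sigma_U] at or below [s], and [ray_type_lower_bound] puts every type competing in [sigma_Z] at
     or above [A]. *)
  apply Rbar_le_lt_trans with (Finite s).
  + rewrite sigma_U_inf. apply (proj1 (Glb_Rbar_correct _)). split; [lra|].
    exists f. split; [exact Hf|]. split; [now exists (RtoC 0)|exact Hv].
  + apply Rbar_lt_le_trans with (Finite A); [simpl; lra|].
    apply (proj2 (Glb_Rbar_correct _)). intros t [Ht0 [h [Hh Hzh]]]. simpl.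
    apply (ray_type_lower_bound m tau rho A t h); trivial. lra.
Qed.
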